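(* There is a universal constant $C>0$ such that for every $\varepsilon>0$ there are constants $C_\varepsilon>0$ and $N_\varepsilon$, depending only on $\varepsilon$, for which the following holds. Let $n \ge N_\varepsilon$, let $p$ satisfy $$C n^{-1}\log^2 n \;\le\; p \;\le\; n^{-1/2}\log^{1/4} n,$$ and let $\Delta \ge C_\varepsilon\, p^{-3/2} n^{-1/2}\log n$. Let $V$ be a set of $n$ vertices with a fixed initial coloring $V = R_0\sqcup B_0$ such that $|R_0| \ge n/2 + \Delta$, and let $G\sim G(n,p)$ be a random graph on $V$. Then, with probability at least $1-\varepsilon$, Red wins the majority dynamics on $G$ with initial sides $(R_0,B_0)$ within $O(\log_{pn} n)$ days.
   Context: $G(n,p)$ is the Erdős–Rényi random graph on $n$ vertices: each pair of vertices is joined by an edge independently with probability $p$. ''Fixed'' initial coloring means the coloring is chosen deterministically, before (and hence independently of) $G$. Majority dynamics on a simple undirected graph $G=(V,E)$ with initial sides $(R_0,B_0)$, where $V=R_0\sqcup B_0$: on day $0$ the vertices of $R_0$ are colored Red and those of $B_0$ are colored Blue. For each $t\ge 0$, on day $t+1$ every vertex simultaneously adopts the color held on day $t$ by the majority of its neighbors, and keeps its own day-$t$ color in case of a tie. $R_t$ and $B_t$ denote the sets of Red and Blue vertices on day $t$. ''Red wins within $T$ days'' means that $R_t=V$ for some $t\le T$. The implied constant in $O(\cdot)$ is absolute, and $\log$ is the natural logarithm. *)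

(* Defs.v *)
From HB Require Import structures.
From mathcomp Require Import all_boot all_order all_algebra.
From mathcomp Require Import all_classical all_reals all_analysis.
Import Order.TTheory GRing.Theory Num.Theory.

Set Implicit Arguments.
Unset Strict Implicit.
Unset Printing Implicit Defensive.

Local Open Scope ring_scope.

(* A simple graph on V is identified with its edge set, an edge being a       *)
(* two-element subset of V.                                                   *)
Definition vpair (V : finType) := {e : {set V} | #|e| == 2%N}.

Definition sgraph (V : finType) := {set vpair V}.

Definition adj (V : finType) (G : sgraph V) : rel V :=
  fun u v => [exists e : vpair V, (e \in G) && (val e == [set u; v]%SET)].

Lemma adj_sym (V : finType) (G : sgraph V) : symmetric (adj G).
Proof. by move=> u v; rewrite /adj finset.setUC. Qed.

Lemma adj_irr (V : finType) (G : sgraph V) : irreflexive (adj G).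
Proof.
move=> u; apply/negbTE/existsP => -[[e /= e2]] /andP[_ /eqP eu].
by move: e2; rewrite eu finset.setUid cards1.
Qed.

Definition nbrs_in (V : finType) (G : sgraph V) (v : V) (S : {set V}) : nat :=
  #|[set u in S | adj G v u]%SET|.

(* The coloring is represented by its set of Red vertices, the Blue ones      *)
(* being the complement.                                                      *)
Definition majority_step (V : finType) (G : sgraph V) (S : {set V}) : {set V} :=
  [set v | if (nbrs_in G v (~: S) < nbrs_in G v S)%N then true
           else if (nbrs_in G v S < nbrs_in G v (~: S))%N then false
           else v \in S]%SET.

Definition red_set (V : finType) (G : sgraph V) (R0 : {set V}) (t : nat) :
  {set V} := iter t (majority_step G) R0.

(* T is real since it is an asymptotic bound; days are natural numbers.       *)
Definition red_wins_within (R : realType) (V : finType) (G : sgraph V)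
    (R0 : {set V}) (T : R) : Prop :=
  exists t : nat, t%:R <= T /\ red_set G R0 t = [set: V]%SET.

Definition gnp_mass (R : realType) (V : finType) (p : R) (G : sgraph V) : R :=
  \prod_(e : vpair V) (if e \in G then p else 1 - p).

(* Probability of the event A under G(n, p), with n = #|V|.                   *)
Definition gnp_prob (R : realType) (V : finType) (p : R)
    (A : set (sgraph V)) : R :=
  \sum_(G : sgraph V | G \in A) gnp_mass p G.

(* Under gnp_prob each pair is an edge independently with probability p.      *)
Lemma gnp_prob_edges (R : realType) (V : finType) (p : R) (F : {set vpair V}) :
  gnp_prob p [set G : sgraph V | F \subset G]%classic = p ^+ #|F|.
Proof.
pose a (e : vpair V) : R := if e \in F then 0 else 1 - p.
transitivity (\prod_(e : vpair V) (p + a e)); last first.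
  rewrite (bigID (mem F)) /= [X in _ * X]big1 ?mulr1; last first.
    by move=> e /negbTE eF; rewrite /a eF addrC subrK.
  rewrite (eq_bigr (fun=> p)) ?prodr_const // => e eF.
  by rewrite /a eF addr0.
rewrite bigA_distr /gnp_prob big_mkcond; apply: eq_bigr => G _ /=.
rewrite /gnp_mass.
have -> : (G \in [set H : sgraph V | F \subset H]%classic) = (F \subset G).
  by apply/idP/idP; rewrite in_setE.
case: ifPn => [FG|/subsetPn[e eF eG]].
  apply: eq_bigr => e _; case: ifPn => // eG; rewrite /a.
  by case: ifPn => // /(fintype.subsetP FG); rewrite (negbTE eG).
by rewrite (bigD1 e) //= (negbTE eG) /a eF mul0r.
Qed.

Lemma gnp_prob_setT (R : realType) (V : finType) (p : R) :
  gnp_prob p [set: sgraph V]%classic = 1.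
Proof.
rewrite -(expr0 p) -(@cards0 (vpair V)) -gnp_prob_edges.
congr gnp_prob; apply/seteqP; split => // G _ /=; exact: finset.sub0set.
Qed.

(* Logarithm of x in base b; meaningful for b > 1 and x > 0.                  *)
Definition log_base (R : realType) (b x : R) : R := ln x / ln b.

(* Main.v *)
Require Import Defs.
From HB Require Import structures.
From mathcomp Require Import all_boot all_order all_algebra.
From mathcomp Require Import perm.
From mathcomp Require Import all_classical all_reals all_analysis.
From mathcomp Require Import finset ring lra zify.
Import Order.TTheory GRing.Theory Num.Theory.

Set Implicit Arguments.
Unset Strict Implicit.
Unset Printing Implicit Defensive.

Local Open Scope ring_scope.

(** Why the theorem is true.

Write n for the number of vertices and d = p n, and let sd be the square root
of d.  The dynamics is monotone in the initial red set, so the red set may be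
shrunk to a set S with about n/2 + D vertices, where D = C0 ln n / (p sd) is the
lower bound required of Delta.

Expected lead after two days.  Let S' be a subset of S with as many vertices as
the complement of S.  Exchanging the colours and relabelling the vertices shows
that the expected size of the second-day red set started from S' is n minus the
one started from S, ties included.  Hence the expected excess over n/2 of the
second-day red set started from S is half the expected number of vertices whose
second-day colours differ in the two processes ([Ex_red2]).  To bound this
number from below, fix a vertex u, reveal the graph without u first, and the
neighbourhood of u afterwards.  In the graph without u, a vertex w changes its
first-day colour when S' is replaced by S as soon as it has a neighbour in the
set Q of swing vertices and is tied on the others; the latter has probability
of order 1 / sd by a local lower bound, so about ln n / p vertices change
([flip_day1], [good_day1]).  The neighbourhood of u, independent of all this,
catches about ln n of them, so that the colour of u changes as soon as its red
and blue neighbours differ by less than ln n on the other vertices, which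
happens with probability of order ln n / sd ([separate_day2]).  The expected
excess is therefore of order n ln n / sd.

Concentration.  Conditionally on the graph without u, the probability that u
sees more red than blue on the first day is a function of the number of red
vertices only, and it is Lipschitz with constant of order p / sd.  That number
has variance O(n), because two vertices only share the edge that joins them
([Var_reach]).  For two vertices u and v, one reveals the graph without u and
v: up to events of probability O(p) the two events become conditionally
independent, and their conditional probabilities have variance O(p), so their
covariance is O(p) ([Cov_zsum]).  Chebyshev then shows that red exceeds n/2 by at
least 50 n / sd on the second day, since p n^2 is of lower order than
(n ln n / sd)^2 in the given range of p ([day2_majority]).

The following days.  Exponential moments and a union bound over all pairs of
sets show that, with high probability, every red set that large leaves at most
n / 100 blue vertices on the next day, and that any smaller blue set shrinks by
a factor sd each day ([Pr_bad_day3], [Pr_bad_shrink]).  It is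
empty after O(log n / log d) days ([blue_dies]).

All the local estimates come from one identity: integrating the indicator of an
upper level set by parts ([trunc_moment_straddle]) relates the point
probabilities of a sum of independent signs to its truncated first moment, which
is at most the standard deviation and is bounded below by any tail. *)

(** * Random subsets with independent coordinates *)
Section ProductSpace.
Variables (R : realType) (I : finType).
Implicit Types (p : I -> R) (A B J : {set I}) (F H : {set I} -> R).

(** The probabilities [p i] may depend on [i]: tilted laws are needed below for
    the lower bounds on tails. *)
Definition mass p A : R := \prod_i (if i \in A then p i else 1 - p i).

Definition Ex p F : R := \sum_A mass p A * F A.

Lemma eq_Ex p F H : F =1 H -> Ex p F = Ex p H.
Proof. by move=> FH; apply: eq_bigr => A _; rewrite FH. Qed.

Lemma ExD p F H : Ex p (fun A => F A + H A) = Ex p F + Ex p H.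
Proof. by rewrite -big_split; apply: eq_bigr => A _; rewrite mulrDr. Qed.

Lemma ExZ p c F : Ex p (fun A => c * F A) = c * Ex p F.
Proof. by rewrite mulr_sumr; apply: eq_bigr => A _; rewrite mulrCA. Qed.

Lemma ExZr p c F : Ex p (fun A => F A * c) = Ex p F * c.
Proof. by rewrite mulrC -ExZ; apply: eq_Ex => A; rewrite mulrC. Qed.

Lemma ExB p F H : Ex p (fun A => F A - H A) = Ex p F - Ex p H.
Proof. by rewrite -mulN1r -ExZ -ExD; apply: eq_Ex => A; rewrite mulN1r. Qed.

Lemma Ex_sum p (T : Type) (r : seq T) (P : pred T) (F : T -> {set I} -> R) :
  Ex p (fun A => \sum_(t <- r | P t) F t A) = \sum_(t <- r | P t) Ex p (F t).
Proof.
by rewrite exchange_big; apply: eq_bigr => A _; rewrite mulr_sumr.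
Qed.

Lemma Ex_prod p (h : I -> bool -> R) :
  Ex p (fun A => \prod_i h i (i \in A)) =
  \prod_i (p i * h i true + (1 - p i) * h i false).
Proof.
rewrite bigA_distr; apply: eq_bigr => A _.
by rewrite -big_split; apply: eq_bigr => i _ /=; case: (i \in A).
Qed.

Lemma Ex1 p : Ex p (fun=> 1) = 1.
Proof.
transitivity (Ex p (fun A => \prod_(i : I) 1)).
  by apply: eq_Ex => A; rewrite big1.
rewrite (Ex_prod p (fun _ _ => 1)) big1 // => i _.
by rewrite !mulr1 addrC subrK.
Qed.

Lemma Ex_cst p c : Ex p (fun=> c) = c.
Proof.
by rewrite -[RHS]mulr1 -(Ex1 p) -ExZ; apply: eq_Ex => A; rewrite mulr1.
Qed.

Definition mix J A B := (A :&: J) :|: (B :\: J).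

Lemma in_mix J A B i : (i \in mix J A B) = if i \in J then i \in A else i \in B.
Proof. by rewrite !inE; case: (i \in J); rewrite ?(andbT, andbF, orbF). Qed.

(** Exchanging the coordinates outside [J] of two independent samples
    preserves their joint law.  This resampling identity stands for
    conditioning on the coordinates in [J]. *)
Lemma Ex_mix p J F : Ex p F = Ex p (fun A => Ex p (fun B => F (mix J A B))).
Proof.
transitivity (\sum_(AB : {set I} * {set I}) mass p AB.1 * (mass p AB.2 * F AB.1)).
  rewrite -(pair_big predT predT (fun A B => mass p A * (mass p B * F A))) /=.
  apply: eq_bigr => A _; rewrite -mulr_sumr; congr (_ * _).
  rewrite -mulr_suml -[LHS]mul1r -(Ex1 p); congr (_ * _).
  by apply: eq_bigr => B _; rewrite mulr1.
transitivity (\sum_(AB : {set I} * {set I})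
    mass p AB.1 * (mass p AB.2 * F (mix J AB.1 AB.2))); last first.
  rewrite -(pair_big predT predT
    (fun A B => mass p A * (mass p B * F (mix J A B)))) /=.
  by apply: eq_bigr => A _; rewrite -mulr_sumr.
pose sw (AB : {set I} * {set I}) := (mix J AB.1 AB.2, mix J AB.2 AB.1).
have swK : cancel sw sw.
  move=> [A B]; rewrite /sw /=; congr pair; apply/setP => i; rewrite !in_mix /=;
    by case: (i \in J).
rewrite (reindex_inj (can_inj swK)); apply: eq_bigr => -[A B] _ /=.
rewrite !mulrA; congr (_ * _); rewrite -!big_split; apply: eq_bigr => i _ /=.
by rewrite !in_mix; case: (i \in J) => //; rewrite mulrC.
Qed.

Definition dep J (T : Type) (F : {set I} -> T) :=
  forall A B, {in J, forall i, (i \in A) = (i \in B)} -> F A = F B.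

Lemma dep_sub J J' T (F : {set I} -> T) : J \subset J' -> dep J F -> dep J' F.
Proof.
by move=> /fintype.subsetP JJ' dF A B AB; apply: dF => i /JJ' /AB.
Qed.

Lemma Ex_indep p J F H : dep J F -> dep (~: J) H ->
  Ex p (fun A => F A * H A) = Ex p F * Ex p H.
Proof.
move=> dF dH; rewrite (Ex_mix p J) -ExZr; apply: eq_Ex => A.
rewrite -ExZ; apply: eq_Ex => B; congr (_ * _).
  by apply: dF => i iJ; rewrite in_mix iJ.
by apply: dH => i; rewrite inE in_mix => /negbTE ->.
Qed.

Lemma Ex_in p i : Ex p (fun A => (i \in A)%:R) = p i.
Proof.
transitivity (Ex p (fun A =>
    \prod_j (if j == i then (j \in A)%:R else 1 : R))).
  apply: eq_Ex => A; rewrite (bigD1 i) //= eqxx big1 ?mulr1 // => j /negbTE.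
  by move=> ->.
rewrite (Ex_prod p (fun j b => if j == i then b%:R else 1)).
rewrite (bigD1 i) //= eqxx mulr1 mulr0 addr0 big1 ?mulr1 // => j /negbTE ->.
by rewrite !mulr1 addrC subrK.
Qed.

Lemma Ex_coord p i F :
  Ex p F = p i * Ex p (fun A => F (i |: A)) +
           (1 - p i) * Ex p (fun A => F (A :\ i)).
Proof.
have -> : Ex p F = Ex p (fun A => (i \in A)%:R * F (i |: A)) +
                   Ex p (fun A => (i \notin A)%:R * F (A :\ i)).
  rewrite -ExD; apply: eq_Ex => A; case: (boolP (i \in A)) => iA.
    rewrite mul1r mul0r addr0; congr F; apply/setP => j; rewrite !inE.
    by case: eqP => //= ->.
  rewrite mul0r mul1r add0r; congr F; apply/setP => j; rewrite !inE.
  by case: eqP => //= ->; apply/negbTE.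
have di b (f : bool -> R) : dep [set i] (fun A => f (i \in A) * b).
  by move=> A B AB; rewrite AB // inE.
rewrite (@Ex_indep p [set i]) ?(@Ex_indep p [set i] _ (fun A => F (A :\ i))).
- rewrite Ex_in; congr (_ + _ * _).
  rewrite -[in RHS](Ex1 p) -(Ex_in p i) -ExB; apply: eq_Ex => A.
  by case: (i \in A); rewrite ?subrr ?subr0.
- by move=> A B AB; rewrite AB // inE.
- move=> A B AB; congr F; apply/setP => j; rewrite !inE.
  by case: (altP (j =P i)) => //= ji; rewrite AB // !inE.
- by move=> A B AB; rewrite AB // inE.
- move=> A B AB; congr F; apply/setP => j; rewrite !inE.
  by case: (altP (j =P i)) => //= ji; rewrite AB // !inE.
Qed.

(** The Bernoulli integration by parts: a centred coordinate acts as a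
    discrete derivative. *)
Lemma Ex_centred p i F :
  Ex p (fun A => ((i \in A)%:R - p i) * F A) =
  p i * (1 - p i) * (Ex p (fun A => F (i |: A)) - Ex p (fun A => F (A :\ i))).
Proof.
rewrite (Ex_coord p i).
under eq_Ex do rewrite setU11.
under [in X in _ + X]eq_Ex do rewrite setD11.
rewrite !ExZ /=; ring.
Qed.

Section Nonneg.
Variable p : I -> R.
Hypothesis p01 : forall i, 0 <= p i <= 1.

Lemma mass_ge0 A : 0 <= mass p A.
Proof.
by apply: prodr_ge0 => i _; case/andP: (p01 i) => ? ?; case: ifP; lra.
Qed.

Lemma ler_Ex F H : (forall A, F A <= H A) -> Ex p F <= Ex p H.
Proof.
by move=> FH; apply: ler_sum => A _; apply: ler_wpM2l => //; apply: mass_ge0.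
Qed.

Lemma Ex_ge0 F : (forall A, 0 <= F A) -> 0 <= Ex p F.
Proof. by move=> F0; rewrite -(Ex_cst p 0); apply: ler_Ex. Qed.

Lemma Ex_ub F c : (forall A, F A <= c) -> Ex p F <= c.
Proof. by move=> Fc; rewrite -[leRHS](Ex_cst p); apply: ler_Ex. Qed.

Lemma Ex_abs F : `|Ex p F| <= Ex p (fun A => `|F A|).
Proof.
apply: le_trans (ler_norm_sum _ _ _) _; apply: ler_sum => A _.
by rewrite normrM (ger0_norm (mass_ge0 A)).
Qed.

Definition Var F := Ex p (fun A => (F A - Ex p F) ^+ 2).

Lemma VarE F : Var F = Ex p (fun A => F A ^+ 2) - (Ex p F) ^+ 2.
Proof.
rewrite /Var; set m := Ex p F.
transitivity (Ex p (fun A => (F A ^+ 2 + (- (2 * m)) * F A) + m ^+ 2)).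
  by apply: eq_Ex => A; ring.
rewrite !ExD ExZ Ex_cst -/m; ring.
Qed.

Lemma Ex_chebyshev F (t : R) : 0 < t ->
  Ex p (fun A => (t <= `|F A - Ex p F|)%R%:R) <= Var F / t ^+ 2.
Proof.
move=> t0; rewrite ler_pdivlMr ?exprn_gt0 // -ExZr; apply: ler_Ex => A.
case: (boolP (t <= _)) => [tF|_]; last by rewrite mul0r sqr_ge0.
rewrite mul1r -(real_normK (num_real (F A - _))).
by rewrite ler_sqr ?nnegrE // ltW.
Qed.

Lemma Cov_le F H :
  Ex p (fun A => F A * H A) - Ex p F * Ex p H <= (Var F + Var H) / 2.
Proof.
set a := Ex p F; set b := Ex p H.
have -> : Ex p (fun A => F A * H A) - a * b =
          Ex p (fun A => (F A - a) * (H A - b)).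
  transitivity (Ex p (fun A => (F A * H A + (- b) * F A) + ((- a) * H A + a * b))).
    rewrite !ExD !ExZ Ex_cst -/a -/b; ring.
  by apply: eq_Ex => A; ring.
rewrite /Var -ExD -ExZr -/a -/b; apply: ler_Ex => A.
have := sqr_ge0 ((F A - a) - (H A - b)); lra.
Qed.

(** A Lipschitz image has a smaller variance: compare two independent
    copies. *)
Lemma Var_comp_le F H (l : R) : (forall A B, `|F A - F B| <= l * `|H A - H B|) ->
  Var F <= l ^+ 2 * Var H.
Proof.
move=> FH.
have two K : Ex p (fun A => Ex p (fun B => (K A - K B) ^+ 2)) = 2 * Var K.
  have e1 A : Ex p (fun B => (K A - K B) ^+ 2) =
     (K A ^+ 2 + (- (2 * Ex p K)) * K A) + Ex p (fun B => K B ^+ 2).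
    transitivity (Ex p (fun B => K A ^+ 2 + ((- (2 * K A)) * K B + K B ^+ 2))).
      by apply: eq_Ex => B; ring.
    rewrite !ExD Ex_cst ExZ; ring.
  rewrite (eq_Ex _ e1) !ExD Ex_cst ExZ VarE; ring.
suff : 2 * Var F <= l ^+ 2 * (2 * Var H) by lra.
rewrite -!two -ExZ; apply: ler_Ex => A; rewrite -ExZ; apply: ler_Ex => B.
rewrite -exprMn -(real_normK (num_real (F A - F B))).
rewrite -(real_normK (num_real (l * _))) normrM.
rewrite ler_sqr ?nnegrE ?mulr_ge0 //; apply: le_trans (FH A B) _.
by apply: ler_wpM2r => //; apply: ler_norm.
Qed.

End Nonneg.

End ProductSpace.

Lemma const01 (R : realType) (I : Type) (p : R) :
  0 <= p <= 1 -> forall i : I, 0 <= (fun=> p) i <= 1.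
Proof. by []. Qed.

Lemma prob_le_half (R : realType) (p : R) : 0 < p -> p <= 2^-1 -> 0 <= p <= 1.
Proof. by move=> p0 p2; apply/andP; split; lra. Qed.

Lemma prob_le_tenth (R : realType) (p : R) : 0 < p -> p <= 10^-1 -> 0 <= p <= 1.
Proof. by move=> p0 p2; apply/andP; split; lra. Qed.

(** * Probabilities and change of measure *)
Section Probability.
Variables (R : realType) (I : finType).
Implicit Types (p q : I -> R) (A B : {set I}) (E : pred {set I}).

Definition Pr p E : R := Ex p (fun A => (E A)%:R).

Lemma Pr_coord p i E :
  Pr p E = p i * Pr p (fun A => E (i |: A)) +
           (1 - p i) * Pr p (fun A => E (A :\ i)).
Proof. exact: Ex_coord. Qed.

Lemma PrC p E : Pr p (fun A => ~~ E A) = 1 - Pr p E.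
Proof.
rewrite /Pr -[X in X - _](Ex1 p) -ExB; apply: eq_Ex => A.
by case: (E A); rewrite /= ?subrr ?subr0.
Qed.

Section Nonneg.
Variable p : I -> R.
Hypothesis p01 : forall i, 0 <= p i <= 1.

Lemma Pr_ge0 E : 0 <= Pr p E.
Proof. by apply: Ex_ge0 => // A; apply: ler0n. Qed.

Lemma le_Pr E E' : (forall A, E A -> E' A) -> Pr p E <= Pr p E'.
Proof.
move=> EE'; apply: ler_Ex => // A; rewrite ler_nat.
by case: (E A) (EE' A) => // ->.
Qed.

Lemma PrU E E' : Pr p (fun A => E A || E' A) <= Pr p E + Pr p E'.
Proof.
rewrite /Pr -ExD; apply: ler_Ex => // A; rewrite -natrD ler_nat.
by case: (E A); case: (E' A).
Qed.

End Nonneg.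

(** An event that is likely under [q] keeps a probability
    bounded below under [p], as soon as the chi-square type product, which is
    the second moment of the density of [q], is bounded. *)
Lemma change_of_measure p q E (chi : R) :
  (forall i, 0 < p i < 1) -> (forall i, 0 <= q i <= 1) -> 0 < chi ->
  \prod_i (1 + (q i - p i) ^+ 2 / (p i * (1 - p i))) <= chi ->
  Pr q E - 4^-1 <= chi * Pr p E.
Proof.
move=> p01 q01 chi0 chiP.
have p01' i : 0 <= p i <= 1 by case/andP: (p01 i) => /ltW-> /ltW->.
have m0 A : 0 < mass p A.
  by apply: prodr_gt0 => i _; case/andP: (p01 i) => ? ?; case: ifP; lra.
have e1 : \sum_A mass q A ^+ 2 / mass p A <= chi.
  apply: le_trans chiP; rewrite le_eqVlt; apply/orP; left; apply/eqP.
  transitivity (\prod_i (q i ^+ 2 / p i + (1 - q i) ^+ 2 / (1 - p i))).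
    rewrite bigA_distr; apply: eq_bigr => A _.
    rewrite /mass -prodrXl -prodf_div; apply: eq_bigr => i _.
    by case: (i \in A).
  apply: eq_bigr => i _; case/andP: (p01 i) => h1 h2.
  by field; rewrite !subr_eq0 !gt_eqF.
have e2 : \sum_A (chi * (mass p A * (E A)%:R) +
            (mass q A ^+ 2 / mass p A) / (4 * chi)) <= chi * Pr p E + 4^-1.
  rewrite big_split /= -mulr_sumr lerD2l -mulr_suml.
  rewrite ler_pdivrMr ?mulr_gt0 // mulrA mulVf ?mul1r //.
(* Pointwise q <= chi p + q^2 / (4 chi p), an instance of the inequality between
   arithmetic and geometric means. *)
suff : Pr q E <= chi * Pr p E + 4^-1 by lra.
apply: le_trans e2; apply: ler_sum => A _.
have d0 : 0 <= mass q A ^+ 2 / mass p A / (4 * chi).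
  by rewrite !divr_ge0 ?sqr_ge0 ?mulr_ge0 // ltW.
case: (E A); rewrite ?mulr1 ?mulr0 ?add0r //.
rewrite -subr_ge0.
have -> : chi * mass p A + mass q A ^+ 2 / mass p A / (4 * chi) - mass q A =
   (2 * chi * mass p A - mass q A) ^+ 2 / (4 * chi * mass p A).
  by field; rewrite !gt_eqF.
by rewrite divr_ge0 ?sqr_ge0 ?mulr_ge0 // ltW.
Qed.

(** * Linear statistics *)

Definition lin (c : I -> int) A : int := \sum_(i in A) c i.

Lemma linE (c : I -> int) A :
  (lin c A)%:~R = \sum_i (c i)%:~R * (i \in A)%:R :> R.
Proof.
rewrite /lin big_mkcond /= rmorph_sum /=; apply: eq_bigr => i _.
by case: ifP; rewrite ?mulr1 ?mulr0.
Qed.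

Lemma lin_setU1 (c : I -> int) i A : lin c (i |: A) = c i + lin c (A :\ i).
Proof.
rewrite /lin (big_setD1 i) ?setU11 //=; congr (_ + _).
apply: eq_bigl => j; rewrite !inE; by case: eqP.
Qed.

Lemma Ex_lin p c : Ex p (fun A => (lin c A)%:~R) = \sum_i (c i)%:~R * p i.
Proof.
rewrite (eq_Ex _ (linE c)) Ex_sum; apply: eq_bigr => i _.
by rewrite ExZ Ex_in.
Qed.

Lemma lin_centred p c A : (lin c A)%:~R - Ex p (fun A => (lin c A)%:~R) =
  \sum_i (c i)%:~R * ((i \in A)%:R - p i).
Proof.
by rewrite Ex_lin linE -sumrB; apply: eq_bigr => i _; rewrite mulrBr.
Qed.

(** The identity [Ex_centred], added over the coordinates. *)
Lemma Ex_lin_centred p c F :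
  Ex p (fun A => ((lin c A)%:~R - Ex p (fun A => (lin c A)%:~R)) * F A) =
  \sum_i p i * (1 - p i) * (Ex p (fun A => (c i)%:~R * (F (i |: A) - F (A :\ i)))).
Proof.
transitivity (Ex p (fun A => \sum_i (c i)%:~R * (((i \in A)%:R - p i) * F A))).
  apply: eq_Ex => A; rewrite lin_centred mulr_suml.
  by apply: eq_bigr => i _; rewrite mulrA.
rewrite Ex_sum; apply: eq_bigr => i _.
by rewrite !ExZ Ex_centred ExB; ring.
Qed.

Lemma Var_lin p c :
  Var p (fun A => (lin c A)%:~R) = \sum_i (c i)%:~R ^+ 2 * (p i * (1 - p i)).
Proof.
rewrite /Var; under eq_Ex do rewrite expr2.
rewrite Ex_lin_centred; apply: eq_bigr => i _.
rewrite mulrC; congr (_ * _).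
transitivity (Ex p (fun=> (c i)%:~R ^+ 2)); last by rewrite Ex_cst.
apply: eq_Ex => A; rewrite lin_setU1 rmorphD /=; ring.
Qed.

End Probability.

(** * Anticoncentration of sums of independent signs *)
Section Anticoncentration.
Variables (R : realType) (I : finType) (p : R) (c : I -> int).
Hypothesis p0 : 0 < p.
Hypothesis p2 : p <= 2^-1.
Hypothesis c1 : forall i, `|c i| <= 1.

Let pc := fun _ : I => p.
Let m := #|[set i | c i != 0]|.
Let mu := Ex pc (fun A => (lin c A)%:~R).

Let pc01 : forall i, 0 <= pc i <= 1 := const01 (prob_le_half p0 p2).

Lemma unit_int_cases i : [\/ c i = 0, c i = 1 | c i = -1].
Proof.
by have := c1 i; case: (c i) => [[|[|k]]|[|k]] //= _;
  [apply: Or31|apply: Or32|apply: Or33].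
Qed.

Lemma sum_sqr_unit (x : R) : \sum_i (c i)%:~R ^+ 2 * x = m%:R * x.
Proof.
rewrite -mulr_suml; congr (_ * _).
rewrite /m -sum1_card natr_sum [in RHS]big_mkcond /=; apply: eq_bigr => i _.
by rewrite inE; case: (unit_int_cases i) => ->; rewrite ?expr0n ?expr1n ?sqrrN ?expr1n.
Qed.

Lemma Var_unit_sum : Var pc (fun A => (lin c A)%:~R) = m%:R * (p * (1 - p)).
Proof. by rewrite Var_lin; apply: (sum_sqr_unit (p * (1 - p))). Qed.

(** For [c i != 0]: the levels [k] and [k + 1] are the two values taken by the sum when the
    membership of [i] varies. *)
Definition straddle (k : int) i (A : {set I}) :=
  (lin c (A :\ i) <= k < lin c (A :\ i) + c i) ||
  (lin c (A :\ i) + c i <= k < lin c (A :\ i)).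

Let T (k : int) := Ex pc (fun A => ((lin c A)%:~R - mu) * (k < lin c A)%R%:R).

(** Integration by parts against the indicator of an upper level set: the
    truncated first moment counts the coordinates at which the sum
    straddles [k]. *)
Lemma trunc_moment_straddle (k : int) :
  T k = p * (1 - p) * \sum_(i | c i != 0) Pr pc (straddle k i).
Proof.
rewrite /T Ex_lin_centred [in RHS]big_mkcond mulr_sumr; apply: eq_bigr => i _.
congr (_ * _); case: ifPn => [ci|]; last first.
  by rewrite negbK => /eqP ->; rewrite -[RHS](Ex_cst pc); apply: eq_Ex => A; rewrite mul0r.
apply: eq_Ex => A; rewrite lin_setU1 /straddle.
set z := lin c (A :\ i); case: (unit_int_cases i) ci => -> // _.
- have -> : (z + 1 <= k < z) = false by lia.
  rewrite orbF mul1r; case: (boolP (k < 1 + z)) => h1; case: (boolP (k < z)) => h2;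
    case: (boolP (z <= k < z + 1)) => h3; rewrite /= ?subrr ?subr0 ?sub0r //; exfalso; lia.
- have -> : (z <= k < z + -1) = false by lia.
  rewrite orFb mulrN1z mulN1r opprB; case: (boolP (z + -1 <= k < z)) => h3;
    case: (boolP (k < -1 + z)) => h1; case: (boolP (k < z)) => h2;
    rewrite /= ?subrr ?subr0 ?sub0r //; exfalso; lia.
Qed.

(** By Cauchy-Schwarz the truncated moment is at most the standard
    deviation. *)
Lemma trunc_moment_le (k : int) : 0 < m%:R * (p * (1 - p)) -> T k <= Num.sqrt (m%:R * (p * (1 - p))).
Proof.
set V := m%:R * _ => V0; set s := Num.sqrt V.
have s0 : 0 < s by rewrite sqrtr_gt0.
have sV : s ^+ 2 = V by rewrite sqr_sqrtr // ltW.
have -> : s = (s^-1 * V + s) / 2 by rewrite -sV; field; rewrite gt_eqF.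
have -> : V = Ex pc (fun A => ((lin c A)%:~R - mu) ^+ 2) by exact: (esym Var_unit_sum).
rewrite -ExZ -[X in _ + X](Ex_cst pc) -ExD -ExZr.
apply: ler_Ex => [|A]; first exact: pc01.
set x := _ - mu.
have h : `|x| <= (s^-1 * x ^+ 2 + s) / 2.
  rewrite -subr_ge0.
  have -> : (s^-1 * x ^+ 2 + s) / 2 - `|x| = (`|x| - s) ^+ 2 / (2 * s).
    by rewrite -[x ^+ 2]real_normK ?num_real //; field; rewrite gt_eqF.
  by rewrite divr_ge0 ?sqr_ge0 // mulr_ge0 // ltW.
apply: le_trans h; case: (k < _); rewrite ?mulr1 ?mulr0 //.
exact: ler_norm.
Qed.

(** Littlewood-Offord type bound: when the sum equals [k], every coordinate of
    the support straddles [k] or [k - 1], and the average number of straddling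
    coordinates is controlled by [trunc_moment_le]. *)
Lemma lin_point_ub (s : R) (k : int) : 0 < s -> s ^+ 2 <= m%:R * (p * (1 - p)) ->
  Pr pc (fun A => lin c A == k) <= 2 / s.
Proof.
move=> s0 sV; set V := m%:R * (p * (1 - p)) in sV.
have V0 : 0 < V by apply: lt_le_trans sV; rewrite exprn_gt0.
pose P := Pr pc (fun A => lin c A == k).
have h : V * P <= T k + T (k - 1).
  rewrite !trunc_moment_straddle -mulrDr -big_split /= /V.
  have -> : m%:R * (p * (1 - p)) * P = p * (1 - p) * (m%:R * P) by ring.
  apply: ler_wpM2l; first by move: p0 p2 => h0 h2; rewrite mulr_ge0 //; lra.
  rewrite /m -sum1_card natr_sum mulr_suml.
  rewrite [leLHS](eq_bigl (fun i => c i != 0)) => [|i]; last by rewrite inE.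
  apply: ler_sum => i ci; rewrite mul1r /P /Pr -ExD.
  apply: ler_Ex => [|A]; first exact: pc01.
  rewrite -natrD ler_nat; case: eqP => //= Ak.
  rewrite /straddle; have := lin_setU1 c i A.
  case: (boolP (i \in A)) => iA.
    have -> : i |: A = A by apply/setP => j; rewrite !inE; case: eqP => [->|].
    set z := lin c (A :\ i); rewrite Ak.
    case: (unit_int_cases i) ci => -> // _ h.
      suff -> : (z <= k - 1 < z + 1) by rewrite orTb; lia.
      lia.
    suff -> : (z + -1 <= k < z) by rewrite orbT.
    lia.
  have -> : A :\ i = A.
    by apply/setP => j; rewrite !inE; case: eqP => [->|] //=; rewrite (negbTE iA).
  rewrite Ak => _; case: (unit_int_cases i) ci => -> // _.
    suff -> : (k <= k < k + 1) by [].
    lia.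
  suff -> : (k + -1 <= k - 1 < k) by rewrite orbT; lia.
  lia.
have := le_trans h (lerD (trunc_moment_le k V0) (trunc_moment_le (k - 1) V0)).
set r := Num.sqrt _; have r0 : 0 < r by rewrite sqrtr_gt0.
have rV : r ^+ 2 = V by rewrite sqr_sqrtr // ltW.
have sr : s <= r.
  by apply: le_trans (ler_wsqrtr sV); rewrite sqrtr_sqr ler_norm.
move=> h2; have : P <= 2 / r.
  rewrite ler_pdivlMr // -(ler_pM2l r0).
  have -> : r * (P * r) = V * P by rewrite -rV; ring.
  by apply: le_trans h2 _; lra.
move/le_trans; apply; apply: ler_wpM2l => //.
by rewrite lef_pV2 ?posrE.
Qed.

End Anticoncentration.

(** * Tails and local lower bounds *)
Section Tails.
Variables (R : realType) (I : finType).
Implicit Types (p : R) (c : I -> int).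

(** Lower bound for the probability of exceeding the mean by [a] times [s].  The
    tilted mean lies [a + 3] times [s] above the mean, so that Chebyshev applies
    to the tilted law with a margin of three. *)
Definition tail_cst (a : R) : R := expR (- (2 * (a + 3) ^+ 2)) / 2.

Lemma tail_cst_gt0 a : 0 < tail_cst a.
Proof. by rewrite divr_gt0 ?expR_gt0. Qed.

(** Tilting every coordinate by a relative amount of order [s^-1] moves the
    mean by several standard deviations, at a bounded cost. *)
Lemma lin_upper_tail p c (a s : R) : 0 < p -> p <= 2^-1 ->
  (forall i, `|c i| <= 1) -> 0 <= a -> a + 3 <= s ->
  s ^+ 2 = p * #|[set i | c i != 0]|%:R ->
  tail_cst a <=
    Pr (fun=> p) (fun X => Ex (fun=> p) (fun A => (lin c A)%:~R) + a * s <= (lin c X)%:~R).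
Proof.
move=> p0 p2 c1 a0 as_ sE; set pc : I -> R := fun=> p; set mu := Ex pc _.
have s0 : 0 < s by lra.
have pc01 i : 0 < pc i < 1 by rewrite /pc; apply/andP; split; lra.
pose dlt := (a + 3) / s.
have dlt0 : 0 <= dlt by rewrite divr_ge0; lra.
have dlt1 : dlt <= 1 by rewrite ler_pdivrMr // mul1r.
pose q i : R := p * (1 + (c i)%:~R * dlt).
have sumc (x : R) : \sum_i (c i)%:~R ^+ 2 * x = #|[set i | c i != 0]|%:R * x.
  exact: sum_sqr_unit.
have cR i : [\/ (c i)%:~R = 0 :> R, (c i)%:~R = 1 :> R | (c i)%:~R = -1 :> R].
  by case: (unit_int_cases c1 i) => ->; [apply: Or31|apply: Or32|apply: Or33].
have q01 i : 0 <= q i <= 1.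
  rewrite /q; have pd : p * dlt <= p by rewrite -[leRHS]mulr1 ler_pM2l.
  have pd0 : 0 <= p * dlt by rewrite mulr_ge0 // ltW.
  case: (cR i) => ->; apply/andP; split; lra.
pose chi := expR (2 * (a + 3) ^+ 2).
have chiP : \prod_i (1 + (q i - pc i) ^+ 2 / (pc i * (1 - pc i))) <= chi.
  have -> : chi = \prod_i expR ((c i)%:~R ^+ 2 * (2 * p * dlt ^+ 2)).
    rewrite -expR_sum sumc /chi; congr expR.
    have [pn0 mn0] : p != 0 /\ #|[set i | c i != 0]|%:R != 0 :> R.
      have := exprn_gt0 2 s0; rewrite sE => /lt0r_neq0.
      by rewrite mulf_eq0 negb_or => /andP.
    by rewrite /dlt expr_div_n sE; field; rewrite pn0 mn0.
  apply: ler_prod => i _; apply/andP; split.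
    by rewrite addr_ge0 // divr_ge0 ?sqr_ge0 // mulr_ge0 //; rewrite /pc; lra.
  apply: le_trans (expR_ge1Dx _); rewrite lerD2l /pc /q.
  rewrite ler_pdivrMr; last by rewrite mulr_gt0 //; lra.
  have -> : (p * (1 + (c i)%:~R * dlt) - p) ^+ 2 = (c i)%:~R ^+ 2 * dlt ^+ 2 * p ^+ 2.
    by ring.
  have -> : (c i)%:~R ^+ 2 * (2 * p * dlt ^+ 2) * (p * (1 - p)) =
     (c i)%:~R ^+ 2 * dlt ^+ 2 * (p ^+ 2 * (2 * (1 - p))) by ring.
  apply: ler_wpM2l; first by rewrite mulr_ge0 ?sqr_ge0.
  by rewrite ler_peMr ?sqr_ge0 //; lra.
have := @change_of_measure R I pc q
  (fun X => mu + a * s <= (lin c X)%:~R) chi pc01 q01 (expR_gt0 _) chiP.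
set P := Pr pc _; set Q := Pr q _ => QP.
suff Q1 : 3 / 4 <= Q.
  have h : 2^-1 <= chi * P by lra.
  rewrite /tail_cst expRN -/chi.
  by rewrite -(ler_pM2l (expR_gt0 _ : 0 < chi)) mulrA mulfV ?mul1r // gt_eqF ?expR_gt0.
pose nu := Ex q (fun A => (lin c A)%:~R).
have nuE : nu = mu + (a + 3) * s.
  rewrite /nu /mu !Ex_lin.
  transitivity (\sum_i ((c i)%:~R * p + (c i)%:~R ^+ 2 * (p * dlt)) : R).
    by apply: eq_bigr => i _; rewrite /q; ring.
  rewrite big_split /= sumc; congr (_ + _).
  have -> : #|[set i | c i != 0]|%:R * (p * dlt) = s ^+ 2 * dlt by rewrite sE; ring.
  by rewrite /dlt; field; rewrite gt_eqF.
have Vq : Var q (fun A => (lin c A)%:~R) <= 2 * s ^+ 2.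
  have -> : 2 * s ^+ 2 = \sum_i (c i)%:~R ^+ 2 * (2 * p) by rewrite sumc sE; ring.
  rewrite Var_lin; apply: ler_sum => i _; apply: ler_wpM2l; first exact: sqr_ge0.
  case/andP: (q01 i) => h1 h2.
  apply: (@le_trans _ _ (q i)); first by rewrite ler_piMr //; lra.
  rewrite /q mulrC ler_pM2r //.
  by case: (cR i) => ->; lra.
have s3 : 0 < 3 * s by lra.
have := Ex_chebyshev q01 (fun A => (lin c A)%:~R) s3; rewrite -/nu => ch.
have QC : 1 - Q <= 2 / 9.
  rewrite /Q -PrC; apply: le_trans (_ : Var q (fun A => (lin c A)%:~R) / (3 * s) ^+ 2 <= _).
    apply: le_trans ch; apply: le_Pr => // A; rewrite -ltNge => hA.
    rewrite distrC; apply: le_trans (ler_norm _).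
    rewrite nuE; lra.
  rewrite ler_pdivrMr ?exprn_gt0 //; apply: le_trans Vq _.
  rewrite exprMn; lra.
lra.
Qed.

Lemma lin_opp c (A : {set I}) : lin (fun i => - c i) A = - lin c A.
Proof. by rewrite /lin sumrN. Qed.

Lemma lin_lower_tail p c (a s : R) : 0 < p -> p <= 2^-1 ->
  (forall i, `|c i| <= 1) -> 0 <= a -> a + 3 <= s ->
  s ^+ 2 = p * #|[set i | c i != 0]|%:R ->
  tail_cst a <=
    Pr (fun=> p) (fun X => (lin c X)%:~R <= Ex (fun=> p) (fun A => (lin c A)%:~R) - a * s).
Proof.
move=> p0 p2 c1 a0 as_ sE; set pc : I -> R := fun=> p.
have suppN : [set i | - c i != 0] = [set i | c i != 0].
  by apply/setP => i; rewrite !inE oppr_eq0.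
have := @lin_upper_tail p (fun i => - c i) a s p0 p2 _ a0 as_ _.
rewrite suppN => /(_ _ sE) h; apply: le_trans (h _) _ => [i|].
  by rewrite normrN.
apply: le_Pr => [i|A]; first by rewrite /pc; apply/andP; split; lra.
rewrite lin_opp rmorphN /=.
have -> : Ex (fun=> p) (fun A => (lin (fun i => - c i) A)%:~R) =
    - Ex pc (fun A => (lin c A)%:~R).
  rewrite -mulN1r -ExZ; apply: eq_Ex => B; by rewrite lin_opp rmorphN mulN1r.
lra.
Qed.

(** Local lower bound: two consecutive values within [a] standard deviations
    of the mean carry a mass of order [s^-1].  The truncated first moment is
    bounded below by a tail, and every coordinate that straddles [k] leaves
    the sum at [k] or [k + 1] when it is removed. *)
Lemma lin_point_lb p c (a s : R) (k : int) : 0 < p -> p <= 2^-1 ->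
  (forall i, `|c i| <= 1) -> 1 <= a -> a + 3 <= s ->
  s ^+ 2 = p * #|[set i | c i != 0]|%:R ->
  `|k%:~R - Ex (fun=> p) (fun A => (lin c A)%:~R)| < a * s ->
  tail_cst a / s <= Pr (fun=> p) (fun X => (lin c X == k) || (lin c X == k + 1)).
Proof.
move=> p0 p2 c1 a1 as_ sE; set pc : I -> R := fun=> p; set mu := Ex pc _ => hk.
have pc01 i : 0 <= pc i <= 1 by rewrite /pc; apply/andP; split; lra.
have s0 : 0 < s by lra.
have a0 : 0 <= a by lra.
set m := #|[set i | c i != 0]| in sE.
pose P := Pr pc (fun X => (lin c X == k) || (lin c X == k + 1)).
pose T := Ex pc (fun A => ((lin c A)%:~R - mu) * (k < lin c A)%R%:R).
have T_ub : T <= p * m%:R * P.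
  rewrite /T (trunc_moment_straddle p c1).
  have -> : p * m%:R * P = p * (1 - p) * (\sum_(i | c i != 0) P / (1 - p)).
    rewrite -mulr_suml sumr_const -mulr_natl.
    have -> : #|[pred i | c i != 0]| = m by apply: eq_card => i; rewrite inE.
    by field; rewrite subr_eq0 gt_eqF //; lra.
  apply: ler_wpM2l; first by rewrite mulr_ge0 //; lra.
  apply: ler_sum => i ci; rewrite ler_pdivlMr; last by lra.
  rewrite [in leRHS]/P [leRHS](Pr_coord _ i); apply: ler_wpDl.
    by rewrite mulr_ge0 ?Pr_ge0 //; apply: ltW.
  have p1 : 0 <= 1 - p by lra.
  rewrite mulrC; apply: ler_wpM2l => //.
  apply: le_Pr => // A; rewrite /straddle.
  set z := lin c (A :\ i); case: (unit_int_cases c1 i) ci => -> // _; lia.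
have T_lb : tail_cst a * (a * s) <= T.
  have as0 : 0 <= a * s by rewrite mulr_ge0 // ltW.
  have [muk|kmu] := leP mu k%:~R.
    apply: le_trans (_ : Pr pc (fun X => mu + a * s <= (lin c X)%:~R) * (a * s) <= _).
      by apply: ler_wpM2r => //; apply: lin_upper_tail.
    rewrite /Pr -ExZr; apply: ler_Ex => // A.
    case: (boolP (mu + a * s <= _)) => [h|_].
      have hk2 : k < lin c A.
        rewrite -(ltr_int R); move: hk; rewrite ger0_norm; lra.
      rewrite hk2 mul1r mulr1; lra.
    rewrite mul0r; case: (boolP (k < _)) => [|_]; last by rewrite mulr0.
    rewrite -(ltr_int R) mulr1; lra.
  have -> : T = Ex pc (fun A => (mu - (lin c A)%:~R) * (lin c A <= k)%R%:R).
    rewrite -[RHS]addr0 -[X in _ + X](subrr mu).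
    rewrite -[X in _ + (_ - X)](Ex_cst pc) -ExB -ExD.
    apply: eq_Ex => A; rewrite leNgt; case: (k < _) => /=; ring.
  apply: le_trans (_ : Pr pc (fun X => (lin c X)%:~R <= mu - a * s) * (a * s) <= _).
    by apply: ler_wpM2r => //; apply: lin_lower_tail.
  rewrite /Pr -ExZr; apply: ler_Ex => // A.
  case: (boolP (_ <= mu - a * s)) => [h|_].
    have hk2 : lin c A <= k.
      rewrite -(ler_int R); move: hk; rewrite ltr0_norm; lra.
    rewrite hk2 mul1r mulr1; lra.
  rewrite mul0r; case: (boolP (_ <= k)) => [|_]; last by rewrite mulr0.
  rewrite -(ler_int R) mulr1; lra.
rewrite ler_pdivrMr //.
have := le_trans T_lb T_ub; rewrite -sE => h.
have h2 : tail_cst a * a * s <= (P * s) * s.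
  by apply: le_trans (le_trans _ h) _; rewrite ?expr2; [rewrite mulrA | lra].
move: h2; rewrite ler_pM2r // => h2; apply: le_trans h2.
by rewrite ler_peMr // ltW // tail_cst_gt0.
Qed.

End Tails.

(** * Sums of random signs *)
Lemma subset_of_card (T : finType) (S : {set T}) k : (k <= #|S|)%N ->
  exists2 S' : {set T}, S' \subset S & #|S'| = k.
Proof.
move=> kS; exists [set x in take k (enum S)].
  apply/fintype.subsetP => x; rewrite inE => /mem_take; by rewrite mem_enum.
have /card_uniqP : uniq (take k (enum S)) by rewrite take_uniq ?enum_uniq.
rewrite size_takel -?cardE // => h; rewrite -[RHS]h; apply: eq_card => x.
by rewrite inE.
Qed.

Lemma perm_of_codom (T : finType) (K : eqType) (f g : T -> K) :
  perm_eq (codom f) (codom g) -> exists s : {perm T}, f =1 g \o s.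
Proof.
move=> fg; have /tuple_permP[s sE] :
    perm_eq (tcast (erefl #|T|) (codom_tuple f)) (codom_tuple g) by [].
have inj : injective (fun x => enum_val (s (enum_rank x))).
  by move=> x y /enum_val_inj /perm_inj /enum_rank_inj.
exists (perm inj) => x /=; rewrite permE.
pose t := [tuple tnth (codom_tuple g) (s i) | i < #|T|].
have e i : tnth (codom_tuple f) i = tnth (codom_tuple g) (s i).
  have -> : codom_tuple f = t by apply: val_inj; rewrite /= -sE.
  by rewrite tnth_mktuple.
have := e (enum_rank x).
by rewrite !(tnth_nth (f x)) /= !nth_codom enum_rankK.
Qed.

Section SignSums.
Variables (R : realType) (I : finType).
Implicit Types (p : R) (W Y A B : {set I}).

Definition sg W Y (i : I) : int :=
  if i \in W then (if i \in Y then 1 else -1) else 0.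

Lemma sg_unit W Y i : `|sg W Y i| <= 1.
Proof. by rewrite /sg; case: ifP => // _; case: ifP. Qed.

Lemma sg_supp W Y : [set i | sg W Y i != 0] = W.
Proof.
apply/setP => i; rewrite inE /sg; case: (i \in W) => //; by case: (i \in Y).
Qed.

Lemma Ex_perm p (s : {perm I}) (F : {set I} -> R) :
  Ex (fun=> p) F = Ex (fun=> p) (fun A => F [set s x | x in A]).
Proof.
rewrite /Ex (reindex_inj (imset_inj (@perm_inj _ s))); apply: eq_bigr => A _.
congr (_ * _); rewrite /mass (reindex_inj (@perm_inj _ s)).
by apply: eq_bigr => i _; rewrite (mem_imset _ _ perm_inj).
Qed.

(** A permutation of the coordinates carries one configuration to the other. *)
Lemma lin_sg_law p W Y Y' (f : int -> R) : #|W :&: Y| = #|W :&: Y'| ->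
  Ex (fun=> p) (fun A => f (lin (sg W Y) A)) =
  Ex (fun=> p) (fun A => f (lin (sg W Y') A)).
Proof.
move=> YY'.
have [s sE] : exists s : {perm I}, sg W Y =1 sg W Y' \o s.
  apply: perm_of_codom; apply/allP => k _ /=; apply/eqP.
  have cnt Z : count_mem k (codom (sg W Z)) =
      (#|W :&: Z| * (k == 1)%R + #|W :\: Z| * (k == -1)%R + #|~: W| * (k == 0)%R)%N.
    rewrite /codom /image_mem count_map -size_filter.
    transitivity #|[set i | sg W Z i == k]|.
      by rewrite enumT cardsE cardE /enum_mem.
    rewrite -sum1_card big_mkcond /= -!sum1_card !big_distrl /=.
    rewrite (big_mkcond (fun i => i \in W :&: Z)).
    rewrite (big_mkcond (fun i => i \in W :\: Z)) (big_mkcond (fun i => i \in ~: W)).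
    rewrite -!big_split /=; apply: eq_bigr => i _; rewrite !inE /sg.
    case: (i \in W); case: (i \in Z); rewrite /= ?mul1n ?addn0 ?add0n eq_sym;
      by case: ifP.
  by rewrite !cnt YY' !cardsD YY'.
rewrite [RHS](Ex_perm p s); apply: eq_Ex => A; congr f.
rewrite /lin big_imset /=; last by move=> x y _ _; apply: perm_inj.
by apply: eq_bigr => i _; rewrite sE.
Qed.

Lemma lin_sg_dep W Y : dep W (lin (sg W Y)).
Proof.
move=> A B AB; rewrite /lin [LHS]big_mkcond [RHS]big_mkcond /=.
apply: eq_bigr => i _; rewrite /sg; case: (boolP (i \in W)) => [iW|_].
  by rewrite AB.
by case: ifP; case: ifP.
Qed.

Lemma eq_lin_sg W Y Y' A : {in W, forall i, (i \in Y) = (i \in Y')} ->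
  lin (sg W Y) A = lin (sg W Y') A.
Proof.
move=> YY'; apply: eq_bigr => i _; rewrite /sg; by case: ifP => // /YY' ->.
Qed.

Lemma lin_sg_setD1 W Y A i : i \in W ->
  lin (sg W Y) A = lin (sg (W :\ i) Y) A +
    (if i \in A then (if i \in Y then 1 else -1) else 0).
Proof.
move=> iW; rewrite /lin !(big_mkcond (fun j => j \in A)) /=.
rewrite (bigD1 i) //= [in RHS](bigD1 i) //= /sg iW setD11 if_same add0r addrC.
by congr (_ + _); apply: eq_bigr => j ji; rewrite in_setD1 ji.
Qed.

Lemma lin_sg_setC W Y A : lin (sg W (~: Y)) A = - lin (sg W Y) A.
Proof.
rewrite -lin_opp; apply: eq_bigr => i _; rewrite /sg inE.
by case: (i \in W) => //; case: (i \in Y).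
Qed.

Lemma lin_sg_pos W A : lin (sg W W) A = #|A :&: W|.
Proof.
rewrite /lin -[RHS]natz -sum1_card natr_sum [in LHS]big_mkcond [in RHS]big_mkcond /=.
apply: eq_bigr => i _; rewrite !inE /sg; by case: (i \in A); case: (i \in W).
Qed.

Lemma Ex_lin_sg p W Y : Ex (fun=> p) (fun A => (lin (sg W Y) A)%:~R) =
  p * (2 * #|W :&: Y|%:R - #|W|%:R).
Proof.
rewrite Ex_lin -mulr_suml mulrC; congr (_ * _).
rewrite -!sum1_card !natr_sum mulr_sumr (big_mkcond (fun i => i \in W :&: Y)).
rewrite (big_mkcond (fun i => i \in W)) /= -sumrB; apply: eq_bigr => i _.
rewrite !inE /sg; case: (i \in W); case: (i \in Y) => /=; ring.
Qed.

(** The bound [eta] is kept abstract; for graphs it is of order the inverse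
    square root of the average degree, see [point_bound_sd]. *)
Definition point_bound p (M : nat) (eta : R) :=
  forall W Y k, (M <= #|W|)%N -> Pr (fun=> p) (fun A => lin (sg W Y) A == k) <= eta.

Section PointBound.
Variables (p : R) (M : nat) (eta : R).
Hypothesis p01 : 0 <= p <= 1.
Hypothesis pb : point_bound p M eta.

Let pc01 (i : I) : 0 <= (fun=> p) i <= 1 := p01.

(** Changing one sign matters only if the corresponding coordinate is present
    and the rest of the sum takes one of two values. *)
Lemma sg_flip W Y Y' i (t : int) : (M < #|W|)%N -> i \in W ->
  (forall j, j \in W -> j != i -> (j \in Y) = (j \in Y')) ->
  Ex (fun=> p) (fun A => `|(t <= lin (sg W Y) A)%R%:R - (t <= lin (sg W Y') A)%R%:R|)
    <= 2 * p * eta.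
Proof.
move=> MW iW YY'; pose W1 := W :\ i.
have MW1 : (M <= #|W1|)%N by move: MW; rewrite (cardsD1 i W) iW.
have e A : lin (sg W1 Y') A = lin (sg W1 Y) A.
  by apply: eq_lin_sg => j; rewrite !inE => /andP[ji jW]; rewrite YY'.
apply: le_trans (_ : Ex (fun=> p) (fun A => (i \in A)%:R *
  ((lin (sg W1 Y) A == t)%:R + (lin (sg W1 Y) A == t - 1)%:R)) <= _).
  apply: ler_Ex => // A; rewrite !(lin_sg_setD1 _ _ iW) -/W1 e.
  set z := lin _ _; case: (i \in A); last by rewrite subrr normr0 mul0r.
  rewrite mul1r -natrD.
  suff : ((t <= z + (if i \in Y then 1 else -1)) != (t <= z + (if i \in Y' then 1 else -1)))
    -> (0 < (z == t)%R + (z == t - 1)%R)%N.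
    case: (t <= z + _); case: (t <= z + _) => /= h;
      rewrite ?subrr ?normr0 ?subr0 ?sub0r ?normrN ?normr1 ?ler0n // ler1n; exact: h.
  case: (i \in Y); case: (i \in Y'); rewrite ?eqxx //; lia.
rewrite (@Ex_indep _ _ _ [set i]).
- rewrite Ex_in ExD -mulrA [leRHS]mulrCA.
  case/andP: p01 => h0 _; apply: ler_wpM2l => //.
  by apply: le_trans (lerD (pb _ _ MW1) (pb _ _ MW1)) _; lra.
- by move=> A B AB; rewrite AB // inE.
- apply: dep_sub (_ : dep W1 _); last by move=> A B AB; rewrite (lin_sg_dep Y AB).
  by apply/fintype.subsetP => j; rewrite !inE => /andP[].
Qed.

Definition sg_dist W Y Y' := #|[set i in W | (i \in Y) != (i \in Y')]|.

Lemma sg_flips W Y Y' (t : int) : (M < #|W|)%N ->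
  Ex (fun=> p) (fun A => `|(t <= lin (sg W Y) A)%R%:R - (t <= lin (sg W Y') A)%R%:R|)
    <= 2 * p * eta * (sg_dist W Y Y')%:R.
Proof.
move=> MW; move dE: (sg_dist W Y Y') => n.
elim: n Y dE => [|n IH] Y.
  move=> /eqP; rewrite cards_eq0 => /eqP d0; rewrite mulr0.
  apply: Ex_ub => // A; rewrite (@eq_lin_sg W Y Y') ?subrr ?normr0 // => i iW.
  apply/eqP; apply: contraFT (in_set0 i); by rewrite -d0 inE iW.
move=> dE; have /set0Pn[i] : [set i in W | (i \in Y) != (i \in Y')] != set0.
  by rewrite -cards_eq0 -/(sg_dist W Y Y') dE.
rewrite inE => /andP[iW iY].
pose Y1 := if i \in Y then Y :\ i else i |: Y.
have Y1E j : (j \in Y1) = (j \in Y) (+) (j == i).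
  rewrite /Y1; case: ifP => h; rewrite !inE; case: (altP (j =P i)) => [->|] /=;
    by rewrite ?h ?addbF // addbT h.
apply: le_trans (_ : Ex (fun=> p) (fun A =>
   `|(t <= lin (sg W Y) A)%R%:R - (t <= lin (sg W Y1) A)%R%:R| +
   `|(t <= lin (sg W Y1) A)%R%:R - (t <= lin (sg W Y') A)%R%:R|) <= _).
  by apply: ler_Ex => // A; apply: ler_distD.
rewrite ExD -[n.+1%:R]natr1 mulrDr mulr1 addrC; apply: lerD.
  apply: IH; have := dE; rewrite /sg_dist (cardsD1 i) inE iW iY => -[<-]; rewrite add0n.
  apply: eq_card => j; rewrite !inE Y1E.
  case: (altP (j =P i)) => [->|] /=; last by rewrite addbF.
  by rewrite iW addbT; move: iY; case: (i \in Y); case: (i \in Y').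
by apply: (@sg_flip _ _ _ i) => // j jW /negbTE ji; rewrite Y1E ji addbF.
Qed.

(** By [lin_sg_law] one of the two configurations may be replaced by one that is
    nested in the other, so that only the difference of their sizes counts. *)
Lemma sg_count W Y Y' (t : int) : (M < #|W|)%N ->
  `|Pr (fun=> p) (fun A => t <= lin (sg W Y) A) -
    Pr (fun=> p) (fun A => t <= lin (sg W Y') A)|
    <= 2 * p * eta * `|#|W :&: Y|%:R - #|W :&: Y'|%:R|.
Proof.
move=> MW; wlog YY' : Y Y' / (#|W :&: Y| <= #|W :&: Y'|)%N.
  move=> H; case/orP: (leq_total #|W :&: Y| #|W :&: Y'|) => h; first exact: H.
  by rewrite distrC [X in _ <= _ * X]distrC; apply: H.
have [Y1 Y1s Y1c] := subset_of_card YY'.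
have WY1 : W :&: Y1 = Y1.
  apply/setIidPr/(fintype.subset_trans Y1s); exact: subsetIl.
rewrite /Pr (@lin_sg_law p W Y Y1 (fun z => (t <= z)%R%:R)) ?WY1 //.
rewrite -ExB; apply: le_trans (Ex_abs pc01 _) _.
apply: le_trans (sg_flips Y1 Y' t MW) _.
have -> // : (sg_dist W Y1 Y')%:R = `|#|W :&: Y|%:R - #|W :&: Y'|%:R| :> R.
rewrite distrC -natrB // ger0_norm ?ler0n // -Y1c -(setIidPr Y1s) -cardsD.
rewrite /sg_dist; congr _%:R; apply: eq_card => i; rewrite !inE.
have := fintype.subsetP Y1s i; rewrite inE.
by case: (i \in Y1); case: (i \in W); case: (i \in Y') => // /(_ isT).
Qed.

Lemma sg_shift W Y (t : int) n : (M <= #|W|)%N ->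
  Pr (fun=> p) (fun A => t <= lin (sg W Y) A) <=
  Pr (fun=> p) (fun A => t + n%:Z <= lin (sg W Y) A) + eta * n%:R.
Proof.
move=> MW; elim: n => [|n IH].
  by rewrite mulr0 addr0; apply: le_Pr => // A; rewrite addr0.
apply: le_trans IH _; rewrite -[n.+1%:R]natr1 mulrDr mulr1 addrA addrAC lerD2r.
apply: le_trans (lerD (lexx _) (pb Y (t + n%:Z) MW)).
apply: le_trans (PrU pc01 _ _); apply: le_Pr => // A; lia.
Qed.

(** A sign sum with almost as many positive as negative signs is almost
    symmetric: compare it with its opposite. *)
Lemma sg_half W Y (t : int) : (M < #|W|)%N ->
  `|2 * Pr (fun=> p) (fun A => t <= lin (sg W Y) A) - 1| <=
  eta * `|2 * t - 1|%:~R + 2 * p * eta * `|2 * #|W :&: Y|%:R - #|W|%:R|.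
Proof.
move=> MW; set P := fun t : int => Pr (fun=> p) (fun A => t <= lin (sg W Y) A).
have h1 := sg_count Y (~: Y) t MW.
have e1 : #|W :&: ~: Y|%:R = #|W|%:R - #|W :&: Y|%:R :> R.
  by rewrite -setDE cardsD natrB // subset_leq_card // subsetIl.
have e2 : Pr (fun=> p) (fun A => t <= lin (sg W (~: Y)) A) = 1 - P (1 - t).
  by rewrite -PrC; apply: eq_Ex => A; rewrite lin_sg_setC; congr _%:R; congr nat_of_bool; lia.
rewrite e1 e2 -/(P t) in h1.
have h2 : `|P t - P (1 - t)| <= eta * `|2 * t - 1|%:~R.
  have mono (s : int) n : P (s + n%:Z) <= P s.
    by apply: le_Pr => // A; lia.
  have [t1|t1] := leP 1 (2 * t).
    have tE : t = (1 - t) + (absz (2 * t - 1)%R)%:Z by lia.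
    rewrite -(abszE (2 * t - 1)) [in P t]tE ler0_norm ?subr_le0 //.
    have := sg_shift Y (1 - t) (absz (2 * t - 1)%R) (ltnW MW).
    rewrite -/(P _) -/(P _); set a := P (1 - t); set b := P _.
    by rewrite -pmulrn; lra.
  have tE : 1 - t = t + (absz (2 * t - 1)%R)%:Z by lia.
  rewrite -(abszE (2 * t - 1)) [in P (1 - t)]tE ger0_norm ?subr_ge0 //.
  have := sg_shift Y t (absz (2 * t - 1)%R) (ltnW MW).
  rewrite -/(P _) -/(P _); set a := P t; set b := P _.
  by rewrite -pmulrn; lra.
have -> : 2 * P t - 1 = (P t - P (1 - t)) + (P t - (1 - P (1 - t))) by ring.
apply: le_trans (ler_normD _ _) (lerD h2 _).
apply: le_trans h1 _; rewrite le_eqVlt; apply/orP; left; apply/eqP.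
by congr (_ * `|_|); ring.
Qed.

End PointBound.

(** Uses (1 - p)^k <= exp (- p k) <= 1 / (1 + p k). *)
Lemma card_hit p W : 0 <= p <= 1 ->
  p * #|W|%:R / (1 + p * #|W|%:R) <= Pr (fun=> p) (fun A => (0 < #|A :&: W|)%N).
Proof.
move=> p01; have p01' (i : I) : 0 <= (fun=> p) i <= 1 by [].
case/andP: (p01) => p0 p1.
have pw0 : 0 <= p * #|W|%:R by rewrite mulr_ge0.
have e : Pr (fun=> p) (fun A => ~~ (0 < #|A :&: W|)%N) = (1 - p) ^+ #|W|.
  transitivity (Ex (fun=> p) (fun A => \prod_i
      (if (i \in W) && (i \in A) then 0 else 1 : R))).
    apply: eq_Ex => A; rewrite -leqNgt leqn0 cards_eq0.
    case: (boolP (A :&: W == set0)) => [/eqP AW|/set0Pn[i]].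
      rewrite big1 // => i _; have : i \notin A :&: W by rewrite AW inE.
      by rewrite inE andbC => /negbTE ->.
    by rewrite inE andbC => iAW; rewrite (bigD1 i) //= iAW mul0r.
  rewrite (Ex_prod _ (fun i b => if (i \in W) && b then 0 else 1)).
  rewrite (bigID (mem W)) /= [X in _ * X]big1 => [|i /negbTE ->]; last first.
    by rewrite !mulr1 addrC subrK.
  rewrite mulr1 (eq_bigr (fun=> 1 - p)) => [|i ->]; last by rewrite mulr0 add0r mulr1.
  by rewrite prodr_const.
move: e; rewrite PrC => e; clear p01'.
have h : (1 - p) ^+ #|W| <= (1 + p * #|W|%:R)^-1.
  apply: le_trans (_ : expR (- p) ^+ #|W| <= _).
    by apply: lerXn2r; rewrite ?nnegrE ?subr_ge0 ?expR_ge0 // expR_ge1Dx.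
  rewrite -expRM_natr mulNr expRN lef_pV2 ?posrE ?expR_gt0 ?expR_ge1Dx //.
  lra.
have -> : p * #|W|%:R / (1 + p * #|W|%:R) = 1 - (1 + p * #|W|%:R)^-1.
  by field; rewrite gt_eqF //; lra.
lra.
Qed.

Lemma card_half_mean p W (L : nat) : 0 < p -> p <= 2^-1 ->
  (4 <= L)%N -> 2 * L%:R <= p * #|W|%:R ->
  2^-1 <= Pr (fun=> p) (fun A => (L <= #|A :&: W|)%N).
Proof.
move=> p0 p2 L4 LW; pose pc : I -> R := fun=> p.
have p01 i : 0 <= pc i <= 1 by rewrite /pc; apply/andP; split; lra.
have L4' : 4 <= L%:R :> R by rewrite ler_nat.
set mu := p * #|W|%:R in LW.
have Emu : Ex (fun=> p) (fun A => (lin (sg W W) A)%:~R) = mu.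
  rewrite Ex_lin_sg setIid /mu; ring.
have V : Var (fun=> p) (fun A => (lin (sg W W) A)%:~R) <= mu.
  rewrite Var_lin (sum_sqr_unit (sg_unit W W)) sg_supp mulrC /mu.
  by apply: ler_wpM2r => //; rewrite ler_piMr //; lra.
have mu2 : 0 < mu / 2 by lra.
have := Ex_chebyshev p01 (fun A => (lin (sg W W) A)%:~R) mu2; rewrite Emu => ch.
have : Pr (fun=> p) (fun A => ~~ (L <= #|A :&: W|)%N) <= 2^-1.
  apply: le_trans (le_trans _ ch) _.
    apply: le_Pr => // A; rewrite -ltnNge lin_sg_pos => h.
    rewrite distrC; apply: le_trans (ler_norm _).
    have : #|A :&: W|%:R <= L%:R :> R by rewrite ler_nat ltnW.
    by rewrite -[(_%:Z)%:~R]/(#|A :&: W|%:R); lra.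
  rewrite ler_pdivrMr ?exprn_gt0 //; apply: le_trans V _.
  have -> : 2^-1 * (mu / 2) ^+ 2 = mu * (mu / 8) by field.
  by rewrite ler_peMr //; lra.
rewrite PrC; lra.
Qed.

(** Markov's inequality for the exponential of the sum, followed by
    [1 + x <= expR x] in each factor of its expectation. *)
Lemma exp_markov_sum p (w : I -> R) : 0 <= p <= 1 ->
  Pr (fun=> p) (fun A => 0 <= \sum_(i in A) w i) <=
  expR (p * \sum_i (expR (w i) - 1)).
Proof.
move=> p01; pose pc : I -> R := fun=> p; have p01' i : 0 <= pc i <= 1 by [].
case/andP: (p01) => p0 p1.
apply: le_trans (_ : Ex (fun=> p) (fun A =>
    \prod_i (if i \in A then expR (w i) else 1)) <= _).
  apply: ler_Ex => // A; rewrite -big_mkcond -expR_sum.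
  case: (boolP (0 <= _)) => h; last exact: expR_ge0.
  by apply: le_trans (expR_ge1Dx _); rewrite lerDl.
rewrite (Ex_prod _ (fun i b => if b then expR (w i) else 1)) mulr_sumr expR_sum.
apply: ler_prod => i _; apply/andP; split.
  by rewrite addr_ge0 ?mulr_ge0 ?expR_ge0 // subr_ge0.
apply: le_trans (expR_ge1Dx _); lra.
Qed.

End SignSums.

(** * Symmetries of majority dynamics *)
Section Relabelling.
Variable V : finType.
Implicit Types (G : sgraph V) (S : {set V}) (s : {perm V}).

Lemma majority_stepC G S : majority_step G (~: S) = ~: majority_step G S.
Proof.
apply/setP => v; rewrite !inE setCK.
by case: ltngtP => //=; rewrite negbK.
Qed.

Lemma red_setC G S t : red_set G (~: S) t = ~: red_set G S t.
Proof. by elim: t => //= t IH; rewrite /red_set /= -/(red_set _ _ _) IH majority_stepC. Qed.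

Lemma edge_map_card s (e : vpair V) : #|[set s x | x in val e]| == 2%N.
Proof. by rewrite card_imset; [exact: (valP e)|exact: perm_inj]. Qed.

Definition edge_map s (e : vpair V) : vpair V :=
  exist _ [set s x | x in val e] (edge_map_card s e).

Lemma edge_map_inj s : injective (edge_map s).
Proof.
move=> e f /(congr1 val) /= ef; apply: val_inj.
exact: (imset_inj (@perm_inj _ s)) ef.
Qed.

Definition relabel s G : sgraph V := [set edge_map s e | e in G].

Lemma adj_relabel s G x y : adj (relabel s G) (s x) (s y) = adj G x y.
Proof.
have imE : [set s x; s y] = [set s z | z in [set x; y]] by rewrite imsetU1 imset_set1.
apply/existsP/existsP => -[e /andP[eG /eqP ev]].
  move/imsetP: eG => [f fG ef]; exists f; rewrite fG /=; apply/eqP.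
  by apply: (imset_inj (@perm_inj _ s)); rewrite -imE -ev ef.
exists (edge_map s e); rewrite imset_f //=; apply/eqP.
by rewrite imE -ev.
Qed.

Lemma nbrs_in_relabel s G S v :
  nbrs_in (relabel s G) (s v) [set s x | x in S] = nbrs_in G v S.
Proof.
rewrite /nbrs_in -[RHS](card_imset _ (@perm_inj _ s)); apply: eq_card => u.
have [u' ->] : exists u', u = s u' by exists (s^-1%g u); rewrite permKV.
by rewrite (mem_imset _ _ (@perm_inj _ s)) !inE (mem_imset _ _ (@perm_inj _ s)) adj_relabel.
Qed.

Lemma imset_permC s S : ~: [set s x | x in S] = [set s x | x in ~: S].
Proof.
apply/setP => u; have [u' ->] : exists u', u = s u' by exists (s^-1%g u); rewrite permKV.
by rewrite inE !(mem_imset _ _ (@perm_inj _ s)) inE.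
Qed.

Lemma majority_step_relabel s G S :
  majority_step (relabel s G) [set s x | x in S] = [set s x | x in majority_step G S].
Proof.
apply/setP => u; have [u' ->] : exists u', u = s u' by exists (s^-1%g u); rewrite permKV.
by rewrite !(mem_imset _ _ (@perm_inj _ s)) !inE imset_permC !nbrs_in_relabel
  (mem_imset _ _ (@perm_inj _ s)).
Qed.

Lemma red_set_relabel s G S t :
  red_set (relabel s G) [set s x | x in S] t = [set s x | x in red_set G S t].
Proof.
elim: t => //= t IH.
by rewrite /red_set /= -/(red_set _ _ _) IH majority_step_relabel.
Qed.

(** The vertices of the random graph are exchangeable, hence only the size of
    the initial red set matters on average. *)
Lemma Ex_red_set_card (R : realType) (p : R) S S' t : #|S| = #|S'| ->
  Ex (fun=> p) (fun G : sgraph V => #|red_set G S t|%:R) =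
  Ex (fun=> p) (fun G : sgraph V => #|red_set G S' t|%:R).
Proof.
move=> SS'.
have [s sE] : exists s : {perm V}, (mem S : V -> bool) =1 mem S' \o s.
  apply: perm_of_codom; apply/allP => b _ /=; apply/eqP.
  have cnt (Z : {set V}) : count_mem b (codom (mem Z)) = #|if b then Z else ~: Z|.
    rewrite /codom /image_mem count_map -size_filter.
    transitivity #|[set i | (i \in Z) == b]|.
      by rewrite enumT cardsE cardE /enum_mem.
    by apply: eq_card => i; rewrite inE; case: b; rewrite ?inE; case: (i \in Z).
  rewrite !cnt; case: (b) => //; have := cardsC S; have := cardsC S'; lia.
have S'E : S' = [set s x | x in S].
  apply/setP => u; have [u' ->] : exists u', u = s u' by exists (s^-1%g u); rewrite permKV.
  by rewrite (mem_imset _ _ (@perm_inj _ s)) -[RHS]/((mem S : V -> bool) u') sE.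
rewrite [RHS](Ex_perm p (perm (@edge_map_inj s))); apply: eq_Ex => G.
have -> : [set perm (@edge_map_inj s) x | x in G] = relabel s G.
  by apply: eq_imset => e; rewrite permE.
by rewrite S'E red_set_relabel card_imset //; exact: perm_inj.
Qed.

End Relabelling.

(** * Edges and signed neighbour counts *)
Section Edges.
Variables (V : finType) (e0 : vpair V).
Implicit Types (u v w x y : V) (A G : {set vpair V}) (W Y X S : {set V}).

(** The value is the junk edge [e0] when [u = w]. *)
Definition ed u w : vpair V := insubd e0 [set u; w].

Lemma val_ed u w : u != w -> val (ed u w) = [set u; w].
Proof. by move=> uw; rewrite val_insubd cards2 uw. Qed.

Lemma edC u w : ed u w = ed w u.
Proof. by rewrite /ed setUC. Qed.

Lemma ed_inj u w w' : u != w -> u != w' -> ed u w = ed u w' -> w = w'.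
Proof.
move=> uw uw' /(congr1 val); rewrite !val_ed // => /setP /(_ w).
by rewrite !inE eqxx orbT eq_sym (negbTE uw) /= => /esym/eqP.
Qed.

Lemma adjE G u w : u != w -> adj G u w = (ed u w \in G).
Proof.
move=> uw; apply/existsP/idP => [[e /andP[eG /eqP ev]]|h].
  by have -> : ed u w = e by apply: val_inj; rewrite val_ed.
by exists (ed u w); rewrite h val_ed /=.
Qed.

Definition vsum u W Y A : int :=
  \sum_(w in W) (if ed u w \in A then (if w \in Y then 1 else -1) else 0).

Lemma vsumE u W Y A : u \notin W -> vsum u W Y A =
  lin (sg [set ed u w | w in W] [set ed u w | w in W :&: Y]) A.
Proof.
move=> uW; have ne w : w \in W -> u != w.
  by move=> wW; apply: contraNneq uW => ->.
have inj : {in W &, injective (ed u)} by move=> w w' /ne ? /ne ?; apply: ed_inj.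
rewrite /lin (bigID (mem [set ed u w | w in W])) /= addrC big1 => [|e]; last first.
  by case/andP => _ /negbTE h; rewrite /sg h.
rewrite add0r (eq_bigl (fun e => (e \in [set ed u w | w in W]) && (e \in A)));
  last by move=> e; rewrite andbC.
rewrite big_mkcondr /= big_imset // /vsum.
apply: eq_bigr => w wW; rewrite /sg imset_f //; case: ifP => // _.
suff -> : (ed u w \in [set ed u w0 | w0 in W :&: Y]) = (w \in Y) by [].
apply/imsetP/idP => [[w']|wY]; last by exists w; rewrite ?inE ?wW.
by rewrite inE => /andP[w'W w'Y] /inj -> .
Qed.

Lemma card_edges u W : u \notin W -> #|[set ed u w | w in W]| = #|W|.
Proof.
move=> uW; apply: card_in_imset => w w' wW w'W; apply: ed_inj.
  by apply: contraNneq uW => ->.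
by apply: contraNneq uW => ->.
Qed.

Lemma card_edgesI u W Y : u \notin W ->
  #|[set ed u w | w in W] :&: [set ed u w | w in W :&: Y]| = #|W :&: Y|.
Proof.
move=> uW; rewrite (setIidPr _); last by apply: imsetS; apply: subsetIl.
by apply: card_edges; rewrite inE negb_and uW.
Qed.

Lemma vsum_dep u W Y : u \notin W -> dep [set ed u w | w in W] (vsum u W Y).
Proof. by move=> uW A B AB; rewrite !vsumE //; apply: lin_sg_dep. Qed.

Lemma vsum_setD1 u W Y A w : w \in W -> vsum u W Y A =
  vsum u (W :\ w) Y A + (if ed u w \in A then (if w \in Y then 1 else -1) else 0).
Proof. by move=> wW; rewrite /vsum (big_setD1 w) //= addrC. Qed.

Lemma eq_vsum u W Y Y' A :
  (forall w, w \in W -> ed u w \in A -> (w \in Y) = (w \in Y')) ->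
  vsum u W Y A = vsum u W Y' A.
Proof.
move=> h; apply: eq_bigr => w wW; by case: ifP => // /(h _ wW) ->.
Qed.

Lemma vsum_mono u W Y Y' A : Y \subset Y' -> vsum u W Y A <= vsum u W Y' A.
Proof.
move=> /fintype.subsetP YY'; apply: ler_sum => w _; case: ifP => // _.
by case: ifP => [/YY' ->|_] //; case: ifP.
Qed.

(** A tie keeps the colour, so a blue vertex needs a strict majority. *)
Definition thr S v : int := if v \in S then 0 else 1.

Lemma majority_stepE G S v :
  (v \in majority_step G S) = (thr S v <= vsum v (~: [set v]) S G).
Proof.
have nE Z : nbrs_in G v Z =
    (\sum_(w in ~: [set v]) ((ed v w \in G) && (w \in Z) : nat))%N.
  rewrite /nbrs_in -sum1_card big_mkcond [RHS]big_mkcond /=.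
  apply: eq_bigr => w _; rewrite !inE; case: (altP (w =P v)) => [->|wv] /=.
    by rewrite adj_irr andbF.
  by rewrite adjE 1?eq_sym // andbC; case: andb.
have -> : vsum v (~: [set v]) S G = (nbrs_in G v S)%:Z - (nbrs_in G v (~: S))%:Z.
  rewrite !nE /vsum -!natz !natr_sum -sumrB; apply: eq_bigr => w _.
  by rewrite inE; case: (ed v w \in G); case: (w \in S).
rewrite inE /thr; case: ltngtP; case: (v \in S) => /=; lia.
Qed.

Lemma majority_step_mono G S S' :
  S \subset S' -> majority_step G S \subset majority_step G S'.
Proof.
move=> SS'; apply/fintype.subsetP => v; rewrite !majority_stepE => h.
apply: le_trans (le_trans h (vsum_mono _ _ _ SS')).
by rewrite /thr; case: ifP => vS'; case: ifP => // /(fintype.subsetP SS'); rewrite vS'.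
Qed.

Lemma red_set_mono G S S' t : S \subset S' -> red_set G S t \subset red_set G S' t.
Proof. by move=> SS'; elim: t => //= t; apply: majority_step_mono. Qed.

End Edges.

(** * Covariance bounds *)
Section Covariances.
Variables (R : realType) (I : finType).
Implicit Types (p : I -> R) (F H : {set I} -> R) (J : {set I}).

Definition Cov p F H := Ex p (fun A => F A * H A) - Ex p F * Ex p H.

(** Given the shared coordinate [i] the two functions are independent, so the
    covariance is that of two functions of a single Bernoulli variable. *)
Lemma Cov_one_coord p i J1 J2 F H :
  dep (i |: J1) F -> dep (i |: J2) H -> [disjoint J1 & J2] ->
  Cov p F H = p i * (1 - p i) *
    (Ex p (fun A => F (i |: A)) - Ex p (fun A => F (A :\ i))) *
    (Ex p (fun A => H (i |: A)) - Ex p (fun A => H (A :\ i))).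
Proof.
move=> dF dH J12; rewrite /Cov (Ex_coord p i (fun A => F A * H A)) (Ex_coord p i F) (Ex_coord p i H).
have d1 J (K : {set I} -> R) : dep (i |: J) K -> dep J (fun A => K (i |: A)).
  move=> dK A B AB; apply: dK => j; rewrite !inE.
  by case: eqP => //= _; apply: AB.
have d0 J (K : {set I} -> R) : dep (i |: J) K -> dep J (fun A => K (A :\ i)).
  move=> dK A B AB; apply: dK => j; rewrite !inE.
  by case: eqP => //= _; apply: AB.
have sub : J2 \subset ~: J1 by rewrite -disjoints_subset disjoint_sym.
rewrite (Ex_indep p (d1 _ _ dF) (dep_sub sub (d1 _ _ dH))).
rewrite (Ex_indep p (d0 _ _ dF) (dep_sub sub (d0 _ _ dH))).
ring.
Qed.

Lemma card_setU1_le (T : finType) (x : T) (S : {set T}) : (#|x |: S| <= #|S|.+1)%N.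
Proof. by rewrite cardsU1 -add1n leq_add2r leq_b1. Qed.

Lemma card_setCU1 (T : finType) (x : T) (S : {set T}) :
  (#|T| <= #|~: (x |: S)| + #|S|.+1)%N.
Proof. by rewrite -(cardsC (x |: S)) addnC leq_add2l card_setU1_le. Qed.

Lemma le_room (M a b c n : nat) :
  (M + a + 2 <= n)%N -> (n <= c + b.+1)%N -> (b <= a.+1)%N -> (M <= c)%N.
Proof. lia. Qed.

Lemma Var_sum_le p (T : finType) (S : {set T}) (E : T -> pred {set I}) (k : R) :
  (forall i, 0 <= p i <= 1) -> 0 <= k ->
  (forall s t, s \in S -> t \in S -> s != t ->
    Cov p (fun A => (E s A)%:R) (fun A => (E t A)%:R) <= k) ->
  Var p (fun A => \sum_(s in S) (E s A)%:R) <= #|S|%:R + #|S|%:R ^+ 2 * k.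
Proof.
move=> p01 k0 ck.
have -> : Var p (fun A => \sum_(s in S) (E s A)%:R) =
    \sum_(s in S) \sum_(t in S) Cov p (fun A => (E s A)%:R) (fun A => (E t A)%:R).
  rewrite VarE !Ex_sum expr2 mulr_suml.
  rewrite (eq_Ex _ (_ : _ =1 fun A => \sum_(s in S) \sum_(t in S) (E s A)%:R * (E t A)%:R)).
    rewrite Ex_sum -sumrB; apply: eq_bigr => s _.
    by rewrite Ex_sum mulr_sumr -sumrB.
  by move=> A; rewrite expr2 mulr_suml; apply: eq_bigr => s _; rewrite mulr_sumr.
apply: le_trans (_ : \sum_(s in S) \sum_(t in S) ((s == t)%:R + k) <= _).
  apply: ler_sum => s sS; apply: ler_sum => t tS.
  case: (altP (s =P t)) => [<-|st]; last by rewrite add0r; apply: ck.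
  apply: (@le_trans _ _ 1); last by rewrite lerDl.
  have e0 : 0 <= Ex p (fun A => (E s A)%:R) by apply: Ex_ge0 => // A; apply: ler0n.
  rewrite /Cov; apply: le_trans (_ : Ex p (fun A => (E s A)%:R * (E s A)%:R) <= _).
    by rewrite gerBl mulr_ge0.
  by apply: Ex_ub => // A; case: (E s A); rewrite ?mulr1 ?mulr0.
rewrite le_eqVlt; apply/orP; left; apply/eqP.
transitivity (\sum_(s in S) (1 + #|S|%:R * k)).
  apply: eq_bigr => s sS; rewrite big_split /= sumr_const mulr_natl; congr (_ + _).
  rewrite (bigD1 s) //= eqxx big1 ?addr0 // => t /andP[_ /negbTE].
  by rewrite eq_sym => ->.
rewrite sumr_const -mulr_natl; ring.
Qed.

Lemma Cov_approx p F F' H H' : (forall i, 0 <= p i <= 1) ->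
  (forall A, 0 <= F A <= 1) -> (forall A, 0 <= F' A <= 1) ->
  (forall A, 0 <= H A <= 1) -> (forall A, 0 <= H' A <= 1) ->
  Cov p F H <= Cov p F' H' + 2 * (Ex p (fun A => `|F A - F' A|) +
                                  Ex p (fun A => `|H A - H' A|)).
Proof.
move=> p01 F01 F'01 H01 H'01; rewrite /Cov.
set d1 := Ex p (fun A => `|F A - F' A|); set d2 := Ex p (fun A => `|H A - H' A|).
have h1 : Ex p (fun A => F A * H A) - Ex p (fun A => F' A * H' A) <= d1 + d2.
  rewrite -ExB /d1 /d2 -ExD; apply: ler_Ex => // A.
  have -> : F A * H A - F' A * H' A = (F A - F' A) * H A + F' A * (H A - H' A) by ring.
  case/andP: (H01 A) => ? ?; case/andP: (F'01 A) => ? ?.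
  apply: lerD.
    apply: le_trans (ler_norm _) _; rewrite normrM ler_piMr // ger0_norm //.
  apply: le_trans (ler_norm _) _; rewrite normrM ler_piMl // ger0_norm //.
have E01 K : (forall A, 0 <= K A <= 1) -> 0 <= Ex p K <= 1.
  move=> h; rewrite Ex_ge0 ?Ex_ub //= => A; by case/andP: (h A).
have a1 : `|Ex p F - Ex p F'| <= d1 by rewrite -ExB; apply: Ex_abs.
have a2 : `|Ex p H - Ex p H'| <= d2 by rewrite -ExB; apply: Ex_abs.
have h2 : Ex p F' * Ex p H' - Ex p F * Ex p H <= d1 + d2.
  have -> : Ex p F' * Ex p H' - Ex p F * Ex p H =
    (Ex p F' - Ex p F) * Ex p H' + Ex p F * (Ex p H' - Ex p H) by ring.
  case/andP: (E01 H' H'01) => ? ?; case/andP: (E01 F F01) => ? ?.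
  apply: lerD; apply: le_trans (ler_norm _) _; rewrite normrM.
    by apply: le_trans a1; rewrite distrC ler_piMr // ger0_norm.
  by apply: le_trans a2; rewrite [in leLHS]distrC ler_piMl // ger0_norm.
lra.
Qed.

End Covariances.

Lemma ind_shift (R : realType) (t z : int) (b : bool) :
  `|(t <= z + (if b then 1 else -1))%R%:R - (t <= z)%R%:R| <=
  (z == (if b then t - 1 else t))%:R :> R.
Proof.
case: b; case: (boolP (t <= z)) => h2;
  case: (boolP (t <= z + _)) => h1;
  rewrite /= ?subrr ?normr0 ?ler0n // ?subr0 ?sub0r ?normrN ?normr1 ler1n lt0b; lia.
Qed.

(** * The first day seen from deleted vertices *)
Section LocalStructure.
Variables (V : finType) (e0 : vpair V).
Implicit Types (u v w x y : V) (A G : {set vpair V}) (W Y X S : {set V}).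
Notation ed := (ed e0).
Notation vsum := (vsum e0).

Definition touch X : {set vpair V} := [set e : vpair V | val e :&: X != set0].

Lemma in_touch X u w : u != w -> (ed u w \in touch X) = (u \in X) || (w \in X).
Proof.
move=> uw; rewrite inE val_ed //; apply/set0Pn/orP => [[x]|[uX|wX]].
- by rewrite !inE => /andP[/orP[] /eqP ->]; [left|right].
- by exists u; rewrite !inE eqxx uX.
- by exists w; rewrite !inE eqxx wX orbT.
Qed.

Lemma vsum_dep_touch u W Y X : u \in X -> u \notin W -> dep (touch X) (vsum u W Y).
Proof.
move=> uX uW; apply: (dep_sub _ (vsum_dep (e0 := e0) Y uW)).
apply/fintype.subsetP => _ /imsetP[w wW ->]; rewrite in_touch ?uX //.
by apply: contraNneq uW => ->.
Qed.

(** The first-day statistic of [w] in the graph deprived of [X]. *)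
Definition dsum X S w A : int := vsum w (~: (w |: X)) S A.

(** With [X = [set u]] and [t = nthr S u] these are the vertices that would be
    red on the first day if they were joined to [u].  The point is that this set
    does not depend on the edges at [u] ([reach_dep]), whereas it gives the
    colours of the actual neighbours of [u] ([step_nbr]). *)
Definition reach X S (t : V -> int) A : {set V} :=
  [set w in ~: X | t w <= dsum X S w A].

Lemma dsum_dep X S w : w \notin X -> dep (~: touch X) (dsum X S w).
Proof.
move=> wX; have wW : w \notin ~: (w |: X) by rewrite !inE eqxx.
apply: (dep_sub _ (vsum_dep (e0 := e0) S wW)).
apply/fintype.subsetP => f /imsetP[y yW ->]; move: yW.
rewrite in_setC in_setU1 negb_or => /andP[yw yX].
by rewrite in_setC in_touch 1?eq_sym // negb_or wX.
Qed.

Lemma reach_dep X S t : dep (~: touch X) (reach X S t).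
Proof.
move=> A B AB; apply/setP => w; rewrite !inE.
by case: (boolP (w \in X)) => //= wX; rewrite (dsum_dep S wX AB).
Qed.

Definition sgn S v : int := if v \in S then 1 else -1.

Lemma dsum_setU1 X S w v A : w \notin X -> v \notin X -> w != v ->
  dsum X S w A = dsum (v |: X) S w A + (if ed w v \in A then sgn S v else 0).
Proof.
move=> wX vX wv; rewrite /dsum (@vsum_setD1 _ _ _ _ _ _ v); last first.
  by rewrite !inE negb_or eq_sym wv.
by congr (vsum _ _ _ _ + _); apply/setP => y; rewrite !inE; case: (y == v); case: (y == w).
Qed.

(** The threshold that [w] must reach without [u] in order to be red when it is
    joined to [u]: the colour of [u] counts for one unit. *)
Definition nthr S u w : int := thr S w - sgn S u.

Lemma step_nbr S u w G : w != u -> ed u w \in G ->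
  (w \in majority_step G S) = (w \in reach [set u] S (nthr S u) G).
Proof.
move=> wu uw; rewrite (majority_stepE e0) !inE wu /=.
have -> : vsum w (~: [set w]) S G = dsum set0 S w G by rewrite /dsum setU0.
rewrite (@dsum_setU1 _ _ _ u) ?inE // edC uw setU0 /nthr.
by rewrite lerBlDr.
Qed.

(** The sign of this number is the colour of [u] on the second day, up to
    ties. *)
Definition zsum S u G : int := vsum u (~: [set u]) (majority_step G S) G.

Lemma zsumE S u G :
  zsum S u G = vsum u (~: [set u]) (reach [set u] S (nthr S u) G) G.
Proof.
by apply: eq_vsum => w; rewrite in_setC in_set1 => wu; apply: step_nbr.
Qed.

Lemma imset_edE u W Y w : u \notin W -> w \in W ->
  (ed u w \in [set ed u y | y in W :&: Y]) = (w \in Y).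
Proof.
move=> uW wW; have ne y : y \in W -> u != y by move=> yW; apply: contraNneq uW => ->.
apply/imsetP/idP => [[y]|wY]; last by exists w; rewrite ?inE ?wW.
by rewrite inE => /andP[yW yY] /(ed_inj (ne _ wW) (ne _ yW)) ->.
Qed.

Section Bounds.
Variables (R : realType) (p : R) (M : nat) (eta : R).
Hypothesis p01 : 0 <= p <= 1.
Hypothesis pb : @point_bound R (vpair V) p M eta.
Let pc : vpair V -> R := fun=> p.

Let pc01 : forall e, 0 <= pc e <= 1 := const01 p01.

Lemma vsum_point u W Y (k : int) : u \notin W -> (M <= #|W|)%N ->
  Pr pc (fun A => vsum u W Y A == k) <= eta.
Proof.
move=> uW MW; rewrite /Pr; under eq_Ex do rewrite vsumE //.
by apply: pb; rewrite card_edges.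
Qed.

Lemma vsum_flips u W Y Y' (t : int) : u \notin W -> (M < #|W|)%N ->
  Ex pc (fun A => `|(t <= vsum u W Y A)%R%:R - (t <= vsum u W Y' A)%R%:R|) <=
  2 * p * eta * #|[set w in W | (w \in Y) != (w \in Y')]|%:R.
Proof.
move=> uW MW; under eq_Ex do rewrite !vsumE //.
apply: le_trans (sg_flips p01 pb _ _ _ _) _; first by rewrite card_edges.
rewrite le_eqVlt; apply/orP; left; apply/eqP; congr (_ * _%:R).
rewrite /sg_dist -(@card_in_imset _ _ (ed u) [set w in W | _]); last first.
  move=> y z; rewrite !inE => /andP[yW _] /andP[zW _].
  by apply: ed_inj; apply: contraNneq uW => ->.
apply: eq_card => e; rewrite inE; apply/andP/imsetP => [[/imsetP[w wW ->]]|[w]].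
  by rewrite !imset_edE // => h; exists w; rewrite // inE wW.
by rewrite inE => /andP[wW h] ->; rewrite !imset_edE // imset_f.
Qed.

Lemma vsum_count u W Y Y' (t : int) : u \notin W -> (M < #|W|)%N ->
  `|Pr pc (fun A => t <= vsum u W Y A) - Pr pc (fun A => t <= vsum u W Y' A)| <=
  2 * p * eta * `|#|W :&: Y|%:R - #|W :&: Y'|%:R|.
Proof.
move=> uW MW; rewrite /Pr; under eq_Ex do rewrite !vsumE //.
under [X in _ - X]eq_Ex do rewrite !vsumE //.
rewrite -(card_edgesI e0 Y uW) -(card_edgesI e0 Y' uW).
by apply: (sg_count p01 pb); rewrite card_edges.
Qed.

Lemma vsum_half u W Y (t : int) : u \notin W -> (M < #|W|)%N ->
  `|2 * Pr pc (fun A => t <= vsum u W Y A) - 1| <=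
  eta * `|2 * t - 1|%:~R + 2 * p * eta * `|2 * #|W :&: Y|%:R - #|W|%:R|.
Proof.
move=> uW MW; rewrite /Pr; under eq_Ex do rewrite !vsumE //.
rewrite -(card_edgesI e0 Y uW) -(card_edges e0 uW).
by apply: (sg_half p01 pb); rewrite card_edges.
Qed.

Lemma card_reach X S t A :
  #|reach X S t A|%:R = \sum_(w in ~: X) (t w <= dsum X S w A)%R%:R :> R.
Proof.
rewrite /reach -sum1_card natr_sum big_mkcond [RHS]big_mkcond /=.
by apply: eq_bigr => w _; rewrite !inE; case: (w \in X) => //=; case: (_ <= _).
Qed.

(** The events that two distinct vertices reach their thresholds only share
    the edge joining them, and each is affected by this edge with probability at
    most [eta].  Hence the covariances are at most [p * eta ^+ 2]. *)
Lemma Var_reach X S t : (M + #|X| + 2 <= #|V|)%N -> 0 <= eta ->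
  Var pc (fun A => #|reach X S t A|%:R) <= #|V|%:R + #|V|%:R ^+ 2 * (p * eta ^+ 2).
Proof.
move=> MX eta0; case/andP: (p01) => p0 p1.
have Xn : #|~: X|%:R <= #|V|%:R :> R by rewrite ler_nat max_card.
have k0 : 0 <= p * eta ^+ 2 by rewrite mulr_ge0 ?exprn_ge0.
apply: le_trans (_ : #|~: X|%:R + #|~: X|%:R ^+ 2 * (p * eta ^+ 2) <= _); last first.
  by apply: lerD => //; apply: ler_wpM2r => //; apply: lerXn2r; rewrite ?nnegrE.
under [X in Var _ X]boolp.funext do rewrite card_reach.
apply: Var_sum_le => // w w'; rewrite !inE => wX w'X ww'.
pose e := ed w w'.
pose J x y := [set ed x z | z in ~: (x |: (y |: X))].
have dJ x y : x \notin X -> y \notin X -> x != y ->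
    dep (ed x y |: J x y) (fun A => (t x <= dsum X S x A)%R%:R : R).
  move=> xX yX xy A B AB; congr (nat_of_bool (_ <= _))%:R.
  rewrite !(@dsum_setU1 X S x y) // AB ?setU11 //; congr (_ + _).
  apply: (vsum_dep (e0 := e0) S (_ : x \notin _)); first by rewrite !inE eqxx.
  by move=> f fJ; apply: AB; rewrite inE fJ orbT.
rewrite (@Cov_one_coord _ _ pc e (J w w') (J w' w)).
- have bnd x y : x \notin X -> y \notin X -> x != y ->
    `|Ex pc (fun A => (t x <= dsum X S x (ed x y |: A))%R%:R) -
      Ex pc (fun A => (t x <= dsum X S x (A :\ ed x y))%R%:R)| <= eta.
    move=> xX yX xy; rewrite -ExB; apply: le_trans (Ex_abs pc01 _) _.
    pose c : int := if y \in S then t x - 1 else t x.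
    apply: le_trans (_ : Pr pc (fun A => dsum (y |: X) S x A == c) <= _); last first.
      apply: vsum_point; first by rewrite !inE eqxx.
      exact: le_room MX (card_setCU1 x (y |: X)) (card_setU1_le y X).
    apply: ler_Ex => [|A]; first exact: pc01.
    rewrite !(@dsum_setU1 X S x y) // setU11 setD11 addr0.
    have dd (B : {set vpair V}) : {in ~: [set ed x y], forall f, (f \in B) = (f \in A)} ->
       dsum (y |: X) S x B = dsum (y |: X) S x A.
      move=> BA; apply: (vsum_dep (e0 := e0) S (_ : x \notin _)); first by rewrite !inE eqxx.
      move=> f /imsetP[z]; rewrite !inE !negb_or => /and3P[zx zy zX] ->.
      apply: BA; rewrite !inE; apply: contra zy => /eqP/ed_inj -> //.
      by rewrite eq_sym.
    rewrite !dd; last 2 first.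
    - by move=> f; rewrite !inE => h; rewrite ?h ?(negbTE h).
    - by move=> f; rewrite !inE => h; rewrite ?h ?(negbTE h).
    exact: ind_shift.
  have b1 := bnd w w' wX w'X ww'.
  have w'w : w' != w by rewrite eq_sym.
  have b2 := bnd w' w w'X wX w'w.
  rewrite /e; rewrite (edC _ w' w) in b2.
  apply: le_trans (ler_norm _) _; rewrite !normrM -mulrA.
  rewrite (ger0_norm p0) [`|1 - _|]ger0_norm ?subr_ge0 //.
  apply: ler_pM; rewrite ?mulr_ge0 ?subr_ge0 //; first by rewrite ler_piMr // gerBl.
  by rewrite expr2; apply: ler_pM.
- exact: dJ.
- by rewrite /e edC; apply: dJ; rewrite // eq_sym.
- rewrite disjoints_subset; apply/fintype.subsetP => f /imsetP[z].
  rewrite !inE !negb_or => /and3P[zw zw' zX] ->.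
  apply/imsetP => -[y]; rewrite !inE !negb_or => /and3P[yw' yw yX].
  move=> /(congr1 val); rewrite !val_ed 1?eq_sym // => /setP /(_ w).
  rewrite !inE eqxx (negbTE ww') /= => /esym/eqP wy.
  by rewrite wy eqxx in yw.
Qed.

End Bounds.
End LocalStructure.

(** * Concentration on the second day *)
Section SecondDay.
Variables (V : finType) (e0 : vpair V).
Implicit Types (u v w x y : V) (A B G : {set vpair V}) (W Y X S : {set V}).
Notation ed := (ed e0).
Notation vsum := (vsum e0).
Notation dsum := (dsum e0).
Notation reach := (reach e0).
Notation zsum := (zsum e0).

Lemma touch_sub X X' : X \subset X' -> ~: touch X' \subset ~: touch X.
Proof.
move=> XX'; rewrite setCS; apply/fintype.subsetP => e; rewrite !inE.
case/set0Pn => x; rewrite inE => /andP[xe xX]; apply/set0Pn; exists x.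
by rewrite inE xe (fintype.subsetP XX').
Qed.

Lemma reach_mix X X' S t A B : X \subset X' ->
  reach X' S t (mix (~: touch X) A B) = reach X' S t A.
Proof.
move=> XX'; apply: (dep_sub (touch_sub XX') (@reach_dep _ e0 X' S t)) => e eX.
by rewrite in_mix eX.
Qed.

Lemma vsum_mix X u W Y A B : u \in X -> u \notin W ->
  vsum u W Y (mix (~: touch X) A B) = vsum u W Y B.
Proof.
move=> uX uW; apply: (vsum_dep_touch e0 Y uX uW) => e eX.
by rewrite in_mix in_setC eX.
Qed.

(** The second-day statistic of [u] in the graph deprived of [X :\ u]. *)
Definition zloc X S u G : int := vsum u (~: X) (reach X S (nthr S u) G) G.

Section Bounds.
Variables (R : realType) (p : R) (M : nat) (eta : R).
Hypothesis p01 : 0 <= p <= 1.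
Hypothesis pb : @point_bound R (vpair V) p M eta.
Hypothesis eta0 : 0 <= eta.
Hypothesis MV : (M + 4 <= #|V|)%N.
Let pc : vpair V -> R := fun=> p.

Let pc01 : forall e, 0 <= pc e <= 1 := const01 p01.

(** Deleting [v] changes the status of [w] only if [w] is joined to [v] and is
    within one unit of its threshold. *)
Lemma reach_diff u v S t w : u != v -> w \in ~: (v |: [set u]) ->
  Pr pc (fun A => (w \in reach [set u] S t A) != (w \in reach (v |: [set u]) S t A))
    <= p * eta.
Proof.
move=> uv wX; set X := v |: [set u] in wX *.
have [wu wv] : w != u /\ w != v.
  by move: wX; rewrite !inE negb_or => /andP[].
pose c : int := if v \in S then t w - 1 else t w.
apply: le_trans (_ : Ex pc (fun A =>
    (ed w v \in A)%:R * (dsum X S w A == c)%R%:R) <= _).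
  apply: ler_Ex => [|A]; first exact: pc01.
  rewrite !inE (negbTE wu) (negbTE wv) /= (@dsum_setU1 _ _ _ _ _ v) ?inE // 1?eq_sym //.
  rewrite -/X; set z := dsum X S w A; case: ifP => _; last by rewrite addr0 eqxx mul0r.
  have := ind_shift R (t w) z (v \in S); rewrite -/c mul1r; apply: le_trans.
  rewrite /sgn; case: (t w <= z + _); case: (t w <= z);
    by rewrite /= ?subrr ?normr0 ?subr0 ?sub0r ?normrN ?normr1 ?lexx ?ler01.
rewrite (@Ex_indep _ _ _ [set ed w v]).
- rewrite Ex_in; case/andP: p01 => p0 _; apply: ler_wpM2l => //.
  apply: (vsum_point e0 pb); first by rewrite !inE eqxx.
  have := le_room _ (card_setCU1 w X) (card_setU1_le v [set u]).
  by rewrite cards1; apply; move: MV; clear; lia.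
- by move=> A B AB; rewrite AB // inE.
- move=> A B AB; congr (nat_of_bool (_ == _))%:R.
  apply: (vsum_dep (e0 := e0) S (_ : w \notin _)); first by rewrite !inE eqxx.
  move=> f /imsetP[y]; rewrite !inE !negb_or => /and3P[yw yv yu] ->.
  apply: AB; rewrite !inE; apply: contra yv => /eqP/ed_inj -> //.
  by rewrite eq_sym.
Qed.

(** The first term accounts for the edge joining [u] and [v]; otherwise, given
    the graph without [u], each vertex whose status depends on [v] changes the
    probability by at most [2 * p * eta]. *)
Lemma zsum_zloc u v S : u != v ->
  Ex pc (fun G => `|(1 <= zsum S u G)%R%:R - (1 <= zloc (v |: [set u]) S u G)%R%:R|)
    <= p + 2 * p * eta * (#|V|%:R * (p * eta)).
Proof.
move=> uv; set X := v |: [set u]; case/andP: (p01) => p0 p1.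
have uX : u \notin ~: X by rewrite !inE eqxx orbT.
pose g G := vsum u (~: X) (reach [set u] S (nthr S u) G) G.
apply: le_trans (_ : Ex pc (fun G => (ed u v \in G)%:R +
   `|(1 <= g G)%R%:R - (1 <= zloc X S u G)%R%:R|) <= _).
  apply: ler_Ex => [|G]; first exact: pc01.
  apply: le_trans (ler_distD (1 <= g G)%R%:R _ _) _; rewrite lerD2r.
  rewrite zsumE (@vsum_setD1 _ _ _ _ _ _ v); last by rewrite !inE eq_sym.
  have -> : ~: [set u] :\ v = ~: X by apply/setP => y; rewrite !inE negb_or.
  rewrite -/(g G); case: ifP => _; last by rewrite addr0 subrr normr0.
  by case: (1 <= _); case: (1 <= g G);
    rewrite /= ?subrr ?normr0 ?subr0 ?sub0r ?normrN ?normr1 ?lexx ?ler01.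
rewrite ExD Ex_in lerD2l (Ex_mix pc (~: touch [set u])).
have MX : (M < #|~: X|)%N.
  have := card_setCU1 v [set u]; rewrite cards1 -/X; move: MV; clear; lia.
apply: le_trans (_ : Ex pc (fun A => 2 * p * eta *
   #|[set w in ~: X | (w \in reach [set u] S (nthr S u) A) !=
                      (w \in reach X S (nthr S u) A)]|%:R) <= _).
  apply: ler_Ex => [|A]; first exact: pc01.
  apply: le_trans (vsum_flips e0 p01 pb _ _ 1 uX MX).
  rewrite le_eqVlt; apply/orP; left; apply/eqP; apply: eq_Ex => B.
  rewrite /g /zloc !reach_mix ?subsetUr ?fintype.subxx //.
  by rewrite !vsum_mix // inE.
rewrite ExZ; apply: ler_wpM2l; first by rewrite !mulr_ge0.
under eq_Ex do rewrite -sum1_card natr_sum big_mkcond /=.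
rewrite Ex_sum; apply: le_trans (_ : \sum_(w : V) p * eta <= _); last first.
  by rewrite sumr_const mulr_natl.
apply: ler_sum => w _.
case: (boolP (w \in ~: X)) => wX.
  apply: le_trans (reach_diff S (nthr S u) uv wX).
  apply: ler_Ex => [|A]; first exact: pc01.
  by rewrite in_set wX /=; case: (_ != _).
rewrite (eq_Ex _ (_ : _ =1 fun=> 0)) ?Ex_cst ?mulr_ge0 // => A.
by rewrite in_set (negbTE wX).
Qed.

(** The first term is the cost of localizing two events, the second one bounds
    the covariance of the localized events. *)
Definition cov_bound : R :=
  4 * (p + 2 * p * eta * (#|V|%:R * (p * eta))) +
  (2 * p * eta) ^+ 2 * (#|V|%:R + #|V|%:R ^+ 2 * (p * eta ^+ 2)).

(** Given the graph outside [u] and [v], the two localized events are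
    independent, and their conditional probabilities only depend on the number
    of vertices that reach the threshold, in a Lipschitz way. *)
Lemma Cov_zloc u v S : u != v ->
  Cov pc (fun G => (1 <= zloc (v |: [set u]) S u G)%R%:R)
         (fun G => (1 <= zloc (v |: [set u]) S v G)%R%:R) <=
  (2 * p * eta) ^+ 2 * (#|V|%:R + #|V|%:R ^+ 2 * (p * eta ^+ 2)).
Proof.
move=> uv; set X := v |: [set u].
have uX : u \in X by rewrite !inE eqxx orbT.
have vX : v \in X by rewrite !inE eqxx.
have nX x : x \in X -> x \notin ~: X by move=> xX; rewrite in_setC negbK.
pose F x A := Pr pc (fun B => 1 <= vsum x (~: X) (reach X S (nthr S x) A) B).
have zE x A B : x \in X -> zloc X S x (mix (~: touch X) A B) =
    vsum x (~: X) (reach X S (nthr S x) A) B.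
  by move=> xX; rewrite /zloc reach_mix ?fintype.subxx // vsum_mix // nX.
have EF x : x \in X -> Ex pc (fun G => (1 <= zloc X S x G)%R%:R) = Ex pc (F x).
  move=> xX; rewrite (Ex_mix pc (~: touch X)); apply: eq_Ex => A.
  by apply: eq_Ex => B; rewrite zE.
have EFF : Ex pc (fun G => (1 <= zloc X S u G)%R%:R * (1 <= zloc X S v G)%R%:R) =
    Ex pc (fun A => F u A * F v A).
  rewrite (Ex_mix pc (~: touch X)); apply: eq_Ex => A.
  pose Ju := [set ed u w | w in ~: X].
  rewrite /F /Pr -(@Ex_indep _ _ _ Ju).
  - by apply: eq_Ex => B; rewrite !zE.
  - by move=> B B' BB'; rewrite (vsum_dep (e0 := e0) _ (nX u uX) BB').
  - move=> B B' BB'; rewrite (vsum_dep (e0 := e0) (A := B) (B := B') _ (nX v vX)) // => f.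
    move=> /imsetP[y yX ->]; apply: BB'; rewrite in_setC.
    apply/imsetP => -[z zX] /(congr1 val).
    have [yv yu] : y != v /\ y != u by move: yX; rewrite !inE negb_or => /andP[].
    have [zv zu] : z != v /\ z != u by move: zX; rewrite !inE negb_or => /andP[].
    rewrite !val_ed 1?eq_sym // => /setP /(_ u).
    by rewrite !inE eqxx (negbTE uv) eq_sym (negbTE yu).
have VF x : x \in X -> Var pc (F x) <=
    (2 * p * eta) ^+ 2 * (#|V|%:R + #|V|%:R ^+ 2 * (p * eta ^+ 2)).
  move=> xX; have cX : #|X| = 2%N by rewrite cardsU1 cards1 inE eq_sym uv.
  apply: le_trans (_ : (2 * p * eta) ^+ 2 *
      Var pc (fun A => #|reach X S (nthr S x) A|%:R) <= _).
    apply: Var_comp_le => [e|A B]; first exact: pc01.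
    have sub A' : ~: X :&: reach X S (nthr S x) A' = reach X S (nthr S x) A'.
      by apply/setIidPr/fintype.subsetP => y; rewrite inE => /andP[].
    rewrite -(sub A) -(sub B); apply: (vsum_count e0 p01 pb); first exact: nX.
    have := cardsC X; rewrite cX; move: MV; clear; lia.
  apply: ler_wpM2l; first exact: sqr_ge0.
  by apply: (Var_reach e0 p01 pb) => //; rewrite cX -addnA.
rewrite /Cov EFF !EF //.
apply: le_trans (Cov_le pc01 _ _) _.
have := VF u uX; have := VF v vX; set a := Var _ _; set b := Var _ _.
set c := _ * (_ + _) => h1 h2; rewrite ler_pdivrMr // mulr_natr mulr2n addrC.
exact: lerD.
Qed.

Lemma Cov_zsum u v S : u != v ->
  Cov pc (fun G => (1 <= zsum S u G)%R%:R) (fun G => (1 <= zsum S v G)%R%:R) <=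
  cov_bound.
Proof.
move=> uv; set X := v |: [set u].
have XE : X = u |: [set v] by rewrite /X setUC.
have i01 (b : bool) : 0 <= (b%:R : R) <= 1 by rewrite ler0n lern1 leq_b1.
apply: le_trans (@Cov_approx _ _ pc _ (fun G => (1 <= zloc X S u G)%R%:R) _
   (fun G => (1 <= zloc X S v G)%R%:R) pc01 _ _ _ _) _ => //.
have h1 := zsum_zloc S uv.
have vu : v != u by rewrite eq_sym.
have h2 := zsum_zloc S vu; rewrite -XE in h2; rewrite -/X in h1.
have h3 := Cov_zloc S uv; rewrite -/X in h3.
rewrite /cov_bound addrC; apply: lerD => //.
have := lerD h1 h2; set a := Ex _ _; set b := Ex _ _; set c := p + _.
move=> h; have -> : 4 * c = 2 * (c + c) by ring.
by apply: ler_wpM2l.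
Qed.

Lemma cov_bound_ge0 : 0 <= cov_bound.
Proof.
case/andP: p01 => p0 p1.
by rewrite /cov_bound addr_ge0 // !mulr_ge0 ?addr_ge0 ?mulr_ge0 ?exprn_ge0 ?mulr_ge0.
Qed.

(** Ties are left out, so that the conditional probability of the event given
    the graph without [u] only depends on the number of red vertices of the
    previous day. *)
Definition sure_red S G : {set V} := [set u | 1 <= zsum S u G].

Lemma Var_sure_red S : Var pc (fun G => #|sure_red S G|%:R) <=
  #|V|%:R + #|V|%:R ^+ 2 * cov_bound.
Proof.
have E G : #|sure_red S G|%:R = \sum_(u in [set: V]) (1 <= zsum S u G)%R%:R :> R.
  rewrite /sure_red -sum1_card natr_sum big_mkcond [RHS]big_mkcond /=.
  by apply: eq_bigr => u _; rewrite !inE; case: (1 <= _).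
under [X in Var _ X]boolp.funext do rewrite E.
rewrite -cardsT; apply: Var_sum_le => // [|u v _ _]; first exact: cov_bound_ge0.
exact: Cov_zsum.
Qed.

End Bounds.
End SecondDay.

(** * Lower bounds for signed neighbour counts *)
Section Separation.
Variables (V : finType) (e0 : vpair V).
Implicit Types (u v w x y : V) (A B G : {set vpair V}) (W F Y X S : {set V}).
Notation ed := (ed e0).
Notation vsum := (vsum e0).
Notation dsum := (dsum e0).
Notation reach := (reach e0).
Notation zsum := (zsum e0).

Definition nbe u F A : nat := #|A :&: [set ed u w | w in F]|.

Lemma vsumUD u W F Y A : F \subset W ->
  vsum u W Y A = vsum u (W :\: F) Y A + vsum u F Y A.
Proof.
move=> FW; rewrite /vsum (bigID (mem F)) /= addrC; congr (_ + _).
  by apply: eq_bigl => w; rewrite inE andbC.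
apply: eq_bigl => w; case: (boolP (w \in F)) => [/(fintype.subsetP FW) ->|] //=.
by rewrite andbF.
Qed.

Lemma vsum_sub u F Y A : u \notin F -> F \subset Y -> vsum u F Y A = nbe u F A.
Proof.
by move=> uF FY; rewrite vsumE // (setIidPl FY) lin_sg_pos.
Qed.

Lemma vsum_disjoint u F Y A : u \notin F -> [disjoint F & Y] ->
  vsum u F Y A = - (nbe u F A)%:Z.
Proof.
move=> uF FY; rewrite -(@vsum_sub u F F) // /vsum -sumrN.
apply: eq_bigr => w wF; rewrite wF (disjointFr FY wF).
by case: ifP; rewrite ?oppr0.
Qed.

Lemma nbe_dep u F : dep [set ed u w | w in F] (nbe u F).
Proof.
move=> A B AB; apply: eq_card => e; rewrite !inE.
by case: (boolP (e \in [set ed u w | w in F])) => [/AB ->|]; rewrite ?andbF.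
Qed.

Lemma star_disjoint u W F : u \notin W -> u \notin F -> [disjoint W & F] ->
  [set ed u w | w in F] \subset ~: [set ed u w | w in W].
Proof.
move=> uW uF WF; apply/fintype.subsetP => e /imsetP[w wF ->].
rewrite inE; apply/imsetP => -[y yW ewy].
have wy : w = y.
  by apply: ed_inj ewy; [apply: contraNneq uF => ->|apply: contraNneq uW => ->].
by move: yW; rewrite -wy (disjointFl WF wF).
Qed.

Lemma reach_mono X S S' t t' A : S' \subset S -> (forall w, t w <= t' w) ->
  reach X S' t' A \subset reach X S t A.
Proof.
move=> SS' tt'; apply/fintype.subsetP => w; rewrite !inE => /andP[-> h] /=.
by apply: le_trans (tt' w) (le_trans h (vsum_mono _ _ _ _ SS')).
Qed.

Lemma nthr_bounds S u w : -1 <= nthr S u w <= 2.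
Proof. by rewrite /nthr /thr /sgn; case: (w \in S); case: (u \in S). Qed.

Section Bounds.
Variables (R : realType) (p : R).
Hypothesis p0 : 0 < p.
Hypothesis p2 : p <= 2^-1.
Let pc : vpair V -> R := fun=> p.

Let pc01 : forall e, 0 <= pc e <= 1 := const01 (prob_le_half p0 p2).

Lemma vsum_lb u W Y (a s : R) (k : int) : u \notin W -> 1 <= a -> a + 3 <= s ->
  s ^+ 2 = p * #|W|%:R ->
  `|k%:~R - p * (2 * #|W :&: Y|%:R - #|W|%:R)| < a * s ->
  tail_cst a / s <= Pr pc (fun A => (vsum u W Y A == k) || (vsum u W Y A == k + 1)).
Proof.
move=> uW a1 as_ sE hk; rewrite /Pr; under eq_Ex do rewrite !vsumE //.
apply: lin_point_lb => // [i| |]; first exact: sg_unit.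
  by rewrite sg_supp card_edges.
by rewrite Ex_lin_sg card_edgesI // card_edges.
Qed.

(** A window of length [2 L] around zero is covered by [L - 1] disjoint pairs
    of consecutive values. *)
Lemma vsum_window u W Y (a s : R) (L : nat) : u \notin W -> 1 <= a -> a + 3 <= s ->
  s ^+ 2 = p * #|W|%:R ->
  L%:R + `|p * (2 * #|W :&: Y|%:R - #|W|%:R)| < a * s ->
  L.-1%:R * (tail_cst a / s) <= Pr pc (fun A => `|vsum u W Y A| < L%:Z).
Proof.
move=> uW a1 as_ sE hk.
apply: le_trans (_ : \sum_(j < L.-1) Pr pc (fun A =>
   (vsum u W Y A == 1 - L%:Z + (2 * j)%N) || (vsum u W Y A == 1 - L%:Z + (2 * j)%N + 1)) <= _).
  rewrite mulr_natl -[X in _ *+ X]card_ord -sumr_const.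
  apply: ler_sum => j _; apply: vsum_lb => //.
  apply: le_lt_trans (ler_normB _ _) _; apply: le_lt_trans hk; rewrite lerD2r.
  rewrite -intr_norm -[L%:R]/(L%:Z%:~R) ler_int.
  by have := ltn_ord j; lia.
rewrite /Pr -Ex_sum; apply: ler_Ex => [|A]; first exact: pc01.
set z := vsum u W Y A.
have [h|h] := boolP (`|z| < L%:Z).
  rewrite -natr_sum ler_nat.
  have [j0|j0] := leqP L.-1 0.
    by move: j0; rewrite leqn0 => /eqP ->; rewrite big_ord0.
  pose k := (absz (z + L%:Z - 1)%R)./2.
  have [kL|kL] := ltnP k L.-1.
    rewrite (bigD1 (Ordinal kL)) //= big1 ?addn0 ?leq_b1 // => j jk.
    apply/eqP; rewrite eqb0; apply: contra jk => jz; apply/eqP/val_inj => /=.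
    by move: jz; rewrite /k; lia.
  rewrite big1 // => j _; apply/eqP; rewrite eqb0.
  by apply/negP => jz; have := ltn_ord j; move: kL jz; rewrite /k; lia.
rewrite big1 // => j _; apply/eqP; rewrite pnatr_eq0 eqb0.
by apply: contra h => jz; have := ltn_ord j; lia.
Qed.

End Bounds.
End Separation.

(** * Estimates on the first two days *)
Section FirstTwoDays.
Variables (V : finType) (e0 : vpair V).
Implicit Types (u v w x y : V) (A B G : {set vpair V}) (W F Y X T : {set V}).
Notation ed := (ed e0).
Notation vsum := (vsum e0).
Notation dsum := (dsum e0).
Notation reach := (reach e0).
Notation zsum := (zsum e0).
Notation nbe := (nbe e0).

Variables (R : realType) (p sd : R).
Hypothesis p0 : 0 < p.
Hypothesis p10 : p <= 10^-1.
Hypothesis sd1000 : 10 ^+ 3 <= sd.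
Hypothesis sdE : sd ^+ 2 = p * #|V|%:R.
Let pc : vpair V -> R := fun=> p.
Let n : R := #|V|%:R.
Let eta := 4 / sd.
Let kap : R := tail_cst 64.

Let p01 : 0 <= p <= 1 := prob_le_tenth p0 p10.
Let pc01 : forall e, 0 <= pc e <= 1 := const01 p01.

Lemma point_bound_sd : @point_bound R (vpair V) p (uphalf #|V|) eta.
Proof.
move: p0 p10 sd1000 sdE => h0 h1 h2 hs W Y k MW.
have -> : eta = 2 / (sd / 2) by rewrite /eta; field; rewrite gt_eqF //; lra.
apply: lin_point_ub => // [|i| |]; first by lra.
- exact: sg_unit.
- lra.
have nW : #|V|%:R <= 2 * #|W|%:R :> R.
  by rewrite -natrM ler_nat; move: MW; clear; lia.
rewrite sg_supp expr_div_n hs.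
have -> : p * #|V|%:R / 2 ^+ 2 = p * (#|V|%:R / 4) by field.
rewrite [leRHS]mulrCA; apply: ler_wpM2l; first by lra.
have : #|W|%:R * 2^-1 <= #|W|%:R * (1 - p).
  by apply: ler_wpM2l; rewrite ?ler0n //; lra.
lra.
Qed.

Lemma eta_gt0 : 0 < eta.
Proof. by move: sd1000 => h; rewrite /eta divr_gt0 //; lra. Qed.

Lemma sd_le_n : sd <= n.
Proof.
move: p0 p10 sd1000 sdE => h0 h1 h2 hs.
have n0 : 0 <= n by rewrite /n.
have : sd * 1 <= sd * sd by apply: ler_wpM2l; lra.
rewrite -expr2 hs -/n => h; apply: le_trans (_ : sd * 1 <= _); first by rewrite mulr1.
by apply: le_trans h _; rewrite ler_piMl //; lra.
Qed.

Lemma p_eta_n : p * (eta * n) = 4 * sd.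
Proof.
move: sd1000 sdE => h hs; have -> : p * (eta * n) = 4 / sd * (sd ^+ 2).
  by rewrite hs /eta -/n; ring.
by field; rewrite gt_eqF //; lra.
Qed.

Lemma room : (uphalf #|V| + 4 <= #|V|)%N.
Proof.
have : 1000%:R <= #|V|%:R :> R by apply: le_trans sd_le_n; move: sd1000 => h; lra.
by rewrite ler_nat; clear; lia.
Qed.

Lemma Var_reach_sd u T t : Var pc (fun A => #|reach [set u] T t A|%:R) <= 17 * n.
Proof.
move: p0 p10 sd1000 sdE => h0 h1 h2 hs.
have /le_trans : Var pc (fun A => #|reach [set u] T t A|%:R) <=
    #|V|%:R + #|V|%:R ^+ 2 * (p * eta ^+ 2).
  apply: (Var_reach e0 p01 point_bound_sd); last by apply: ltW; exact: eta_gt0.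
  by rewrite cards1; move: room; clear; lia.
apply; rewrite -/n.
have -> : n ^+ 2 * (p * eta ^+ 2) = n * (p * (eta * n)) * eta by ring.
rewrite p_eta_n /eta.
have -> : n * (4 * sd) * (4 / sd) = 16 * n by field; rewrite gt_eqF //; lra.
lra.
Qed.

(** The red and blue sides have almost the same size, so every vertex reaches
    its threshold with probability one half up to a multiple of [eta]. *)
Lemma reach_mean u T t (q : nat) : (forall w, -1 <= t w <= 2) ->
  p * q%:R <= 1 -> `|2 * #|T|%:R - n| <= q%:R ->
  `|Ex pc (fun A => #|reach [set u] T t A|%:R) - n / 2| <= 4 * (eta * n).
Proof.
move: p0 p10 sd1000 sdE => h0 h1 h2 hs t12 pq Tq.
have eg := eta_gt0.
have cardU : #|~: [set u]|%:R = n - 1 :> R.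
  by rewrite /n -(cardsC [set u]) cards1 natrD; ring.
have -> : Ex pc (fun A => #|reach [set u] T t A|%:R) - n / 2 =
    (\sum_(w in ~: [set u]) (2 * Pr pc (fun A => t w <= dsum [set u] T w A) - 1)) / 2
    - 2^-1.
  under eq_Ex do rewrite card_reach.
  rewrite Ex_sum sumrB -mulr_sumr sumr_const -mulr_natl cardU /Pr.
  by field.
have bnd : `|\sum_(w in ~: [set u]) (2 * Pr pc (fun A => t w <= dsum [set u] T w A) - 1)|
    <= 7 * (eta * n).
  apply: le_trans (ler_norm_sum _ _ _) _.
  apply: le_trans (_ : \sum_(w in ~: [set u]) 7 * eta <= _); last first.
    rewrite sumr_const -[leLHS]mulr_natl cardU.
    have -> : 7 * (eta * n) = n * (7 * eta) by ring.
    by apply: ler_wpM2r; lra.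
  apply: ler_sum => w; rewrite in_setC in_set1 => wu.
  set W := ~: (w |: [set u]).
  have cW : #|W|%:R = n - 2 :> R.
    have c2 : #|w |: [set u]| = 2%N by rewrite cards2 wu.
    by rewrite /n -(cardsC (w |: [set u])) c2 natrD; ring.
  have wW : w \notin W by rewrite !inE eqxx.
  apply: le_trans (vsum_half e0 p01 point_bound_sd T (t w) wW _) _.
    by have := card_setCU1 w [set u]; rewrite cards1 -/W; move: room; clear; lia.
  have TW : `|2 * #|W :&: T|%:R - #|W|%:R| <= q%:R + 2 :> R.
    have cT : #|W :&: T|%:R = #|T|%:R - #|T :&: (w |: [set u])|%:R :> R.
      have hT : #|T|%:R = #|T :&: (w |: [set u])|%:R + #|T :\: (w |: [set u])|%:R :> R.
        by rewrite -natrD cardsID.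
      by rewrite hT /W setIC -setDE addrAC subrr add0r.
    have x2 : #|T :&: (w |: [set u])|%:R <= 2 :> R.
      have c2 : #|w |: [set u]| = 2%N by rewrite cards2 wu.
      by rewrite -c2 ler_nat subset_leq_card // subsetIr.
    have x0 : 0 <= #|T :&: (w |: [set u])|%:R :> R by [].
    rewrite cW cT; move: Tq; rewrite !ler_norml => /andP[q1 q2].
    by apply/andP; split; lra.
  have t3 : `|2 * t w - 1|%:~R <= 3 :> R.
    by rewrite -[3]/(3%:~R) ler_int; have := t12 w; clear; lia.
  have e1 : eta * `|2 * t w - 1|%:~R <= eta * 3 by apply: ler_wpM2l => //; lra.
  have e2 : 2 * p * eta * `|2 * #|W :&: T|%:R - #|W|%:R| <= 2 * p * eta * (q%:R + 2).
    apply: ler_wpM2l => //.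
    exact: mulr_ge0 (mulr_ge0 (ler0n _ 2) (ltW h0)) (ltW eg).
  have e3 : eta * (p * q%:R) <= eta * 1 by apply: ler_wpM2l => //; lra.
  have e4 : eta * p <= eta * 2^-1 by apply: ler_wpM2l => //; lra.
  lra.
have e5 : 1 <= eta * n.
  have -> : eta * n = 4 * n / sd by rewrite /eta; ring.
  by rewrite ler_pdivlMr ?mul1r; [have := sd_le_n; lra|lra].
move: bnd; rewrite !ler_norml => /andP[b1 b2]; apply/andP; split; lra.
Qed.

(** The random neighbourhood of [u] meets the difference of the two
    configurations in at least [L] vertices with probability one half;
    independently, its red and blue members outside of the difference differ by
    less than [L] with probability of order [L / sd]. *)
Lemma separate_day2 u Y Y' (L : nat) : u \notin Y -> Y' \subset Y ->
  `|#|Y|%:R - n / 2| <= 5 * (eta * n) -> `|#|Y'|%:R - n / 2| <= 5 * (eta * n) ->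
  2 * L%:R <= p * #|Y :\: Y'|%:R -> (4 <= L)%N -> L%:R <= sd ->
  2^-1 * (L.-1%:R * (kap / sd)) <=
  Pr pc (fun B => (1 <= vsum u (~: [set u]) Y B) && (vsum u (~: [set u]) Y' B <= -1)).
Proof.
move: p0 p10 sd1000 sdE => h0 h1 h2 hs uY Y'Y hY hY' hL L4 Lsd.
have eg := eta_gt0; have sdn := sd_le_n.
have sdp : 0 < sd by lra.
set F := Y :\: Y' in hL *; set W := ~: [set u] :\: F.
have uF : u \notin F by rewrite inE negb_and uY orbT.
have FU : F \subset ~: [set u].
  by apply/fintype.subsetP => w wF; rewrite !inE; apply: contraNneq uF => <-.
have FY : F \subset Y by apply: subsetDl.
have FY' : [disjoint F & Y'] by rewrite disjoints_subset subsetDr.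
have uW : u \notin W by rewrite !inE eqxx andbF.
have cF : #|F|%:R = #|Y|%:R - #|Y'|%:R :> R.
  by rewrite cardsD (setIidPr Y'Y) natrB // subset_leq_card.
have cW : #|W|%:R = n - 1 - #|F|%:R :> R.
  rewrite cardsD (setIidPr FU) natrB ?subset_leq_card //; congr (_ - _).
  by rewrite /n -(cardsC [set u]) cards1 natrD; ring.
have WY' : W :&: Y' = Y'.
  apply/setIidPr/fintype.subsetP => y yY'; rewrite !inE yY' /=.
  by apply: contraNneq uY => <-; apply: (fintype.subsetP Y'Y).
pose Z0 := vsum u W Y'.
pose N := nbe u F.
have ZY B : vsum u (~: [set u]) Y B = Z0 B + (N B)%:Z.
  rewrite (vsumUD e0 u Y B FU) (vsum_sub e0 B uF FY) -/(N B); congr (_ + _).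
  apply: eq_vsum => w; rewrite inE => /andP[wF _] _.
  by move: wF; rewrite inE negb_and negbK; case: (boolP (w \in Y')) => //= wY' ;
    rewrite ?(fintype.subsetP Y'Y _ wY') // => /negbTE.
have ZY' B : vsum u (~: [set u]) Y' B = Z0 B - (N B)%:Z.
  by rewrite (vsumUD e0 u Y' B FU) (vsum_disjoint e0 B uF FY').
apply: le_trans (_ : Ex pc (fun B => (L <= N B)%N%:R * (`|Z0 B| < L%:Z)%R%:R) <= _).
  rewrite (@Ex_indep _ _ _ [set ed u w | w in F]).
  - apply: ler_pM.
    + by rewrite invr_ge0.
    + by rewrite mulr_ge0 // divr_ge0 // ltW // tail_cst_gt0.
    + have -> : Ex pc (fun B => (L <= N B)%N%:R) =
         Pr pc (fun B => (L <= #|B :&: [set ed u w | w in F]|)%N) by [].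
      by apply: card_half_mean; rewrite ?card_edges //; lra.
    + have Fsd : eta * n <= n / 250.
        rewrite /eta mulrAC ler_pdivrMr //.
        have : n * 1000 <= n * sd by apply: ler_wpM2l => //; lra.
        lra.
      have F0 : 0 <= #|F|%:R :> R by [].
      have n1000 : 1000 <= n by lra.
      have Fn : #|F|%:R <= n / 25.
        rewrite cF; move: hY hY'; rewrite !ler_norml => /andP[? ?] /andP[? ?]; lra.
      pose s := Num.sqrt (p * #|W|%:R).
      have W2 : n / 2 <= #|W|%:R by rewrite cW; lra.
      have s2 : s ^+ 2 = p * #|W|%:R by rewrite sqr_sqrtr // mulr_ge0 //; lra.
      have s0 : 0 <= s by apply: sqrtr_ge0.
      have ssd : s <= sd.
        rewrite -(ler_pXn2r (n := 2)) ?nnegrE // ?s2 ?hs; last by lra.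
        by apply: ler_wpM2l; [lra|rewrite -/n cW; lra].
      have s7 : 7 / 10 * sd <= s.
        rewrite -(ler_pXn2r (n := 2)) ?nnegrE //; last by lra.
        rewrite s2 exprMn hs -/n.
        have : p * (n / 2) <= p * #|W|%:R by apply: ler_wpM2l => //; lra.
        have : 0 <= p * n by apply: mulr_ge0; lra.
        lra.
      (* The mean of the balance is at most 10 p eta n + p, that is 40 sd + p, and
         L <= sd; this stays below 64 s because s >= 0.7 sd. *)
      have hw : L.-1%:R * (kap / s) <= Pr pc (fun B => `|Z0 B| < L%:Z).
        apply: (vsum_window e0 h0) => //; [lra|lra|lra|].
        rewrite WY' cW cF.
        have -> : p * (2 * #|Y'|%:R - (n - 1 - (#|Y|%:R - #|Y'|%:R))) =
           p * ((#|Y'|%:R - n / 2) + (#|Y|%:R - n / 2) + 1) by field.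
        rewrite normrM (ger0_norm (ltW h0)).
        have : `|#|Y'|%:R - n / 2 + (#|Y|%:R - n / 2) + 1| <= 10 * (eta * n) + 1.
          move: hY hY'; rewrite !ler_norml => /andP[? ?] /andP[? ?].
          by apply/andP; split; lra.
        move/(ler_wpM2l (ltW h0)) => hh.
        have := p_eta_n; lra.
      apply: le_trans hw; apply: ler_wpM2l => //.
      by apply: ler_wpM2l; [by apply: ltW; exact: tail_cst_gt0|rewrite lef_pV2 ?posrE //; lra].
  - by move=> B B' BB'; rewrite /N (nbe_dep BB').
  - move=> B B' BB'; congr (nat_of_bool (`|_| < _))%:R.
    apply: (vsum_dep (e0 := e0) Y' uW) => e eW; apply: BB'.
    apply: (fintype.subsetP (star_disjoint e0 uF uW _)) eW.
    by rewrite disjoint_sym disjoints_subset subsetDr.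
apply: ler_Ex => [|B]; first exact: pc01.
rewrite -natrM ler_nat mulnb ZY ZY'.
case: (boolP (_ && _)) => // /andP[LN Z0L].
rewrite lt0b; move: (Z0 B) (N B) LN Z0L L4; clear => z k; lia.
Qed.

End FirstTwoDays.

(** * Expected lead on the second day *)
Section Gap.
Variables (V : finType) (e0 : vpair V).
Implicit Types (u v w x y : V) (A B G : {set vpair V}) (W F Y X T : {set V}).
Notation ed := (ed e0).
Notation vsum := (vsum e0).
Notation dsum := (dsum e0).
Notation reach := (reach e0).
Notation zsum := (zsum e0).
Notation nbe := (nbe e0).

Variables (R : realType) (p sd : R).
Hypothesis p0 : 0 < p.
Hypothesis p10 : p <= 10^-1.
Hypothesis sd1000 : 10 ^+ 3 <= sd.
Hypothesis sdE : sd ^+ 2 = p * #|V|%:R.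
Let pc : vpair V -> R := fun=> p.
Let n : R := #|V|%:R.
Let eta := 4 / sd.
Let kap : R := tail_cst 64.

Variables (S' Q : {set V}).
Hypothesis QS' : [disjoint Q & S'].
Let S := S' :|: Q.
Hypothesis cardSS' : (#|S| + #|S'|)%N = #|V|.
Let q : R := #|Q|%:R.
Hypothesis pq : p * q <= 1.
Hypothesis qn : q + 2 <= n / 2.

Let p01 : 0 <= p <= 1 := prob_le_tenth p0 p10.
Let pc01 : forall e, 0 <= pc e <= 1 := const01 p01.

Lemma card_majority : #|S|%:R = #|S'|%:R + q.
Proof. by rewrite /S cardsU disjoint_setI0 1?disjoint_sym // cards0 subn0 natrD. Qed.

Lemma card_balance : n = 2 * #|S'|%:R + q.
Proof. by rewrite /n -cardSS' natrD card_majority; ring. Qed.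

Lemma thr_off_swing w : w \notin Q -> thr S w = thr S' w.
Proof. by move=> wQ; rewrite /thr /S inE (negbTE wQ) orbF. Qed.

Lemma nthr_off_swing u w : u \notin Q -> w \notin Q -> nthr S u w = nthr S' u w.
Proof. by move=> uQ wQ; rewrite /nthr thr_off_swing // /sgn /S inE (negbTE uQ) orbF. Qed.

Lemma nthr_mono u w : u \notin Q -> nthr S u w <= nthr S' u w.
Proof.
move=> uQ; rewrite /nthr /thr /sgn /S !inE (negbTE uQ) orbF.
by case: (w \in S'); case: (w \in Q); case: (u \in S').
Qed.

(** A vertex [w] changes its first-day colour as soon as it has a neighbour in
    [Q] and is tied, up to one unit, on the remaining vertices, which are
    balanced. *)
Lemma flip_day1 u w : u \notin Q -> w \notin Q -> w != u ->
  p * q / 2 * (kap / sd) <=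
  Pr pc (fun A => w \in reach [set u] S (nthr S u) A :\:
                        reach [set u] S' (nthr S' u) A).
Proof.
move: p0 p10 sd1000 sdE pq qn => h0 h1 h2 hs hpq hqn uQ wQ wu.
have sdp : 0 < sd by lra.
have q0 : 0 <= q by rewrite /q.
set W := ~: (w |: [set u]).
have QW : Q \subset W.
  apply/fintype.subsetP => y yQ; rewrite !inE negb_or.
  by apply/andP; split; [apply: contraNneq wQ => <-|apply: contraNneq uQ => <-].
have wW : w \notin W by rewrite !inE eqxx.
have wWQ : w \notin W :\: Q by rewrite inE negb_and wW orbT.
pose Z0 := vsum w (W :\: Q) S'.
pose t := nthr S' u w.
have DS A : dsum [set u] S w A = Z0 A + (nbe w Q A)%:Z.
  rewrite /dsum -/W (vsumUD e0 w S A QW) (vsum_sub e0 A wQ (subsetUr _ _)).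
  congr (_ + _); apply: eq_vsum => y; rewrite inE => /andP[yQ _] _.
  by rewrite /S inE (negbTE yQ) orbF.
have DS' A : dsum [set u] S' w A = Z0 A - (nbe w Q A)%:Z.
  by rewrite /dsum -/W (vsumUD e0 w S' A QW) (vsum_disjoint e0 A wQ QS').
apply: le_trans (_ : Ex pc (fun A => (0 < nbe w Q A)%N%:R *
    ((Z0 A == t - 1) || (Z0 A == t - 1 + 1))%:R) <= _); last first.
  apply: ler_Ex => [|A]; first exact: pc01.
  rewrite -natrM ler_nat mulnb in_setD !inE wu /= DS DS' nthr_off_swing // -/t.
  case: (boolP (_ && _)) => // /andP[N0 ZL]; rewrite lt0b.
  by move: (Z0 A) (nbe w Q A) (t) N0 ZL; clear; lia.
rewrite (@Ex_indep _ _ _ [set ed w y | y in Q]).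
- apply: ler_pM.
  + by rewrite divr_ge0 // mulr_ge0 // ltW.
  + by rewrite divr_ge0 // ltW // tail_cst_gt0.
  + have := card_hit [set ed w y | y in Q] p01; rewrite card_edges // -/q.
    apply: le_trans; apply: ler_wpM2l; first by rewrite mulr_ge0 // ltW.
    have pq0 : 0 <= p * q by rewrite mulr_ge0 // ltW.
    by rewrite lef_pV2 ?posrE //; move: pq0 hpq; lra.
  + have cW : #|W :\: Q|%:R = n - 2 - q :> R.
      rewrite cardsD (setIidPr QW) natrB ?subset_leq_card //; congr (_ - _).
      have c2 : #|w |: [set u]| = 2%N by rewrite cards2 wu.
      by rewrite /n -(cardsC (w |: [set u])) c2 natrD; ring.
    have cWS : `|2 * #|(W :\: Q) :&: S'|%:R - #|W :\: Q|%:R| <= 2 :> R.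
      have -> : (W :\: Q) :&: S' = S' :\: (w |: [set u]).
        apply/setP => y; rewrite !inE; case: (boolP (y \in S')) => yS'; last by rewrite !andbF.
        by rewrite (disjointFl QS' yS') /= andbT.
      have x2 : #|S' :&: (w |: [set u])|%:R <= 2 :> R.
        have c2 : #|w |: [set u]| = 2%N by rewrite cards2 wu.
        by rewrite -c2 ler_nat subset_leq_card // subsetIr.
      have x0 : 0 <= #|S' :&: (w |: [set u])|%:R :> R by [].
      have e : #|S' :\: (w |: [set u])|%:R = #|S'|%:R - #|S' :&: (w |: [set u])|%:R :> R.
        by rewrite cardsD natrB // subset_leq_card // subsetIl.
      rewrite e cW ler_norml; have := card_balance; move: x2 x0.
      set a : R := _%:R; set b : R := _%:R => ? ? ->; apply/andP; split; lra.
    pose s := Num.sqrt (p * #|W :\: Q|%:R).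
    have s2 : s ^+ 2 = p * #|W :\: Q|%:R by rewrite sqr_sqrtr // mulr_ge0 //; lra.
    have s0 : 0 <= s by apply: sqrtr_ge0.
    have ssd : s <= sd.
      rewrite -(ler_pXn2r (n := 2)) ?nnegrE // ?s2 ?hs; last by apply: ltW.
      by apply: ler_wpM2l; [apply: ltW|rewrite -/n cW; move: q0; lra].
    have s7 : 7 / 10 * sd <= s.
      rewrite -(ler_pXn2r (n := 2)) ?nnegrE //; last by move: sdp; lra.
      rewrite s2 exprMn hs -/n cW.
      have hh : p * (n / 2) <= p * (n - 2 - q).
        by apply: ler_wpM2l; [apply: ltW|move: hqn; lra].
      have : 0 <= p * n by apply: mulr_ge0; [apply: ltW|].
      move: hh; lra.
    have hw : kap / s <= Pr pc (fun A => (Z0 A == t - 1) || (Z0 A == t - 1 + 1)).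
      apply: (vsum_lb e0 h0) => //.
      - by move: h1; lra.
      - by lra.
      - by move: s7 h2; lra.
      apply: le_lt_trans (ler_normB _ _) _.
      rewrite normrM (ger0_norm (ltW h0)).
      have t2 : `|(t - 1)%:~R| <= 2 :> R.
        rewrite -intr_norm -[2]/(2%:~R) ler_int; have := nthr_bounds S' u w.
        by rewrite -/t; move: (t); clear; lia.
      have := ler_wpM2l (ltW h0) cWS.
      by move: t2 h1 s7 h2; lra.
    apply: le_trans hw; apply: ler_wpM2l; first by apply: ltW; exact: tail_cst_gt0.
    by rewrite lef_pV2 ?posrE //; move: s7 sdp; lra.
- by move=> A B AB; rewrite (nbe_dep AB).
- move=> A B AB; rewrite /Z0 (vsum_dep (e0 := e0) (A := A) (B := B) S' wWQ) // => e eW; apply: AB.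
  apply: (fintype.subsetP (star_disjoint e0 wQ wWQ _)) eW.
  by rewrite disjoint_sym disjoints_subset subsetDr.
Qed.

(** A lower bound for the expected number of vertices whose first-day colour
    depends on whether [Q] is red or blue. *)
Let E0 := n * (p * q) * kap / (4 * sd).

Variable L : nat.
Hypothesis L4 : (4 <= L)%N.
Hypothesis Lsd : L%:R <= sd.
Hypothesis E0L : 4 * L%:R <= p * E0.
Hypothesis E0n : 17 * 64 * n <= E0 ^+ 2.

Lemma VarB_le (F H : {set vpair V} -> R) :
  Var pc (fun A => F A - H A) <= 2 * Var pc F + 2 * Var pc H.
Proof.
rewrite /Var ExB -!ExZ -ExD; apply: ler_Ex => [|A]; first exact: pc01.
set a := Ex pc F; set b := Ex pc H.
have := sqr_ge0 ((F A - a) + (H A - b)); lra.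
Qed.

(** Chebyshev, applied to the sizes of the two first-day configurations seen
    from [u] and to their difference, whose mean is at least [E0] by
    [flip_day1]. *)
Lemma good_day1 u : u \notin Q ->
  2^-1 <= Pr pc (fun A =>
    let Y := reach [set u] S (nthr S u) A in
    let Y' := reach [set u] S' (nthr S' u) A in
    [&& `|#|Y|%:R - n / 2| <= 5 * (eta * n), `|#|Y'|%:R - n / 2| <= 5 * (eta * n)
      & 2 * L%:R <= p * #|Y :\: Y'|%:R]).
Proof.
move=> uQ; move: p0 p10 sd1000 sdE pq qn => h0 h1 h2 hs hpq hqn.
have sdp : 0 < sd by lra.
have n0 : 0 < n by apply: lt_le_trans (sd_le_n p0 p10 sd1000 sdE).
have q0 : 0 <= q by rewrite /q.
pose YA A := reach [set u] S (nthr S u) A.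
pose YA' A := reach [set u] S' (nthr S' u) A.
pose F A : R := #|YA A|%:R; pose F' A : R := #|YA' A|%:R.
have subY A : YA' A \subset YA A.
  by apply: reach_mono; [exact: subsetUl|move=> w; exact: nthr_mono].
have cD A : #|YA A :\: YA' A|%:R = F A - F' A.
  by rewrite cardsD (setIidPr (subY A)) natrB // subset_leq_card.
have eg : 0 < eta by rewrite /eta divr_gt0.
have en : 0 < eta * n by rewrite mulr_gt0.
have mS : `|Ex pc F - n / 2| <= 4 * (eta * n).
  apply: (@reach_mean V e0 R p sd p0 p10 sd1000 sdE u S (nthr S u) #|Q|) => //.
    by move=> w; apply: nthr_bounds.
  by rewrite card_majority -/n card_balance ler_norml -/q; move: q0; set a : R := _%:R; move=> ?; apply/andP; split; lra.
have mS' : `|Ex pc F' - n / 2| <= 4 * (eta * n).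
  apply: (@reach_mean V e0 R p sd p0 p10 sd1000 sdE u S' (nthr S' u) #|Q|) => //.
    by move=> w; apply: nthr_bounds.
  by rewrite -/n card_balance ler_norml -/q; move: q0; set a : R := _%:R; move=> ?; apply/andP; split; lra.
have VS : Var pc F <= 17 * n by apply: (Var_reach_sd e0 p0 p10 sd1000 sdE).
have VS' : Var pc F' <= 17 * n by apply: (Var_reach_sd e0 p0 p10 sd1000 sdE).
have ch8 H : Var pc H <= 17 * n ->
    Pr pc (fun A => eta * n <= `|H A - Ex pc H|) <= 8^-1.
  move=> VH; apply: le_trans (Ex_chebyshev pc01 H en) _.
  rewrite ler_pdivrMr ?exprn_gt0 //; apply: le_trans VH _.
  have -> : 8^-1 * (eta * n) ^+ 2 = (2 / sd ^+ 2) * n * n.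
    by rewrite /eta; field; rewrite gt_eqF.
  apply: ler_wpM2r; first exact: ltW.
  rewrite hs -/n.
  have -> : 2 / (p * n) * n = 2 / p by field; rewrite !gt_eqF.
  by rewrite ler_pdivlMr //; move: h1; lra.
have ED : E0 <= Ex pc (fun A => F A - F' A).
  have -> : Ex pc (fun A => F A - F' A) =
      \sum_w Pr pc (fun A => w \in YA A :\: YA' A).
    rewrite /Pr -Ex_sum; apply: eq_Ex => A; rewrite -cD -sum1_card natr_sum big_mkcond.
    by apply: eq_bigr => w _; case: (w \in _).
  apply: le_trans (_ : \sum_(w in ~: (u |: Q)) p * q / 2 * (kap / sd) <= _).
    rewrite sumr_const -[leRHS]mulr_natl.
    have -> : #|~: (u |: Q)|%:R = n - 1 - q.
      rewrite /n -(cardsC (u |: Q)) cardsU1 uQ !natrD -/q /=; ring.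
    have -> : E0 = n / 2 * (p * q / 2 * (kap / sd)).
      by rewrite /E0; field; rewrite gt_eqF.
    apply: ler_wpM2r; last by move: hqn; lra.
    apply: mulr_ge0; apply: divr_ge0 => //; last exact: ltW.
      exact: mulr_ge0 (ltW h0) q0.
    by apply: ltW; exact: tail_cst_gt0.
  rewrite [leRHS](bigID (mem (~: (u |: Q)))) /= -[leLHS]addr0; apply: lerD.
    apply: ler_sum => w; rewrite !inE negb_or => /andP[wu wQ].
    exact: flip_day1.
  by apply: sumr_ge0 => w _; apply: Pr_ge0; exact: pc01.
have E0p : 0 < E0.
  have L0 : 4 <= L%:R :> R by rewrite ler_nat.
  rewrite -(pmulr_rgt0 _ h0); apply: lt_le_trans E0L; move: L0; lra.
have chD : Pr pc (fun A => F A - F' A < E0 / 2) <= 4^-1.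
  have E2 : 0 < E0 / 2 by rewrite divr_gt0.
  apply: le_trans (_ : Var pc (fun A => F A - F' A) / (E0 / 2) ^+ 2 <= _).
    apply: le_trans (Ex_chebyshev pc01 _ E2); apply: le_Pr => [|A h]; first exact: pc01.
    rewrite distrC; apply: le_trans (ler_norm _); move: ED h; lra.
  rewrite ler_pdivrMr ?exprn_gt0 //; apply: le_trans (VarB_le F F') _.
  have -> : 4^-1 * (E0 / 2) ^+ 2 = E0 ^+ 2 / 16 by field.
  by move: VS VS' E0n; lra.
have key : Pr pc (fun A => ~~ [&& `|F A - n / 2| <= 5 * (eta * n),
    `|F' A - n / 2| <= 5 * (eta * n) & 2 * L%:R <= p * #|YA A :\: YA' A|%:R]) <= 2^-1.
  apply: le_trans (_ : Pr pc (fun A => (eta * n <= `|F A - Ex pc F|) ||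
     ((eta * n <= `|F' A - Ex pc F'|) || (F A - F' A < E0 / 2))) <= _).
    apply: le_Pr => [|A]; first exact: pc01.
    apply: contraR; rewrite !negb_or -!ltNge -leNgt => /and3P[a1 a2 a3].
    apply/and3P; split.
    - move: a1 mS; rewrite ltr_norml !ler_norml => /andP[? ?] /andP[? ?].
      by apply/andP; split; lra.
    - move: a2 mS'; rewrite ltr_norml !ler_norml => /andP[? ?] /andP[? ?].
      by apply/andP; split; lra.
    - rewrite cD; have := ler_wpM2l (ltW h0) a3; move: E0L.
      by rewrite [X in _ -> X <= _ -> _](_ : _ = p * E0 / 2) ?mulrA //; lra.
  apply: le_trans (PrU pc01 _ _) _.
  apply: le_trans (lerD (ch8 F VS) (PrU pc01 _ _)) _.
  have := lerD (ch8 F' VS') chD; lra.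
by move: key; rewrite PrC; rewrite /Pr; set a := Ex _ _; move=> ?; lra.
Qed.

(** Each vertex outside [Q] contributes the bound of [separate_day2], averaged
    over the graph without it, which is favourable with probability at least one
    half by [good_day1]. *)
Lemma Ex_flip_day2 :
  n * L.-1%:R * kap / (8 * sd) <=
  Ex pc (fun G => #|red_set G S 2 :\: red_set G S' 2|%:R).
Proof.
move: p0 p10 sd1000 sdE pq qn => h0 h1 h2 hs hpq hqn.
have sdp : 0 < sd by lra.
have q0 : 0 <= q by rewrite /q.
have kap0 : 0 <= kap by apply: ltW; exact: tail_cst_gt0.
have -> : Ex pc (fun G => #|red_set G S 2 :\: red_set G S' 2|%:R) =
    \sum_u Pr pc (fun G => u \in red_set G S 2 :\: red_set G S' 2).
  rewrite /Pr -Ex_sum; apply: eq_Ex => A; rewrite -sum1_card natr_sum big_mkcond.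
  by apply: eq_bigr => w _; case: (w \in _).
set b := 2^-1 * (L.-1%:R * (kap / sd)).
have b0 : 0 <= b.
  apply: mulr_ge0; first by rewrite invr_ge0.
  by apply: mulr_ge0 => //; apply: divr_ge0 => //; exact: ltW.
apply: le_trans (_ : \sum_(u in ~: Q) 2^-1 * b <= _).
  rewrite sumr_const -[leRHS]mulr_natl.
  have -> : #|~: Q|%:R = n - q by rewrite /n -(cardsC Q) natrD -/q; ring.
  have -> : n * L.-1%:R * kap / (8 * sd) = n / 2 * (2^-1 * b).
    by rewrite /b; field; rewrite gt_eqF.
  by apply: ler_wpM2r; [rewrite mulr_ge0|move: hqn; lra].
rewrite [leRHS](bigID (mem (~: Q))) /= -[leLHS]addr0; apply: lerD; last first.
  by apply: sumr_ge0 => w _; apply: Pr_ge0; exact: pc01.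
apply: ler_sum => u; rewrite inE => uQ.
pose YA A := reach [set u] S (nthr S u) A.
pose YA' A := reach [set u] S' (nthr S' u) A.
have uU : u \notin ~: [set u] by rewrite !inE eqxx.
rewrite /Pr (Ex_mix pc (~: touch [set u])).
apply: le_trans (_ : Ex pc (fun A => ([&& `|#|YA A|%:R - n / 2| <= 5 * (eta * n),
   `|#|YA' A|%:R - n / 2| <= 5 * (eta * n) & 2 * L%:R <= p * #|YA A :\: YA' A|%:R])%:R * b) <= _).
  by rewrite ExZr; apply: ler_wpM2r => //; exact: good_day1.
apply: ler_Ex => [|A]; first exact: pc01.
case: (boolP [&& _, _ & _]) => [/and3P[a1 a2 a3]|_]; last first.
  by rewrite mul0r; apply: Ex_ge0 => [|B]; [exact: pc01|exact: ler0n].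
rewrite mul1r.
have uY : u \notin YA A by rewrite !inE eqxx.
have Y'Y : YA' A \subset YA A.
  by apply: reach_mono; [exact: subsetUl|move=> w; exact: nthr_mono].
apply: le_trans (separate_day2 e0 p0 p10 sd1000 sdE uY Y'Y a1 a2 a3 L4 Lsd) _.
apply: ler_Ex => [|B]; first exact: pc01.
rewrite ler_nat.
have zz T : zsum T u (mix (~: touch [set u]) A B) =
    vsum u (~: [set u]) (reach [set u] T (nthr T u) A) B.
  by rewrite zsumE reach_mix ?fintype.subxx // vsum_mix // inE.
case: (boolP (_ && _)) => // /andP[z1 z2]; rewrite lt0b in_setD.
rewrite /red_set /= !(majority_stepE e0) -!/(zsum _ _ _) !zz -/(YA A) -/(YA' A).
rewrite /thr; move: z1 z2; set z := vsum _ _ _ _; set z' := vsum _ _ _ _.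
by move: z z'; clear => z z'; case: ifP; case: ifP; lia.
Qed.

(** The processes started from [S'] and from the complement of [S] have the same
    expected red sizes, and the latter is the colour reversal of the process
    started from [S]. *)
Lemma Ex_red2 :
  n / 2 + n * L.-1%:R * kap / (16 * sd) <= Ex pc (fun G => #|red_set G S 2|%:R).
Proof.
have h := Ex_flip_day2.
have sub G : red_set G S' 2 \subset red_set G S 2.
  by apply: (red_set_mono e0); exact: subsetUl.
have e1 : Ex pc (fun G => #|red_set G S 2 :\: red_set G S' 2|%:R) =
   Ex pc (fun G => #|red_set G S 2|%:R) - Ex pc (fun G => #|red_set G S' 2|%:R).
  rewrite -ExB; apply: eq_Ex => G.
  by rewrite cardsD (setIidPr (sub G)) natrB // subset_leq_card.
have e2 : Ex pc (fun G => #|red_set G S' 2|%:R) = n - Ex pc (fun G => #|red_set G S 2|%:R).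
  rewrite (@Ex_red_set_card _ _ p S' (~: S)); last first.
    by have := cardsC S; move: cardSS'; clear; lia.
  rewrite -[n](Ex_cst pc) -ExB; apply: eq_Ex => G.
  by rewrite red_setC /n -(cardsC (red_set G S 2)) natrD; ring.
move: h; rewrite e1 e2.
have -> : n * L.-1%:R * kap / (16 * sd) = n * L.-1%:R * kap / (8 * sd) / 2.
  by move: sd1000 => hh; field; rewrite gt_eqF //; lra.
lra.
Qed.

(** Given the graph without [u], a tie at [u] has probability at most
    [eta]. *)
Lemma Ex_sure_red :
  n / 2 + n * L.-1%:R * kap / (16 * sd) - n * eta <=
  Ex pc (fun G => #|sure_red e0 S G|%:R).
Proof.
have h := Ex_red2.
suff : Ex pc (fun G => #|red_set G S 2|%:R) <=
       Ex pc (fun G => #|sure_red e0 S G|%:R) + n * eta by lra.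
have cE (T : sgraph V -> {set V}) : Ex pc (fun G => #|T G|%:R) =
    \sum_u Pr pc (fun G => u \in T G).
  rewrite /Pr -Ex_sum; apply: eq_Ex => A; rewrite -sum1_card natr_sum big_mkcond.
  by apply: eq_bigr => w _; case: (w \in _).
rewrite !cE.
have -> : n * eta = \sum_(u : V) eta by rewrite sumr_const -[RHS]mulr_natl.
rewrite -big_split; apply: ler_sum => u _ /=.
apply: le_trans (_ : Pr pc (fun G => u \in sure_red e0 S G) +
    Pr pc (fun G => zsum S u G == 0) <= _).
  apply: le_trans (PrU pc01 _ _); apply: le_Pr => [|G]; first exact: pc01.
  rewrite /red_set /= (majority_stepE e0) -/(zsum _ _ _) inE.
  by rewrite /thr; case: ifP => _; set z := zsum _ _ _; move: z; clear => z; lia.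
rewrite lerD2l /Pr (Ex_mix pc (~: touch [set u])).
apply: Ex_ub => [|A]; first exact: pc01.
have uU : u \notin ~: [set u] by rewrite !inE eqxx.
have pb := point_bound_sd p0 p10 sd1000 sdE.
have := vsum_point e0 pb (reach [set u] S (nthr S u) A) 0 uU _.
have MU : (uphalf #|V| <= #|~: [set u]|)%N.
  have := room p0 p10 sd1000 sdE; have := cardsC [set u]; rewrite cards1; clear; lia.
move/(_ MU); apply: le_trans; rewrite le_eqVlt; apply/orP; left; apply/eqP.
apply: eq_Ex => B; congr (nat_of_bool (_ == _))%:R.
by rewrite zsumE reach_mix ?fintype.subxx // vsum_mix // inE.
Qed.

End Gap.

(** * Exponential bounds for the balance of two sets *)
Section Discrepancy.
Variables (V : finType) (e0 : vpair V) (R : realType).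
Implicit Types (u v w x y : V) (G : sgraph V) (S T B : {set V}).
Notation ed := (ed e0).

Lemma expR_le_quad (x : R) : x <= 2^-1 -> expR x <= 1 + x + 2 * x ^+ 2.
Proof.
move=> x2; have h : 0 < 1 - x by lra.
apply: le_trans (_ : (1 - x)^-1 <= _).
  rewrite -[x in expR x]opprK expRN lef_pV2 ?posrE ?expR_gt0 //.
  exact: expR_ge1Dx.
rewrite -[leLHS]mul1r ler_pdivrMr //.
have -> : (1 + x + 2 * x ^+ 2) * (1 - x) = 1 + x ^+ 2 * (1 - 2 * x) by ring.
by rewrite lerDl mulr_ge0 ?sqr_ge0 //; lra.
Qed.

(** Every edge comes from exactly two ordered pairs of vertices. *)
Lemma sum_edge (e : vpair V) : exists a b, a != b /\
  forall F : V -> V -> R,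
  \sum_(vy : V * V | (vy.1 != vy.2) && (ed vy.1 vy.2 == e)) F vy.1 vy.2 =
  F a b + F b a.
Proof.
have /cards2P[a [b [ab eE]]] := valP e; exists a, b; split => // F.
have eab : ed a b = e by apply: val_inj; rewrite val_ed.
have ba : b != a by rewrite eq_sym.
rewrite (bigD1 (a, b)) /= ?ab ?eab ?eqxx //=; congr (_ + _).
rewrite (bigD1 (b, a)) /= ?ba ?(edC _ b a) ?eab ?eqxx //=; last first.
  by apply: contraNneq ab => -[->].
rewrite big1 ?addr0 // => -[v y] /= /andP[/andP[/andP[vy /eqP vye] n1] n2].
exfalso; have : [set v; y] = [set a; b] by rewrite -eE -vye val_ed.
move=> E; have := E => /setP /(_ v); have := E => /setP /(_ y).
rewrite !inE !eqxx orbT /= => /esym y1 /esym v1.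
case/orP: v1 => /eqP v1; case/orP: y1 => /eqP y1; move: vy n1 n2;
  by rewrite v1 y1 ?eqxx.
Qed.

(** Nonpositive as soon as every vertex of [T] becomes blue
    ([blue_balance]). *)
Definition balance S T G : int :=
  \sum_(v in T) vsum e0 v (~: [set v]) S G.

Lemma sum_sgn S (W : {set V}) :
  \sum_(y in W) (if y \in S then 1 else -1) = 2 * #|W :&: S|%:R - #|W|%:R :> R.
Proof.
rewrite -!sum1_card !natr_sum mulr_sumr (big_mkcond (fun i => i \in W :&: S)).
rewrite [X in _ = _ - X]big_mkcond [LHS]big_mkcond /= -sumrB; apply: eq_bigr => i _.
rewrite !inE; case: (i \in W); case: (i \in S) => /=; ring.
Qed.

Lemma sum_pairs (F : V -> V -> R) :
  \sum_(vy : V * V | vy.1 != vy.2) F vy.1 vy.2 =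
  \sum_v \sum_(y in ~: [set v]) F v y.
Proof.
rewrite pair_big_dep /=; apply: eq_big => -[v y] //=.
by rewrite !inE eq_sym.
Qed.

(** Each edge is seen from its two ends; by convexity the two contributions to
    the exponential moment decouple. *)
Lemma balance_tail (p lam : R) S T : 0 <= p <= 1 -> 0 <= lam -> lam <= 4^-1 ->
  Pr (fun=> p) (fun G => balance S T G <= 0) <=
  expR (p * (#|T|%:R * (lam - lam * (#|S|%:R - #|~: S|%:R) +
                        4 * lam ^+ 2 * #|V|%:R))).
Proof.
move=> p01 l0 l4.
pose f v y : R := if v \in T then - lam * (if y \in S then 1 else -1) else 0.
pose wt (e : vpair V) : R := \sum_(vy : V * V | (vy.1 != vy.2) && (ed vy.1 vy.2 == e)) f vy.1 vy.2.
have part (F : V -> V -> R) : \sum_(vy : V * V | vy.1 != vy.2) F vy.1 vy.2 =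
    \sum_e \sum_(vy : V * V | (vy.1 != vy.2) && (ed vy.1 vy.2 == e)) F vy.1 vy.2.
  by rewrite (partition_big (fun vy => ed vy.1 vy.2) predT).
have balE G : - lam * (balance S T G)%:~R = \sum_(e in G) wt e.
  have -> : \sum_(e in G) wt e = \sum_(vy : V * V | vy.1 != vy.2)
      (if ed vy.1 vy.2 \in G then f vy.1 vy.2 else 0).
    rewrite (part (fun v y => if ed v y \in G then f v y else 0)) big_mkcond.
    apply: eq_bigr => e _; case: ifP => eG.
      by apply: eq_bigr => vy /andP[_ /eqP ->]; rewrite eG.
    by rewrite big1 // => vy /andP[_ /eqP ->]; rewrite eG.
  rewrite (sum_pairs (fun v y => if ed v y \in G then f v y else 0)).
  rewrite /balance rmorph_sum mulr_sumr [LHS]big_mkcond /=; apply: eq_bigr => v _.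
  rewrite /f; case: ifP => vT; last by rewrite big1 // => y _; case: ifP.
  rewrite /vsum rmorph_sum mulr_sumr; apply: eq_bigr => y _.
  by case: ifP => _ /=; rewrite ?mulr0 //; case: ifP => _ /=; rewrite ?mulrN1z.
apply: le_trans (_ : Pr (fun=> p) (fun G => 0 <= \sum_(e in G) wt e) <= _).
  apply: le_Pr => // G h; rewrite -balE mulNr -mulrN mulr_ge0 // oppr_ge0.
  by rewrite lerz0.
apply: le_trans (exp_markov_sum wt p01) _; rewrite ler_expR.
case/andP: (p01) => p0 _; apply: ler_wpM2l => //.
have dec e : expR (wt e) - 1 <=
    \sum_(vy : V * V | (vy.1 != vy.2) && (ed vy.1 vy.2 == e))
      (expR (2 * f vy.1 vy.2) - 1) / 2.
  have [a [b [ab E]]] := sum_edge e.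
  rewrite /wt !E (E (fun v y => (expR (2 * f v y) - 1) / 2)) expRD.
  have dbl (x : R) : expR (2 * x) = expR x ^+ 2 by rewrite -expRM_natl.
  rewrite !dbl; have := sqr_ge0 (expR (f a b) - expR (f b a)); lra.
apply: le_trans (ler_sum _ (fun e _ => dec e)) _.
rewrite -(part (fun v y => (expR (2 * f v y) - 1) / 2)).
rewrite (sum_pairs (fun v y => (expR (2 * f v y) - 1) / 2)).
have -> (c : R) : #|T|%:R * c = \sum_(v in T) c by rewrite sumr_const -[RHS]mulr_natl.
rewrite [leRHS]big_mkcond /=; apply: ler_sum => v _; rewrite /f.
case: ifP => vT; last first.
  by rewrite big1 // => y _; rewrite mulr0 expR0 subrr mul0r.
apply: le_trans (_ : \sum_(y in ~: [set v])
    (- lam * (if y \in S then 1 else -1) + 4 * lam ^+ 2) <= _).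
  apply: ler_sum => y _; rewrite ler_pdivrMr //.
  set s : R := if y \in S then 1 else -1.
  have s1 : s ^+ 2 = 1 by rewrite /s; case: ifP; rewrite ?sqrrN expr1n.
  have sl : 2 * (- lam * s) <= 2^-1 by rewrite /s; case: ifP => _; lra.
  have := expR_le_quad sl; rewrite !exprMn sqrrN s1; lra.
rewrite big_split /= -mulr_sumr sum_sgn sumr_const -[X in _ + X]mulr_natl.
have l20 : 0 <= 4 * lam ^+ 2 by rewrite mulr_ge0 ?sqr_ge0.
have c1 : #|~: [set v]|%:R <= #|V|%:R :> R by rewrite ler_nat max_card.
have h1 : #|~: [set v]|%:R * (4 * lam ^+ 2) <= #|V|%:R * (4 * lam ^+ 2).
  exact: ler_wpM2r.
have c2 : #|S|%:R - #|~: S|%:R - 1 <= 2 * #|~: [set v] :&: S|%:R - #|~: [set v]|%:R :> R.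
  have hS := cardsD1 v S; have hV := cardsC [set v]; have hC := cardsC S.
  rewrite cards1 in hV.
  have -> : #|~: [set v] :&: S| = #|S :\ v| by rewrite setIC -setDE.
  have : (#|S| <= 1 + #|S :\ v|)%N by rewrite hS leq_add2r leq_b1.
  rewrite -(ler_nat R) natrD.
  move: (congr1 (fun k => k%:R : R) hV) (congr1 (fun k => k%:R : R) hC) => /=.
  rewrite !natrD; lra.
have := ler_wpM2l l0 c2; lra.
Qed.

Lemma blue_balance S G : balance S (~: majority_step G S) G <= 0.
Proof.
apply: sumr_le0 => v; rewrite inE (majority_stepE e0) -ltNge /thr.
by case: ifP => _; set z := vsum _ _ _ _ _; move: z; clear; lia.
Qed.

Lemma Pr_exists (p : R) (D : finType) (P : pred D) (E : D -> pred (sgraph V)) :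
  0 <= p <= 1 ->
  Pr (fun=> p) (fun G => [exists x, P x && E x G]) <=
  \sum_(x | P x) Pr (fun=> p) (E x).
Proof.
move=> p01; rewrite /Pr -Ex_sum; apply: ler_Ex => // G.
case: (boolP [exists x, _]) => [/existsP[x /andP[Px Ex]]|_]; last first.
  by apply: sumr_ge0.
by rewrite (bigD1 x) //= Ex lerDl sumr_ge0.
Qed.

Lemma sum_pow_card (y : R) : \sum_(A : {set V}) y ^+ #|A| = (1 + y) ^+ #|V|.
Proof.
transitivity (\prod_(v : V) (y + 1)); last first.
  by rewrite addrC prodr_const.
rewrite bigA_distr; apply: eq_bigr => A _.
by rewrite -big_mkcond /= prodr_const.
Qed.

End Discrepancy.

(** * Extinction of the blue set *)
Section LaterDays.
Variables (V : finType) (e0 : vpair V) (R : realType) (p sd : R).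
Implicit Types (G : sgraph V) (S T : {set V}).
Local Notation n := (#|V|%:R : R).
Local Notation l := (ln (#|V|%:R : R)).

(** If this fails, a red set with the stated lead leaves fewer than a hundredth
    of the vertices blue on the next day. *)
Definition bad_day3 G := [exists ST : {set V} * {set V},
  ((100 / sd * n <= #|ST.1|%:R - #|~: ST.1|%:R) && (n <= 100 * #|ST.2|%:R)) &&
  (balance e0 ST.1 ST.2 G <= 0)].

(** If this fails, the number [m] of vertices that are blue on the day after [b]
    of them were satisfies [p n m < 80 (b + m) ln n], when [b] is at most a
    hundredth of all vertices and [m] is positive. *)
Definition bad_shrink G := [exists ST : {set V} * {set V},
  [&& 100 * #|~: ST.1|%:R <= n, (0 < #|ST.2|)%N &
      80 * (#|~: ST.1|%:R + #|ST.2|%:R) * l <= p * n * #|ST.2|%:R] &&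
  (balance e0 ST.1 ST.2 G <= 0)].

Lemma card_setCR S : #|~: S|%:R = n - #|S|%:R.
Proof. by rewrite -(cardsC S) natrD; ring. Qed.

(** The exponent gained is at least [3 n], against [4 ^ n] pairs of sets. *)
Lemma Pr_bad_day3 : 0 < p -> p <= 10^-1 -> 10 ^+ 3 <= sd -> sd ^+ 2 = p * n ->
  Pr (fun=> p) bad_day3 <= expR (- n).
Proof.
move=> h0 h1 h2 hs; have p01 : 0 <= p <= 1 by apply/andP; split; lra.
have sdp : 0 < sd by lra.
have sdn : sd <= n.
  have : p * n <= n by rewrite ler_piMl //; lra.
  by rewrite -hs expr2 => h; apply: le_trans h; rewrite ler_peMr //; lra.
apply: le_trans (Pr_exists _ _ p01) _.
apply: le_trans (_ : \sum_(ST : {set V} * {set V}) expR (- (3 * n)) <= _).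
  rewrite [leRHS](bigID (fun ST : {set V} * {set V} =>
    (100 / sd * n <= #|ST.1|%:R - #|~: ST.1|%:R) && (n <= 100 * #|ST.2|%:R))) /=.
  rewrite -[leLHS]addr0; apply: lerD; last by apply: sumr_ge0 => ST _; apply: expR_ge0.
  apply: ler_sum => -[S T] /= /andP[hS hT].
  (* The minimizer of 4 lam ^ 2 - (100 / sd) lam. *)
  pose lam := 25 / (2 * sd).
  have l0 : 0 <= lam by rewrite /lam divr_ge0 //; lra.
  have l4 : lam <= 4^-1 by rewrite /lam ler_pdivrMr; lra.
  apply: le_trans (balance_tail e0 S T p01 l0 l4) _; rewrite ler_expR.
  have e1 : lam * (100 / sd * n) <= lam * (#|S|%:R - #|~: S|%:R) by apply: ler_wpM2l.
  have E : lam - lam * (100 / sd * n) + 4 * lam ^+ 2 * n = 25 / (2 * sd) - 625 * n / sd ^+ 2.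
    by rewrite /lam; field; rewrite gt_eqF.
  have e2 : 25 / (2 * sd) <= 25 / 2 * n / sd ^+ 2.
    rewrite [leLHS](_ : _ = 25 / 2 * sd / sd ^+ 2); last by field; rewrite gt_eqF.
    by rewrite ler_pM2r ?invr_gt0 ?exprn_gt0 //; lra.
  have T0 : 0 <= #|T|%:R :> R by [].
  have e3 : #|T|%:R * (lam - lam * (#|S|%:R - #|~: S|%:R) + 4 * lam ^+ 2 * n) <=
      #|T|%:R * (- (600 * n / sd ^+ 2)).
    apply: ler_wpM2l => //.
    have e4 : 25 / 2 * n / sd ^+ 2 <= 25 * (n / sd ^+ 2).
      have : 0 <= n / sd ^+ 2 by rewrite divr_ge0 // sqr_ge0.
      lra.
    lra.
  have := ler_wpM2l (ltW h0) e3; move/le_trans; apply.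
  have -> : p * (#|T|%:R * - (600 * n / sd ^+ 2)) = - (600 * #|T|%:R).
    have n0 : 0 < n by lra.
    by rewrite hs; field; rewrite !gt_eqF.
  lra.
rewrite sumr_const card_prod.
have cs : #|{: {set V}}| = (2 ^ #|V|)%N.
  rewrite -(cardsT V) -card_powerset; apply: eq_card => A.
  by rewrite powersetE subsetT.
rewrite cs -expnD -[leLHS]mulr_natr natrX.
have e2 : (2 : R) ^+ (#|V| + #|V|) <= (expR 1 : R) ^+ (#|V| + #|V|).
  by apply: lerXn2r; rewrite ?nnegrE ?expR_ge0 //; have := expR_ge1Dx (1 : R); lra.
apply: le_trans (ler_wpM2l (expR_ge0 _) e2) _.
rewrite -expRM_natr mul1r -expRD ler_expR natrD; lra.
Qed.

(** With [y] the inverse square of the number [n] of vertices, each pair of sets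
    of sizes [b] and [m] costs at most [n^-1 y^(b + m)], and the sum of [y^#|A|]
    over all sets [A] is [(1 + y) ^ n], which is at most [e]. *)
Lemma Pr_bad_shrink : 0 < p -> p <= 10^-1 -> 13 <= n ->
  Pr (fun=> p) bad_shrink <= expR (2 - l).
Proof.
move=> h0 h1 n13; have p01 : 0 <= p <= 1 by apply/andP; split; lra.
have n0 : 0 < n by lra.
have l0 : 0 <= l by rewrite ln_ge0 //; lra.
apply: le_trans (Pr_exists _ _ p01) _.
pose y : R := expR (- (2 * l)).
have y0 : 0 <= y by apply: expR_ge0.
apply: le_trans (_ : \sum_(ST : {set V} * {set V})
   expR (- l) * (y ^+ #|~: ST.1| * y ^+ #|ST.2|) <= _).
  rewrite [leRHS](bigID (fun ST : {set V} * {set V} =>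
    [&& 100 * #|~: ST.1|%:R <= n, (0 < #|ST.2|)%N &
      80 * (#|~: ST.1|%:R + #|ST.2|%:R) * l <= p * n * #|ST.2|%:R])) /=.
  rewrite -[leLHS]addr0; apply: lerD; last first.
    by apply: sumr_ge0 => ST _; rewrite !mulr_ge0 ?exprn_ge0 ?expR_ge0.
  apply: ler_sum => -[S T] /= /and3P[hS hT hl].
  (* The parameter 1 / 8 minimizes 4 lam ^ 2 - lam. *)
  have l8 : 8^-1 <= 4^-1 :> R by lra.
  have l80 : 0 <= 8^-1 :> R by lra.
  apply: le_trans (balance_tail e0 S T p01 l80 l8) _.
  rewrite -exprD /y -expRM_natl -expRD ler_expR natrD.
  have hC := card_setCR S; set b : R := #|~: S|%:R in hS hl hC *.
  set m : R := #|T|%:R in hl *.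
  have m1 : 1 <= m by rewrite /m ler1n.
  have b0 : 0 <= b by rewrite /b.
  have e1 : 8^-1 - 8^-1 * (#|S|%:R - b) + 4 * 8^-1 ^+ 2 * n <= - (n / 20) by lra.
  have e2 : m * (8^-1 - 8^-1 * (#|S|%:R - b) + 4 * 8^-1 ^+ 2 * n) <= m * - (n / 20).
    by apply: ler_wpM2l => //; lra.
  have e3 := ler_wpM2l (ltW h0) e2.
  have e4 : 1 * l <= (b + m) * l by apply: ler_wpM2r => //; lra.
  lra.
rewrite -(pair_big predT predT (fun S T : {set V} =>
   expR (- l) * (y ^+ #|~: S| * y ^+ #|T|))) /=.
under eq_bigr do rewrite -mulr_sumr -mulr_sumr sum_pow_card.
rewrite -mulr_sumr -mulr_suml (reindex_inj (@setC_inj V)) /=.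
under eq_bigr do rewrite setCK.
rewrite sum_pow_card.
have e1 : (1 + y) ^+ #|V| <= expR 1.
  apply: le_trans (_ : expR y ^+ #|V| <= _).
    by apply: lerXn2r; rewrite ?nnegrE ?expR_ge0 ?expR_ge1Dx // addr_ge0.
  rewrite -expRM_natl ler_expR.
  have nE : n = expR l by rewrite lnK // posrE.
  have -> : n * y = expR (- l).
    by rewrite [X in X * _]nE /y -expRD; congr expR; ring.
  by rewrite expR_le1 oppr_le0.
have y1 : 0 <= (1 + y) ^+ #|V| by rewrite exprn_ge0 // addr_ge0.
have -> : expR (2 - l) = expR (- l) * (expR 1 * expR 1).
  by rewrite -!expRD; congr expR; ring.
apply: ler_wpM2l; first exact: expR_ge0.
exact: ler_pM.
Qed.

(** Once the majority is clear, the expansion properties alone drive the blue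
    set to extinction, by a factor [sd] a day. *)
Lemma blue_dies G S : 0 < p -> 10 ^+ 3 <= sd -> sd ^+ 2 = p * n -> 1 <= l ->
  160 * l <= sd -> p <= 10^-1 ->
  n / 2 + 50 / sd * n <= #|S|%:R -> ~~ bad_day3 G -> ~~ bad_shrink G ->
  exists2 t : nat, red_set G S t = [set: V] & t%:R <= 4 * (l / ln (p * n)) + 2.
Proof.
move=> h0 h2 hs l1 lsd p10 hS n3 n4.
have sdp : 0 < sd by lra.
pose b t : R := #|~: red_set G S t|%:R.
have b0 t : 0 <= b t by rewrite /b.
have b1 : 100 * b 1%N <= n.
  rewrite leNgt; apply: contra n3 => hb; apply/existsP.
  exists (S, ~: majority_step G S) => /=; rewrite blue_balance andbT card_setCR.
  by apply/andP; split; [lra|exact: ltW].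
have step t : 100 * b t <= n -> b t.+1 * sd <= b t.
  move=> hb; set T := ~: red_set G S t.+1.
  case: (posnP #|T|) => [T0|T0]; first by rewrite /b -/T T0 mul0r.
  have : ~~ (80 * (b t + #|T|%:R) * l <= p * n * #|T|%:R).
    apply: contra n4 => h; apply/existsP; exists (red_set G S t, T) => /=.
    by rewrite T0 h hb /=; apply: blue_balance.
  rewrite -ltNge -hs -/(b t.+1); set m := b t.+1 => h.
  have m0 : 0 <= m by apply: b0.
  have sl : 160 * l * sd <= sd ^+ 2 by rewrite expr2; apply: ler_wpM2r; lra.
  have e1 : m * (160 * l) <= m * sd ^+ 2.
    apply: ler_wpM2l => //; apply: le_trans sl; rewrite ler_peMr //; lra.
  have e2 : m * (160 * l * sd) <= m * sd ^+ 2 by apply: ler_wpM2l.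
  have lp : 0 < 160 * l by lra.
  rewrite -(ler_pM2r lp).
  have -> : m * sd * (160 * l) = m * (160 * l * sd) by ring.
  apply: le_trans e2 _; lra.
have decay j : 100 * (b j.+1 * sd ^+ j) <= n.
  elim: j => [|j IH]; first by rewrite expr0 mulr1.
  have hb : 100 * b j.+1 <= n.
    apply: le_trans IH; rewrite ler_pM2l // ler_peMr //.
    by apply: exprn_ege1; lra.
  apply: le_trans IH; rewrite ler_pM2l // exprS mulrA.
  by apply: ler_wpM2r; [apply: exprn_ge0; lra|exact: step].
have n0 : 0 < n.
  have : 0 < sd ^+ 2 by apply: exprn_gt0.
  by rewrite hs pmulr_rgt0.
pose x := l / ln (p * n).
have lnd : 0 < ln (p * n).
  by rewrite ln_gt0 // -hs; apply: exprn_egt1 => //; lra.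
have x0 : 0 <= x by rewrite /x divr_ge0 //; lra.
have [j jx jle] : exists2 j : nat, 2 * x < j%:R & j%:R <= 2 * x + 1.
  exists (Num.truncn (2 * x)).+1; first exact: truncnS_gt.
  by rewrite -[_.+1%:R]natr1 lerD2r truncn_le // mulr_ge0.
have sdj : n <= sd ^+ j.
  have hl : 2 * l <= ln (p * n) * j%:R.
    by have := ltW jx; rewrite /x mulrA ler_pdivrMr // [leRHS]mulrC.
  have : ln n <= ln (sd ^+ j).
    have lnX k : ln (sd ^+ k) = k%:R * ln sd by rewrite lnXn // mulr_natl.
    have e : ln (p * n) * j%:R = 2 * (j%:R * ln sd) by rewrite -hs lnX; ring.
    by move: hl; rewrite e ler_pM2l // lnX.
  by rewrite ler_ln // posrE // exprn_gt0.
have bj : b j.+1 = 0.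
  apply/eqP; rewrite /b pnatr_eq0; apply: contraT; rewrite -lt0n => bp.
  have b1' : 1 <= b j.+1 by rewrite /b ler1n.
  have h := decay j.
  have : 1 * sd ^+ j <= b j.+1 * sd ^+ j.
    by apply: ler_wpM2r => //; apply: exprn_ge0; lra.
  lra.
exists j.+1.
  apply/eqP; rewrite -[red_set G S j.+1]setCK eqEsubset subsetT /= -setCS setCT setCK.
  by move/eqP: bj; rewrite /b pnatr_eq0 cards_eq0 => /eqP ->.
by rewrite -[j.+1%:R]natr1 -/x; lra.
Qed.

End LaterDays.

(** * The lead after two days *)
Lemma cov_bound_sd (V : finType) (R : realType) (p sd : R) : 0 < sd ->
  sd ^+ 2 = p * #|V|%:R -> cov_bound V p (4 / sd) = 1220 * p.
Proof.
move=> sd0 hs; rewrite /cov_bound; set n : R := #|V|%:R in hs *.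
have e : p * n * (4 / sd) ^+ 2 = 16 by rewrite -hs; field; rewrite gt_eqF.
transitivity (4 * p + 8 * p * (p * n * (4 / sd) ^+ 2) +
   4 * p * (p * n * (4 / sd) ^+ 2) * (1 + p * n * (4 / sd) ^+ 2)); first by ring.
rewrite e; ring.
Qed.

(** Chebyshev: the variance is at most [1221 n^2 p], and
    the deviation is [n l tail_cst / (32 sd)] with [1024 = 32 ^ 2]. *)
Definition day2_cst (R : realType) : R := 1221 * 1024 / tail_cst 64 ^+ 2.

Lemma day2_cst_gt0 (R : realType) : 0 < day2_cst R.
Proof.
apply: divr_gt0; first by apply: mulr_gt0; rewrite ltr0n.
by apply: exprn_gt0; apply: tail_cst_gt0.
Qed.

(** Half of the expected lead, which is a multiple of [n l / sd], absorbs the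
    ties and the required lead [50 n / sd]; the other half is the room left to
    Chebyshev. *)
Lemma day2_majority (V : finType) (e0 : vpair V) (R : realType) (p sd l : R)
    (S' Q : {set V}) :
  0 < p -> p <= 10^-1 -> 10 ^+ 3 <= sd -> sd ^+ 2 = p * #|V|%:R ->
  [disjoint Q & S'] -> (#|S' :|: Q| + #|S'|)%N = #|V| ->
  200 <= l -> 160 * l <= sd -> 64 / tail_cst 64 * l <= sd -> 12 ^+ 3 <= tail_cst 64 * l ->
  p ^+ 2 * #|V|%:R <= l ->
  2 * (16 / tail_cst 64 * l / (p * sd)) <= #|Q|%:R -> #|Q|%:R <= 2 * (16 / tail_cst 64 * l / (p * sd)) + 2 ->
  Pr (fun=> p) (fun G => #|red_set G (S' :|: Q) 2|%:R < #|V|%:R / 2 + 50 / sd * #|V|%:R) <=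
    day2_cst R / l.
Proof.
set n : R := #|V|%:R; set kap : R := tail_cst 64; set q : R := #|Q|%:R; move=> h0 h1 h2 hs QS' cSS' l200 lsd klsd kl pnl q1 q2.
have p01 : 0 <= p <= 1 by apply/andP; split; lra.
have sd0 : 0 < sd by lra.
have kap0 : 0 < kap by apply: tail_cst_gt0.
have l0 : 0 < l by lra.
have sdn := sd_le_n h0 h1 h2 hs; rewrite -/n in sdn.
have n0 : 0 < n by lra.
have pq : p * q <= 1.
  have h : p * q <= p * (2 * (16 / kap * l / (p * sd)) + 2) by apply: ler_wpM2l => //; lra.
  apply: le_trans h _.
  have -> : p * (2 * (16 / kap * l / (p * sd)) + 2) = 2^-1 * (64 / kap * l / sd) + 2 * p.
    by field; rewrite !gt_eqF.
  have : 64 / kap * l / sd <= 1 by rewrite ler_pdivrMr // mul1r.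
  lra.
have qn : q + 2 <= n / 2.
  have e1 : p * (q + 2) <= p * (n / 2).
    have : sd * 10 ^+ 3 <= sd * sd by apply: ler_wpM2l => //; lra.
    have -> : p * (n / 2) = sd * sd / 2 by rewrite -expr2 hs; field.
    rewrite mulrDr; lra.
  by rewrite ler_pM2l in e1.
pose L := (Num.truncn l).+2.
have [lL L2] : l <= L.-1%:R /\ L%:R <= 2 * l.
  have t1 : l < (Num.truncn l).+1%:R by apply: truncnS_gt.
  have t2 : (Num.truncn l)%:R <= l by rewrite truncn_le ltW.
  split; first exact: ltW.
  by rewrite /L -[_.+2%:R]natr1 -[_.+1%:R]natr1; lra.
have L4 : (4 <= L)%N.
  rewrite -(ler_nat R) -[L]/(L.-1.+1) -natr1; lra.
have Lsd : L%:R <= sd by lra.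
have pE : 8 * l <= p * (n * (p * q) * kap / (4 * sd)).
  have -> : p * (n * (p * q) * kap / (4 * sd)) = (p * n) * p * kap / (4 * sd) * q.
    by field; rewrite gt_eqF.
  apply: le_trans (_ : (p * n) * p * kap / (4 * sd) * (2 * (16 / kap * l / (p * sd))) <= _).
    rewrite -hs le_eqVlt; apply/orP; left; apply/eqP.
    by field; rewrite !gt_eqF.
  apply: ler_wpM2l => //.
  by apply: divr_ge0; rewrite ?mulr_ge0 // ltW // mulr_gt0.
have E0L : 4 * L%:R <= p * (n * (p * q) * kap / (4 * sd)) by lra.
have E0n : 17 * 64 * n <= (n * (p * q) * kap / (4 * sd)) ^+ 2.
  set E := n * (p * q) * kap / (4 * sd) in pE *.
  have p20 : 0 < p ^+ 2 by apply: exprn_gt0.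
  rewrite -(ler_pM2l p20) -exprMn.
  apply: le_trans (_ : (8 * l) ^+ 2 <= _).
    rewrite exprMn; have : 200 * l <= l * l by apply: ler_wpM2r => //; lra.
    rewrite -expr2; lra.
  by apply: lerXn2r; rewrite ?nnegrE //; lra.
have := Ex_sure_red e0 h0 h1 h2 hs QS' cSS' pq qn L4 Lsd E0L E0n.
rewrite -/n -/kap; set mu := Ex _ _ => hmu.
pose g := n * l * kap / (32 * sd).
have g0 : 0 < g by rewrite /g divr_gt0 // !mulr_gt0.
have mug : n / 2 + 50 / sd * n + g <= mu.
  apply: le_trans hmu.
  have e1 : n * l * kap / (16 * sd) <= n * L.-1%:R * kap / (16 * sd).
    rewrite ler_pM2r ?invr_gt0 ?mulr_gt0 // ler_pM2r // ler_pM2l //.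
  have e2 : 54 * n / sd <= g.
    have -> : g = (kap * l / 32) * n / sd by rewrite /g; field; rewrite gt_eqF.
    rewrite ler_pM2r ?invr_gt0 // ler_pM2r //; lra.
  have e3 : n * l * kap / (16 * sd) = 2 * g by rewrite /g; field; rewrite gt_eqF.
  have -> : n * (4 / sd) = 4 * n / sd by field; rewrite gt_eqF.
  have -> : 50 / sd * n = 50 * n / sd by field; rewrite gt_eqF.
  have e4 : 54 * n / sd = 50 * n / sd + 4 * n / sd by rewrite -mulrDl; congr (_ / _); ring.
  lra.
have pc01 (e : vpair V) : 0 <= (fun=> p) e <= 1 by [].
apply: le_trans (_ : Pr (fun=> p) (fun G => g <= `|#|sure_red e0 (S' :|: Q) G|%:R - mu|) <= _).
  apply: le_Pr => // G hG; rewrite distrC; apply: le_trans (ler_norm _).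
  suff : #|sure_red e0 (S' :|: Q) G|%:R <= #|red_set G (S' :|: Q) 2|%:R :> R.
    by clear pc01; lra.
  rewrite ler_nat; apply/subset_leq_card/fintype.subsetP => u.
  rewrite inE /red_set /= (majority_stepE e0) -/(zsum _ _ _ _) /thr.
  by case: ifP => _; set z := zsum _ _ _ _; move: z; clear; lia.
apply: le_trans (Ex_chebyshev pc01 _ g0) _.
have rm : (uphalf #|V| + 4 <= #|V|)%N := room h0 h1 h2 hs.
have eta0 : 0 <= 4 / sd by rewrite divr_ge0 // ltW.
have := Var_sure_red e0 p01 (point_bound_sd h0 h1 h2 hs) eta0 rm (S' :|: Q).
rewrite (cov_bound_sd sd0 hs) -/n => hV.
clear pc01; rewrite ler_pdivrMr ?exprn_gt0 //; apply: le_trans hV _.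
have -> : day2_cst R / l * g ^+ 2 = 1221 * n ^+ 2 * l / sd ^+ 2.
  by rewrite /day2_cst -/kap /g; field; rewrite !gt_eqF.
have e1 : sd ^+ 2 * sd ^+ 2 <= n * l.
  rewrite hs; have -> : p * n * (p * n) = n * (p ^+ 2 * n) by ring.
  by rewrite ler_pM2l.
rewrite ler_pdivlMr ?exprn_gt0 //.
have -> : n + n ^+ 2 * (1220 * p) = n * (1 + 1220 * (p * n)) by ring.
rewrite -hs.
have s1 : 1 <= sd ^+ 2 by apply: exprn_ege1; lra.
have -> : 1221 * n ^+ 2 * l = n * (1221 * (n * l)) by ring.
rewrite -mulrA ler_pM2l //.
apply: le_trans (_ : 1221 * (sd ^+ 2 * sd ^+ 2) <= _); last by lra.
rewrite mulrA ler_pM2r ?exprn_gt0 //; lra.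
Qed.

(** * Choice of the constants *)
Lemma gnp_prob_ge (V : finType) (R : realType) (p : R) (E : pred (sgraph V))
    (A : set (sgraph V)) : 0 <= p <= 1 ->
  (forall G, E G -> A G) -> Pr (fun=> p) E <= gnp_prob p A.
Proof.
move=> p01 EA; rewrite /gnp_prob big_mkcond; apply: ler_sum => G _.
have m0 : 0 <= gnp_mass p G by apply: (@mass_ge0 R (vpair V) (fun=> p)).
case: (boolP (E G)) => [/EA AG|_]; last by rewrite mulr0; case: ifP.
by rewrite mulr1 (classical_sets.mem_set AG).
Qed.

(** The lower bound on the initial lead in terms of the square root of the
    average degree. *)
Lemma thresholdE (R : realType) (p n : R) : 0 < p -> 0 < n ->
  p `^ (- (3 / 2)) * n `^ (- 2^-1) = (p * Num.sqrt (p * n))^-1.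
Proof.
move=> p0 n0; rewrite !powRN.
have -> : 3 / 2 = 1 + 2^-1 :> R by lra.
rewrite powRD; last by rewrite gt_eqF ?implybT.
rewrite powRr1 ?ltW // !powR12_sqrt ?ltW // sqrtrM ?ltW //.
by rewrite -invfM mulrA.
Qed.

(** Shrinking the red side to the least size allowed keeps the set [Q] of swing
    vertices small: a vertex must not have too many neighbours in it. *)
Lemma split_coloring (V : finType) (R : realType) (R0 : {set V}) (D : R) :
  0 <= D -> #|V|%:R / 2 + D <= #|R0|%:R ->
  exists S' Q : {set V}, [/\ S' :|: Q \subset R0, [disjoint Q & S'],
    (#|S' :|: Q| + #|S'|)%N = #|V|,
    2 * D <= #|Q|%:R & #|Q|%:R <= 2 * D + 2].
Proof.
move=> D0 hR0; pose P k := #|V|%:R / 2 + D <= k%:R.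
have exP : exists k, P k by exists #|R0|.
case: (ex_minnP exP) => k Pk kmin.
have kR0 : (k <= #|R0|)%N by apply: kmin.
have kV : (k <= #|V|)%N by apply: leq_trans kR0 (max_card _).
have [S SR0 cS] := subset_of_card kR0.
have nk : (#|V| - k <= #|S|)%N.
  have : (#|V| <= 2 * k)%N.
    rewrite -(ler_nat R) natrM; move: Pk; rewrite /P; lra.
  by rewrite cS; clear; lia.
have [S' S'S cS'] := subset_of_card nk.
have SE : S' :|: (S :\: S') = S.
  by rewrite -{1}(setIidPr S'S) setID.
exists S', (S :\: S'); rewrite SE; split => //.
- by rewrite disjoints_subset subsetDr.
- by rewrite cS cS' subnKC.
- rewrite cardsD (setIidPr S'S) natrB ?subset_leq_card // cS cS' natrB //.
  by move: Pk; rewrite /P; lra.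
have V0 : 0 <= #|V|%:R :> R by [].
have kP : k%:R <= #|V|%:R / 2 + D + 1.
  case: k kmin {Pk kR0 kV cS nk cS'} => [|k] kmin; first by rewrite mulr0n; lra.
  rewrite -[k.+1%:R]natr1 lerD2r leNgt; apply/negP => h.
  by have := kmin k (ltW h); rewrite ltnn.
rewrite cardsD (setIidPr S'S) natrB ?subset_leq_card // cS cS' natrB //.
lra.
Qed.

Theorem theorem1p4 (R : realType) :
  exists C K : R, 0 < C /\ 0 < K /\
  forall eps : R, 0 < eps ->
  exists (Ceps : R) (Neps : nat), 0 < Ceps /\
  forall (n : nat) (p Delta : R) (V : finType) (R0 : {set V}),
    (Neps <= n)%N ->
    C * n%:R^-1 * (ln n%:R) ^+ 2 <= p ->
    p <= n%:R `^ (- 2^-1) * (ln n%:R) `^ (4^-1) ->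
    Ceps * p `^ (- (3 / 2)) * n%:R `^ (- 2^-1) * ln n%:R <= Delta ->
    #|V| = n ->
    n%:R / 2 + Delta <= #|R0|%:R ->
    1 - eps <= gnp_prob p
      [set G : sgraph V |
        red_wins_within G R0 (K * log_base (p * n%:R) n%:R)]%classic.
Proof.
have [kap kapE kap0] : exists2 kap : R, kap = tail_cst 64 & 0 < kap.
  by exists (tail_cst 64) => //; apply: tail_cst_gt0.
pose C0 : R := 16 / kap.
have C00 : 0 < C0 by rewrite divr_gt0.
(* With C = c1 ^ 2 one has sd >= c1 ln n; the second summand of c1 makes the
   expected number of neighbours in the swing set at most one. *)
pose c1 : R := 160 + 64 / kap.
have k64 : 0 < 64 / kap by rewrite divr_gt0.
have c10 : 160 <= c1 by rewrite lerDl ltW.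
(* Extinction takes at most 4 x + 2 days after the second one, where x >= 1 is
   the logarithm of n in base p n. *)
exists (c1 ^+ 2), 8; split; first by rewrite exprn_gt0 //; lra.
split => // eps eps0.
pose D3 := day2_cst R; have D30 : 0 < D3 by apply: day2_cst_gt0.
(* M is the lower bound imposed on ln n; the last two conditions make each of the
   three failure probabilities at most eps / 3. *)
have [M [hM1 hM2 hM3 hM4]] : exists M : R,
    [/\ 200 <= M, 12 ^+ 3 / kap <= M, 3 * D3 / eps <= M & 3 / eps <= M - 2].
  have m1 : 0 < 12 ^+ 3 / kap by apply: divr_gt0 _ kap0; rewrite exprn_gt0.
  have m2 : 0 < 3 * D3 / eps by apply: divr_gt0 _ eps0; apply: mulr_gt0 _ D30; rewrite ltr0n.
  have m3 : 0 < 3 / eps by apply: divr_gt0 _ eps0; rewrite ltr0n.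
  by exists (200 + 12 ^+ 3 / kap + 3 * D3 / eps + 3 / eps); split; lra.
pose N := (Num.truncn (expR M)).+1.
exists C0, N; split; first exact: C00.
move=> n p Delta V R0 Nn hp1 hp2 hD cV hR0; subst n.
set n : R := #|V|%:R in hp1 hp2 hD hR0 *.
pose l := ln n; rewrite -/l in hp1 hp2 hD.
have nM : expR M < n.
  apply: lt_le_trans (_ : N%:R <= _); first exact: truncnS_gt.
  by rewrite ler_nat.
have n0 : 0 < n by apply: lt_trans nM; apply: expR_gt0.
have lM : M < l by rewrite /l -[M]expRK ltr_ln ?posrE ?expR_gt0.
have l200 : 200 <= l by lra.
have l0 : 0 < l by lra.
have kl : 12 ^+ 3 <= kap * l.
  rewrite mulrC -ler_pdivrMr //; lra.
have le3 : 3 / eps <= l - 2 by lra.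
have lD3 : 3 * D3 / eps <= l by lra.
have nl : l ^+ 2 / 2 <= n.
  have -> : n = expR l by rewrite lnK // posrE.
  have := expR_ge1Dxn 1 (ltW l0); rewrite (_ : (2`!)%:R = 2 :> R) //.
  by apply: le_trans; rewrite lerDr.
have n100 : 100 * l <= n.
  have : 200 * l <= l * l by apply: ler_wpM2r => //; lra.
  rewrite -expr2; lra.
have pc : (c1 * l) ^+ 2 <= p * n.
  have := ler_wpM2r (ltW n0) hp1; rewrite exprMn.
  have -> // : c1 ^+ 2 / n * l ^+ 2 * n = c1 ^+ 2 * l ^+ 2 by field; rewrite gt_eqF.
have cl0 : 0 < c1 * l by rewrite mulr_gt0 //; lra.
have pn0 : 0 < p * n by apply: lt_le_trans pc; rewrite exprn_gt0.
have p0 : 0 < p by rewrite pmulr_lgt0 in pn0.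
have pnl : p ^+ 2 * n <= l.
  have hb : l `^ 4^-1 <= Num.sqrt l.
      have l1' : 1 <= l by lra.
    have q42 : 4^-1 <= 2^-1 :> R by lra.
    by rewrite -(powR12_sqrt (ltW l0)); exact: (ler_powR l1' q42).
  have ha : n `^ (- 2^-1) = (Num.sqrt n)^-1 by rewrite powRN powR12_sqrt // ltW.
  have h : p <= Num.sqrt l / Num.sqrt n.
    apply: le_trans hp2 _; rewrite ha mulrC.
    by apply: ler_wpM2r hb; rewrite invr_ge0 sqrtr_ge0.
  have : p ^+ 2 <= (Num.sqrt l / Num.sqrt n) ^+ 2.
    by apply: lerXn2r; rewrite ?nnegrE ?divr_ge0 ?sqrtr_ge0 // ltW.
  by rewrite expr_div_n (sqr_sqrtr (ltW l0)) (sqr_sqrtr (ltW n0)) ler_pdivlMr.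
have p10 : p <= 10^-1.
  rewrite -(ler_pXn2r (n := 2)) ?nnegrE ?invr_ge0 ?(ltW p0) //.
  rewrite -(ler_pM2r n0); apply: le_trans pnl _.
  have -> : (10^-1 : R) ^+ 2 = 100^-1 by field.
  lra.
have p01 : 0 <= p <= 1 by apply/andP; split; lra.
pose sd := Num.sqrt (p * n).
have sdE : sd ^+ 2 = p * n by rewrite sqr_sqrtr // ltW.
have sd0 : 0 < sd by rewrite sqrtr_gt0.
have sdc : c1 * l <= sd.
  by rewrite -(ler_pXn2r (n := 2)) ?nnegrE ?sdE // ltW.
have lsd : 160 * l <= sd by apply: le_trans sdc; apply: ler_wpM2r => //; exact: ltW.
have klsd : 64 / kap * l <= sd.
  by apply: le_trans sdc; apply: ler_wpM2r; rewrite ?lerDr // ltW.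
have sd1000 : 10 ^+ 3 <= sd by lra.
pose D : R := C0 * l / (p * sd).
have D0 : 0 <= D by apply: divr_ge0; apply: mulr_ge0; apply: ltW.
have hDD : D <= Delta.
  apply: le_trans hD; rewrite -[C0 * _ * _]mulrA thresholdE // -/sd /D.
  by rewrite -mulrA [l * _]mulrC mulrA.
have hR0' : n / 2 + D <= #|R0|%:R by lra.
have [S' [Q [SR0 QS' cSS' q1 q2]]] := split_coloring D0 hR0'.
have [e0 _] : exists e0 : vpair V, true.
  have /card_gt1P[x [y [_ _ xy]]] : (1 < #|V|)%N.
    by rewrite -(ltr_nat R) -/n; lra.
  have h : #|[set x; y]| == 2%N by rewrite cards2 xy.
  by exists (exist _ [set x; y] h).
set S := S' :|: Q in SR0 cSS'.
pose small G := #|red_set G S 2|%:R < n / 2 + 50 / sd * n.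
pose E (G : sgraph V) := ~~ (small G || (bad_day3 e0 sd G || bad_shrink e0 p G)).
have PE : 1 - eps <= Pr (fun=> p) E.
  rewrite PrC lerB //.
  apply: le_trans (PrU _ _ _) _ => //.
  have h1 : Pr (fun=> p) small <= eps / 3.
    apply: le_trans (day2_majority e0 p0 p10 sd1000 sdE QS' cSS' l200 lsd _ _ pnl _ _) _;
      rewrite -?kapE // -/D3.
    rewrite ler_pdivrMr //; move: lD3; rewrite ler_pdivrMr //; lra.
  have inv3 (y : R) : 3 / eps <= y -> expR (- y) <= eps / 3.
    move=> hy; have e30 : 0 < 3 / eps by apply: divr_gt0 _ eps0; rewrite ltr0n.
    have y0 : 0 < y by apply: lt_le_trans hy.
    apply: le_trans (_ : y^-1 <= _).
      rewrite expRN lef_pV2 ?posrE ?expR_gt0 //.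
      by apply: le_trans (expR_ge1Dx _); rewrite lerDr ler01.
    by rewrite -[leRHS]invrK invf_div lef_pV2 ?posrE.
  have h2 : Pr (fun=> p) (bad_day3 e0 sd) <= eps / 3.
    apply: le_trans (Pr_bad_day3 e0 p0 p10 sd1000 sdE) _; apply: inv3.
    rewrite -/n; lra.
  have h3 : Pr (fun=> p) (bad_shrink e0 p) <= eps / 3.
    apply: le_trans (Pr_bad_shrink e0 p0 p10 _) _; first by rewrite -/n; lra.
    by rewrite -/n -/l -opprB; apply: inv3.
  have -> : eps = eps / 3 + (eps / 3 + eps / 3) by field.
  apply: lerD h1 _.
  apply: le_trans (PrU _ _ _) _ => //; exact: lerD.
apply: le_trans PE _; apply: gnp_prob_ge => // G.
rewrite /E !negb_or -leNgt => /and3P[hS n3 n4] /=.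
have l1 : 1 <= ln (#|V|%:R : R) by rewrite -/n -/l; lra.
have [t tV tle] := blue_dies p0 sd1000 sdE l1 lsd p10 hS n3 n4.
exists (t + 2)%N; split; last first.
  apply/eqP; rewrite finset.eqEsubset finset.subsetT /= -tV.
  rewrite /red_set -iterD -/(red_set G S (t + 2)).
  exact: (red_set_mono e0).
rewrite /log_base natrD; move: tle; rewrite -/n -/l.
have lpn : 0 < ln (p * n).
  rewrite ln_gt0 // -sdE; apply: exprn_egt1 => //; lra.
have x1 : 1 <= l / ln (p * n).
  rewrite ler_pdivlMr // mul1r ler_ln ?posrE //.
  by rewrite ler_piMl //; lra.
lra.
Qed.
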